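(* Let $P$ be a very homogeneous polynomial of degree $(m^+,0)$, $g\in G$, $z=g^{-1}z_0$, and $\mu=-u'+\frac{u_{z^\perp}}{2u_{z^\perp}^2}+\frac{u_z}{2u_z^2}$, with $\mu_M$ its orthogonal projection to $M\otimes\mathbb R$. Then, identifying $\mathbb C[D_L^2]\cong\mathbb C[D_M^2]$, $$\Theta_{L,2}(\tau,g,P)=\frac1{2u_{z^\perp}^2}\sum_{c,d\in\mathbb Z^{1\times2}}\sum_{h_1,h_2}\exp\Big(-\frac{\pi}{2u_{z^\perp}^2}\mathrm{tr}\big((c\tau+d)^t(c\bar\tau+d)y^{-1}\big)\Big)\frac{[(c\bar\tau+d)y^{-1}]_1^{h_1}[(c\bar\tau+d)y^{-1}]_2^{h_2}}{(-2i)^{h_1+h_2}}\,\Theta_{M,2}(\tau,\mu_Md,-\mu_Mc,g_w,P_{g_w,h_1,h_2}),$$ where $[\,\cdot\,]_j$ is the $j$-th entry of a $1\times2$ row and $\mu_Mc=(c_1\mu_M,c_2\mu_M)$.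
   Context: Setup: $L$ even lattice of signature $(b,2)$, $L=M\oplus U$ orthogonally, $U$ spanned by $u,u'$ with $q(u)=q(u')=0$, $(u,u')=1$, so $M$ has signature $(b-1,1)$; orthogonal projection $L'\to M'$ induces an isomorphism $D_L\cong D_M$ ($D_L=L'/L$). $V=L\otimes\mathbb R$ with orthogonal basis $e_1,\dots,e_{b+2}$ ($(e_i,e_i)=1$ for $i\le b$, $-1$ otherwise), $G=\mathrm{SO}(V)$, $z_0=\mathrm{span}(e_{b+1},e_{b+2})$; pairs $\mathbf v\in V^2$, coordinates $x_{i,j}$ identify $V^2\cong\mathbb R^{(b+2)\times2}$; $q(\mathbf v)=((v_i,v_j)/2)$; $\mathrm{tr}(\mathbf v,\mathbf w)=(v_1,w_1)+(v_2,w_2)$; $e(t)=e^{2\pi it}$; $\tau=x+iy\in\mathbb H_2$; $\mathrm{tr}(\Delta y^{-1})=\sum_{i}\sum_{j,l}(y^{-1})_{jl}\partial^2/\partial x_{i,j}\partial x_{i,l}$ with $\exp(-\mathrm{tr}(\Delta y^{-1})/8\pi)$ the power series. Very homogeneous of degree $(m^+,0)$: $P$ depends only on the first $b$ rows and $P(\mathbf xN)=\det N^{m^+}P(\mathbf x)$ for $N\in\mathbb C^{2\times2}$. $\Theta_{L,2}(\tau,g,P)=\sum_{\sigma\in D_L^2}\det y\sum_{\boldsymbol\lambda\in\sigma+L^2}\exp(-\frac{1}{8\pi}\mathrm{tr}(\Delta y^{-1}))(P)(g\boldsymbol\lambda)e(\mathrm{tr}(q(\boldsymbol\lambda_{z^\perp})\tau)+\mathrm{tr}(q(\boldsymbol\lambda_z)\bar\tau))\mathfrak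 e_\sigma$. Let $w$ be the orthogonal complement of $u_z$ in $z$, $w^\perp$ that of $u_{z^\perp}$ in $z^\perp$, $g_w(v)=g(v_{w^\perp}+v_w)$. The split polynomials $P_{g_w,h_1,h_2}$ (on $g(w^\perp)^2$, extended to $V^2$ by precomposing with orthogonal projection) are uniquely determined by $P(g(\mathbf v))=\sum_{h_1,h_2}(v_1,u_{z^\perp})^{h_1}(v_2,u_{z^\perp})^{h_2}P_{g_w,h_1,h_2}(g_w(\mathbf v))$. For a polynomial $R$ on $\mathbb R^{(b+2)\times2}$ and $\boldsymbol\alpha,\boldsymbol\beta\in(M\otimes\mathbb R)^2$: $\Theta_{M,2}(\tau,\boldsymbol\alpha,\boldsymbol\beta,g_w,R)=\sum_{\sigma\in D_M^2}\det y^{1/2}\sum_{\boldsymbol\lambda\in\sigma+M^2}\exp(-\frac{1}{8\pi}\mathrm{tr}(\Delta y^{-1}))(R)(g_w(\boldsymbol\lambda+\boldsymbol\beta))\,e\big(\mathrm{tr}(q((\boldsymbol\lambda+\boldsymbol\beta)_{w^\perp})\tau)+\mathrm{tr}(q((\boldsymbol\lambda+\boldsymbol\beta)_w)\bar\tau)-\mathrm{tr}(\boldsymbol\lambda+\boldsymbol\beta/2,\boldsymbol\alpha)\big)\mathfrak e_\sigma$. *)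

(* Defs.v *)
From HB Require Import structures.
From mathcomp Require Import all_boot all_order all_algebra.
From mathcomp Require Import complex.
From mathcomp Require Import mpoly.
From mathcomp Require Import reals exp trigo sequences topology normedtype.
Set Implicit Arguments. Unset Strict Implicit. Unset Printing Implicit Defensive.
Import Order.TTheory GRing.Theory Num.Theory.
Import numFieldNormedType.Exports.
Local Open Scope ring_scope.
Local Open Scope complex_scope.

Section ThetaDefs.
Variable R : realType.
Local Notation C := R[i].
Variable b : nat.
Local Notation n := b.+2.

Definition toC (x : R) : C := x%:C.
Definition toCM p q (A : 'M[R]_(p,q)) : 'M[C]_(p,q) := map_mx toC A.
Definition reM p q (A : 'M[C]_(p,q)) : 'M[R]_(p,q) := map_mx (@complex.Re R) A.
Definition imM p q (A : 'M[C]_(p,q)) : 'M[R]_(p,q) := map_mx (@complex.Im R) A.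
Definition conjM p q (A : 'M[C]_(p,q)) : 'M[C]_(p,q) := map_mx conjc A.

Definition Qf : 'M[R]_n := diag_mx (\row_(i < n) if (i < b)%N then 1 else -1).
Definition bil (v w : 'cV[R]_n) : R := (v^T *m Qf *m w) 0 0.
(* pairs v = (v_1,v_2) in V^2 are n x 2 matrices (columns v_1, v_2) *)
Definition qpair (X : 'M[R]_(n,2)) : 'M[R]_2 := 2^-1 *: (X^T *m Qf *m X).
Definition trpair (X Y : 'M[R]_(n,2)) : R := \tr (X^T *m Qf *m Y).

Definition cols (P : 'cV[R]_n -> Prop) (X : 'M[R]_(n,2)) := forall j, P (col j X).

Definition inLat (B : 'M[R]_n) (v : 'cV[R]_n) :=
  exists k : 'cV[int]_n, v = B *m map_mx (fun m : int => m%:~R) k.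
Definition even_lattice (B : 'M[R]_n) :=
  B \in unitmx /\
  (forall v w, inLat B v -> inLat B w -> bil v w \is a Num.int) /\
  (forall v, inLat B v -> bil v v / 2 \is a Num.int).
Definition inDual (B : 'M[R]_n) (v : 'cV[R]_n) :=
  forall l, inLat B l -> bil v l \is a Num.int.
(* M = L cap U^perp, M (x) R = U^perp, M' its dual in M (x) R *)
Definition inMR (u u' v : 'cV[R]_n) := bil v u = 0 /\ bil v u' = 0.
Definition inM B (u u' v : 'cV[R]_n) := inLat B v /\ inMR u u' v.
Definition inDualM B (u u' v : 'cV[R]_n) :=
  inMR u u' v /\ forall l, inM B u u' l -> bil v l \is a Num.int.
(* orthogonal projection V -> M (x) R (U has Gram matrix [[0,1],[1,0]]) *)
Definition projM (u u' v : 'cV[R]_n) : 'cV[R]_n := v - bil v u' *: u - bil v u *: u'.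
Definition projMpair (u u' : 'cV[R]_n) (X : 'M[R]_(n,2)) : 'M[R]_(n,2) :=
  \matrix_(i, j) (projM u u' (col j X)) i 0.

Definition siegel (t : 'M[C]_2) :=
  t^T = t /\ forall v : 'rV[R]_2, v != 0 -> 0 < (v *m imM t *m v^T) 0 0.

Definition isSO (g : 'M[R]_n) := g^T *m Qf *m g = Qf /\ \det g = 1.

(* orthogonal projection onto z0 = span(e_{b+1}, e_{b+2}) *)
Definition P0 : 'M[R]_n := diag_mx (\row_(i < n) if (i < b)%N then 0 else 1).
(* orthogonal projections onto z = g^{-1} z0 and z^perp *)
Definition Pz (g : 'M[R]_n) : 'M[R]_n := invmx g *m P0 *m g.
Definition Pzp (g : 'M[R]_n) : 'M[R]_n := 1%:M - Pz g.
Definition Pline (a : 'cV[R]_n) : 'M[R]_n := (bil a a)^-1 *: (a *m (a^T *m Qf)).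
(* w = complement of u_z in z;  w^perp = complement of u_{z^perp} in z^perp *)
Definition Pw (g : 'M[R]_n) (u : 'cV[R]_n) : 'M[R]_n :=
  Pz g - Pline (Pz g *m u) *m Pz g.
Definition Pwp (g : 'M[R]_n) (u : 'cV[R]_n) : 'M[R]_n :=
  Pzp g - Pline (Pzp g *m u) *m Pzp g.
Definition gw (g : 'M[R]_n) (u : 'cV[R]_n) (X : 'M[R]_(n,2)) : 'M[R]_(n,2) :=
  g *m (Pwp g u *m X + Pw g u *m X).
Definition Pgwp (g : 'M[R]_n) (u : 'cV[R]_n) : 'M[R]_n := g *m Pwp g u *m invmx g.

(* polynomials on R^{(b+2) x 2} with complex coefficients, variable x_{i,j}
   indexed by mxvec_index i j *)
Local Notation poly := (mpoly.mpoly (n * 2) C).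
Definition pevalC (p : poly) (X : 'M[C]_(n,2)) : C :=
  mpoly.meval (fun k => (mxvec X) 0 k) p.
Definition peval (p : poly) (X : 'M[R]_(n,2)) : C := pevalC p (toCM X).
(* 1 + total degree of p (0 if p = 0), i.e. msize p *)
Definition psize (p : poly) : nat :=
  (\max_(m <- mpoly.msupp p) (mpoly.mdeg m).+1)%N.
Definition lapl (yi : 'M[R]_2) (p : poly) : poly :=
  \sum_(i < n) \sum_(j < 2) \sum_(l < 2)
     toC (yi j l) *: mpoly.mderiv (mxvec_index i j) (mpoly.mderiv (mxvec_index i l) p).
Definition lapl_iter (k : nat) (yi : 'M[R]_2) (p : poly) : poly := iter k (lapl yi) p.
(* exp(-tr(Delta y^{-1})/8pi)(p): the power series is finite on polynomials
   (each application of lapl lowers the total degree by 2) *)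
Definition expcoef (k : nat) : C := toC ((- (8 * pi)^-1) ^+ k / (k`!)%:R).
Definition expLap (yi : 'M[R]_2) (p : poly) : poly :=
  \sum_(k < (psize p).+1)
     expcoef k *: lapl_iter k yi p.

Definition very_homog (m : nat) (p : poly) :=
  (forall X Y : 'M[R]_(n,2),
      (forall (i : 'I_n) (j : 'I_2), (i < b)%N -> X i j = Y i j) ->
      peval p X = peval p Y) /\
  (forall (X : 'M[R]_(n,2)) (N : 'M[C]_2),
      pevalC p (toCM X *m N) = \det N ^+ m * peval p X).

Definition split_polys (g : 'M[R]_n) (u : 'cV[R]_n) (m : nat) (p : poly)
    (Ps : 'I_m.+1 -> 'I_m.+1 -> poly) :=
  (forall h1 h2 (X : 'M[R]_(n,2)), peval (Ps h1 h2) X = peval (Ps h1 h2) (Pgwp g u *m X)) /\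
  (forall X : 'M[R]_(n,2),
     peval p (g *m X) =
     \sum_(h1 < m.+1) \sum_(h2 < m.+1)
        toC (bil (col 0 X) (Pzp g *m u) ^+ h1 * bil (col 1 X) (Pzp g *m u) ^+ h2)
        * peval (Ps h1 h2) (gw g u X)).

Definition cexp (z : C) : C := toC (expR (complex.Re z)) * (cos (complex.Im z) +i* sin (complex.Im z)).
Definition ee (t : C) : C := cexp (2%:R * toC pi * 'i * t).

(* sums over Z^{p x q}: limit of the sums over the boxes [-N,N]^{p x q}
   (limit of real and imaginary parts) *)
Definition clim (s : nat -> C) : C :=
  (limn (fun N => complex.Re (s N))) +i* (limn (fun N => complex.Im (s N))).
Definition box_sum p q (N : nat) (f : 'M[int]_(p,q) -> C) : C :=
  \sum_(K : 'M['I_(N.*2.+1)]_(p,q))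
     f (map_mx (fun k : 'I_(N.*2.+1) => (k%:Z - N%:Z)%R) K).
Definition zsum p q (f : 'M[int]_(p,q) -> C) : C := clim (fun N => box_sum N f).

Definition intM p q (K : 'M[int]_(p,q)) : 'M[R]_(p,q) := map_mx (fun m : int => m%:~R) K.

(* sigma-component of Theta_{L,2}(tau, g, P), sigma in L'^2 *)
Definition ThetaL (B g : 'M[R]_n) (tau : 'M[C]_2) (p : poly) (sigma : 'M[R]_(n,2)) : C :=
  let y := imM tau in
  toC (\det y) *
  zsum (fun K : 'M[int]_(n,2) =>
    let lam := sigma + B *m intM K in
    peval (expLap (invmx y) p) (g *m lam) *
    ee (\tr (toCM (qpair (Pzp g *m lam)) *m tau)
        + \tr (toCM (qpair (Pz g *m lam)) *m conjM tau))).

(* sigma-component of Theta_{M,2}(tau, alpha, beta, g_w, r), sigma in M'^2;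
   lambda ranges over sigma + M^2, enumerated inside sigma + L^2 *)
Definition ThetaM (B g : 'M[R]_n) (u u' : 'cV[R]_n) (tau : 'M[C]_2)
    (alpha beta : 'M[R]_(n,2)) (r : poly) (sigma : 'M[R]_(n,2)) : C :=
  let y := imM tau in
  toC (Num.sqrt (\det y)) *
  zsum (fun K : 'M[int]_(n,2) =>
    let l := B *m intM K in
    if [forall j : 'I_2, (bil (col j l) u == 0) && (bil (col j l) u' == 0)] then
      let lam := sigma + l in
      let lb := lam + beta in
      peval (expLap (invmx y) r) (gw g u lb) *
      ee (\tr (toCM (qpair (Pwp g u *m lb)) *m tau)
          + \tr (toCM (qpair (Pw g u *m lb)) *m conjM tau)
          - toC (trpair (lam + 2^-1 *: beta) alpha))
    else 0).

End ThetaDefs.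
Arguments intM {R p q} K.

(* Main.v *)
(**
Write a vector of sigma + L^2 as lam_M + u' c + u e with lam_M in sigma_M + M^2 and integral c, e in Z^(1x2). For fixed (lam_M, c) the exponent is, up to a term depending on the w and w^perp components only, a Gaussian in t = (lam, u_(z^perp)) = t_0 + a e with a = u_(z^perp)^2, and Poisson summation over e produces the variable d.

The polynomial weight is handled as follows. Each P_(h1,h2) is constant in the direction v = g u_(z^perp), so exp(-tr(Delta y^-1)/8 pi) is multiplicative on the products l_1^h1 l_2^h2 P_(h1,h2), where l_j is the pairing of the j-th column with v. On the powers of a linear form l_1 + x l_2 it produces Hermite polynomials, that is, the coefficients in s of exp(s l + rho s^2); hence the weighted Poisson formula is obtained from the unweighted one, with a complex shift proportional to s, by comparing power series in s. Monomials are recovered from the powers of l_1 + x l_2 by inverting a Vandermonde matrix.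

The Gaussian Poisson formula itself follows from Polya's identity: the mean of cos^(2m) over shifted roots of unity is a sum of binomial coefficients, and both sides tend to Gaussian sums by dominated convergence. The normalising constant comes from the self-dual case, complex shifts from uniqueness of power series, and two variables from iterating one.

All sums are unconditional limits over finite index sets; the Gaussian majorants justify every interchange.
*)
Require Import Defs.
From HB Require Import structures.
From mathcomp Require Import all_boot all_order all_algebra complex.
From mathcomp Require Import mpoly.
From mathcomp Require Import boolp classical_sets reals exp trigo sequences topology normedtype derive realfun.
From mathcomp Require Import ring lra zify.
Set Implicit Arguments. Unset Strict Implicit. Unset Printing Implicit Defensive.
Import Order.TTheory GRing.Theory Num.Theory numFieldNormedType.Exports.
Local Open Scope ring_scope.
Local Open Scope complex_scope.

(** * Unconditional sums of complex numbers *)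

Section Cabs.
Variable R : realType.
Local Notation C := R[i].
Implicit Types z w : C.

(** [zsum] is a limit over boxes in the coordinates of [B], and no box survives the passage to
    (lam_M, c, e), the exchange of e for d, or the final summation over lam_M inside the sum over
    (c, d). Sums are therefore handled without any order, and boxes come back only through [zsumE].
    Isotropy of u forces u_z^2 = -a. Hence (lam, u_z) = c - t, and the two definite lines together
    contribute i t y t^t / a plus terms of lower degree in t, a Gaussian whatever the real part of
    tau. The 8 pi of the operator is the value that makes the Poisson formula close up. A weight
    exp(s l + rho s^2) turns under summation into one whose exponent is linear in s exactly for one
    value of rho, and this is the rho that exp(-tr(Delta y^-1)/8 pi) attaches to powers of a linear
    form. Hermite polynomials on one side thus face plain powers of (c taubar + d) y^-1 / (-2i) on
    the other. Since t runs over a translate of a Z^2, the Poisson constant is 2 a sqrt(det y). One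
    root of det y then remains as the weight of Theta_M, and the factor 1 / (2a) appears in
    front. *)

Definition cabs z : R := complex.Re `|z|.

Lemma cabsE z : (cabs z)%:C = `|z|.
Proof. by rewrite /cabs normc_def. Qed.

Lemma cabs_inj x (y : R) : x%:C = y%:C :> C -> x = y.
Proof. by case. Qed.

Lemma cabs_ge0 z : 0 <= cabs z.
Proof. by rewrite -ler0c cabsE. Qed.

Lemma cabs0 : cabs 0 = 0.
Proof. by apply: cabs_inj; rewrite cabsE normr0. Qed.

Lemma cabs1 : cabs 1 = 1.
Proof. by apply: cabs_inj; rewrite cabsE normr1. Qed.

Lemma cabsN z : cabs (- z) = cabs z.
Proof. by rewrite /cabs normrN. Qed.

Lemma cabsBC z w : cabs (z - w) = cabs (w - z).
Proof. by rewrite /cabs distrC. Qed.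

Lemma cabsM z w : cabs (z * w) = cabs z * cabs w.
Proof. by apply: cabs_inj; rewrite rmorphM /= !cabsE normrM. Qed.

Lemma cabsX z k : cabs (z ^+ k) = cabs z ^+ k.
Proof. by apply: cabs_inj; rewrite rmorphXn /= !cabsE normrX. Qed.

Lemma cabsV z : cabs (z^-1) = (cabs z)^-1.
Proof. by apply: cabs_inj; rewrite fmorphV /= !cabsE normfV. Qed.

Lemma cabs_eq0 z : (cabs z == 0) = (z == 0).
Proof.
apply/eqP/eqP => [h|->]; last exact: cabs0.
by apply/eqP; rewrite -normr_eq0 -cabsE h.
Qed.

Lemma cabsD z w : cabs (z + w) <= cabs z + cabs w.
Proof. by rewrite -lecR rmorphD /= !cabsE ler_normD. Qed.

Lemma cabs_triB z w t : cabs (z - t) <= cabs (z - w) + cabs (w - t).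
Proof. by rewrite -[z - t](subrKA w) cabsD. Qed.

Lemma cabs_real (x : R) : cabs x%:C = `|x|.
Proof. by rewrite /cabs normc_def /= expr0n addr0 sqrtr_sqr. Qed.

Lemma cabs_nat k : cabs k%:R = k%:R.
Proof. by apply: cabs_inj; rewrite cabsE normr_nat rmorph_nat. Qed.

Lemma cabs_sum (I : Type) (r : seq I) (F : I -> C) :
  cabs (\sum_(i <- r) F i) <= \sum_(i <- r) cabs (F i).
Proof.
elim/big_rec2: _ => [|i y x _ le]; first by rewrite cabs0.
by apply: le_trans (cabsD _ _) _; rewrite lerD2l.
Qed.

Lemma cabs_Re z : `|complex.Re z| <= cabs z.
Proof. by rewrite -lecR cabsE normc_ge_Re. Qed.

Lemma cabs_Im z : `|complex.Im z| <= cabs z.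
Proof.
case: z => x y /=; rewrite /cabs normc_def /= -sqrtr_sqr.
by rewrite ler_wsqrtr // lerDr sqr_ge0.
Qed.

Lemma cabs_lt_eq z w : (forall e : R, 0 < e -> cabs (z - w) < e) -> z = w.
Proof.
move=> h; apply/eqP; rewrite -subr_eq0 -cabs_eq0; apply: contraT => n0.
by have := h (cabs (z - w)); rewrite lt0r n0 cabs_ge0 ltxx => /(_ isT).
Qed.

End Cabs.

Section Hsum.
Variable R : realType.
Local Notation C := R[i].

Lemma ler_sum_sub (I : eqType) (f : I -> R) (K L : seq I) :
  uniq K -> uniq L -> {subset K <= L} -> (forall i, 0 <= f i) ->
  \sum_(i <- K) f i <= \sum_(i <- L) f i.
Proof.
move=> uK uL sKL f0.
rewrite [leRHS](bigID (mem K)) /= -[X in _ <= X + _]big_filter.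
rewrite (perm_big [seq i <- L | i \in K]) /=; first by rewrite lerDl sumr_ge0.
apply: uniq_perm; rewrite ?filter_uniq// => i; rewrite mem_filter /=.
by case: (boolP (i \in K)) => //= /sKL.
Qed.

(** Limit along the directed set of finite subsets, given by duplicate-free lists; unlike a limit
    over boxes it is invariant under reindexing. For nonnegative terms, [bsum] below is
    summability. *)
Definition hsum (I : choiceType) (f : I -> C) (s : C) :=
  forall e : R, 0 < e -> exists J0 : seq I,
    forall J, uniq J -> {subset J0 <= J} -> cabs (\sum_(i <- J) f i - s) < e.

Definition bsum (I : choiceType) (f : I -> R) :=
  exists M, forall J, uniq J -> \sum_(i <- J) f i <= M.

Lemma hsum_unique (I : choiceType) (f : I -> C) s t :
  hsum f s -> hsum f t -> s = t.
Proof.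
move=> hs ht; apply: cabs_lt_eq => e e0.
have e2 : 0 < e / 2 by rewrite divr_gt0.
have [J1 h1] := hs _ e2; have [J2 h2] := ht _ e2.
pose J := undup (J1 ++ J2).
have uJ : uniq J by exact: undup_uniq.
have s1 : {subset J1 <= J} by move=> i iJ; rewrite mem_undup mem_cat iJ.
have s2 : {subset J2 <= J} by move=> i iJ; rewrite mem_undup mem_cat iJ orbT.
have := ltrD (h1 J uJ s1) (h2 J uJ s2); rewrite -splitr; apply: le_lt_trans.
by rewrite (cabsBC _ s) cabs_triB.
Qed.

Lemma eq_hsum (I : choiceType) (f g : I -> C) s : f =1 g -> hsum f s -> hsum g s.
Proof.
move=> fg h e /h[J0 h0]; exists J0 => J uJ sJ.
by under eq_bigr do rewrite -fg; exact: h0.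
Qed.

Lemma hsum_fin (I : choiceType) (f : I -> C) (J : seq I) :
  uniq J -> (forall i, i \notin J -> f i = 0) -> hsum f (\sum_(i <- J) f i).
Proof.
move=> uJ f0 e e0; exists J => K uK sJK.
rewrite (bigID (mem J)) /= [X in _ + X - _]big1 => [|i]; last exact: f0.
rewrite addr0 -big_filter (perm_big J) ?subrr ?cabs0//.
apply: uniq_perm; rewrite ?filter_uniq// => i; rewrite mem_filter /=.
by case: (boolP (i \in J)) => //= /sJK.
Qed.

Lemma hsum0 (I : choiceType) : hsum (fun _ : I => 0) 0.
Proof. by have := @hsum_fin I (fun=> 0) [::] isT (fun _ _ => erefl); rewrite big_nil. Qed.

Lemma hsumD (I : choiceType) (f g : I -> C) s t :
  hsum f s -> hsum g t -> hsum (fun i => f i + g i) (s + t).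
Proof.
move=> hs ht e e0; have e2 : 0 < e / 2 by rewrite divr_gt0.
have [J1 h1] := hs _ e2; have [J2 h2] := ht _ e2.
exists (J1 ++ J2) => J uJ sJ.
have s1 : {subset J1 <= J} by move=> i iJ; rewrite sJ// mem_cat iJ.
have s2 : {subset J2 <= J} by move=> i iJ; rewrite sJ// mem_cat iJ orbT.
have := ltrD (h1 J uJ s1) (h2 J uJ s2); rewrite -splitr; apply: le_lt_trans.
by rewrite big_split /= opprD addrACA cabsD.
Qed.

Lemma hsumZ (I : choiceType) (f : I -> C) s c :
  hsum f s -> hsum (fun i => c * f i) (c * s).
Proof.
move=> hs e e0; have c0 : 0 < cabs c + 1 by rewrite ltr_wpDl ?cabs_ge0.
have [J0 h] := hs (e / (cabs c + 1)) (divr_gt0 e0 c0).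
exists J0 => J uJ /(h J uJ); rewrite -big_distrr /= -mulrBr cabsM ltr_pdivlMr// => le.
apply: le_lt_trans le; rewrite mulrC ler_wpM2l ?cabs_ge0//.
by rewrite lerDl.
Qed.

Lemma hsumZr (I : choiceType) (f : I -> C) s c :
  hsum f s -> hsum (fun i => f i * c) (s * c).
Proof.
by move=> /(hsumZ c); rewrite mulrC; apply: eq_hsum => i; rewrite mulrC.
Qed.

Lemma hsum_sum (I : choiceType) (K : Type) (r : seq K) (f : K -> I -> C) (s : K -> C) :
  (forall k, hsum (f k) (s k)) ->
  hsum (fun i => \sum_(k <- r) f k i) (\sum_(k <- r) s k).
Proof.
move=> h; elim: r => [|k r IH].
  by rewrite big_nil; apply: eq_hsum (@hsum0 I) => i; rewrite big_nil.
by rewrite big_cons; apply: eq_hsum (hsumD (h k) IH) => i; rewrite big_cons.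
Qed.

(** Reindexing and extension by zero in one: the image of [g] only has to contain the support of
    [f]. A partial inverse of [g], obtained by choice, pulls finite sets back. *)
Lemma hsum_inj (I J : choiceType) (g : I -> J) (f : J -> C) s :
  injective g -> (forall j, f j != 0 -> exists i, j = g i) ->
  hsum (fun i => f (g i)) s -> hsum f s.
Proof.
move=> gI f0 h.
pose gi j := if pselect (exists i, j = g i) is left ex then Some (sval (cid ex)) else None.
have giK : ocancel gi g.
  by move=> j; rewrite /gi; case: pselect => //= ex; case: (cid ex).
have gK : pcancel g gi.
  move=> i; rewrite /gi; case: pselect => [ex|[]]; last by exists i.
  by case: cid => /= k /gI ->.
move=> e /h[J0 h0]; exists (map g J0) => K uK sK.
have -> : \sum_(j <- K) f j = \sum_(i <- pmap gi K) f (g i).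
  elim: K {uK sK} => [|j K IH]; first by rewrite !big_nil.
  rewrite big_cons /=; move: (giK j); case E: (gi j) => [i|] /=.
    by move=> gij; rewrite big_cons IH gij.
  move=> _; rewrite IH; case: (eqVneq (f j) 0) => [->|/f0[i ji]]; first by rewrite add0r.
  by move: E; rewrite ji gK.
apply: h0; first exact: pmap_uniq giK _ uK.
by move=> i iJ; rewrite mem_pmap -gK map_f// sK// map_f.
Qed.

Lemma hsum_bij (I J : choiceType) (g : I -> J) (g' : J -> I) (f : J -> C) s :
  cancel g g' -> cancel g' g ->
  hsum (fun i => f (g i)) s -> hsum f s.
Proof.
move=> gK gK'; apply: hsum_inj; first exact: can_inj gK.
by move=> j _; exists (g' j).
Qed.

(** Over a finite set of rows, each row sum is approximated by a finite piece that contains the part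
    of [J0] in that row; the union of the pieces is a finite set of pairs on which the double sum is
    already close to its limit. *)
Lemma hsum_fubini (I J : choiceType) (f : I -> J -> C) (h : I -> C) S :
  hsum (fun p : I * J => f p.1 p.2) S -> (forall i, hsum (f i) (h i)) -> hsum h S.
Proof.
move=> hS hh e e0; have e2 : 0 < e / 2 by rewrite divr_gt0.
have [J0 h0] := hS _ e2; exists (map fst J0) => I' uI sI.
(* The error is shared among the rows; the successor keeps the denominator positive when there are
   none. *)
have d0 : 0 < e / 2 / (size I').+1%:R by rewrite divr_gt0 ?ltr0Sn.
have /boolp.choice[K hK] i : exists K, [/\ uniq K, {subset [seq p.2 | p <- J0 & p.1 == i] <= K} &
    cabs (\sum_(j <- K) f i j - h i) < e / 2 / (size I').+1%:R].
  have [K0 hK] := hh i _ d0.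
  exists (undup (K0 ++ [seq p.2 | p <- J0 & p.1 == i])); split.
  - exact: undup_uniq.
  - by move=> j jJ; rewrite mem_undup mem_cat jJ orbT.
  - by apply: hK => [|j jJ]; rewrite ?undup_uniq// mem_undup mem_cat jJ.
pose L := [seq (i, j) | i <- I', j <- K i].
have uL : uniq L.
  apply: allpairs_uniq_dep => //; first by move=> i _; case: (hK i).
  by move=> [i j] [i' j'] _ _ /= [-> ->].
have sL : {subset J0 <= L}.
  move=> [i j] ij; apply/allpairsPdep; exists i, j; split=> //.
    by apply: sI; apply/mapP; exists (i, j).
  case: (hK i) => _ sK _; apply: sK; apply/mapP; exists (i, j) => //.
  by rewrite mem_filter eqxx.
have := h0 L uL sL; rewrite /L big_allpairs_dep /= => lt1.
rewrite (splitr e); apply: le_lt_trans (cabs_triB _ (\sum_(i <- I') \sum_(j <- K i) f i j) _) _.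
apply: ler_ltD => //; rewrite cabsBC -sumrB.
apply: le_trans (cabs_sum _ _) _.
apply: (@le_trans _ _ (\sum_(i <- I') e / 2 / (size I').+1%:R)).
  by apply: ler_sum => i _; case: (hK i) => _ _ /ltW.
rewrite big_const_seq count_predT iter_addr_0.
have aux (d : R) k : 0 < d -> d / k.+1%:R *+ k <= d.
  move=> dp; rewrite -(mulr_natr _ k) mulrAC ler_pdivrMr ?ltr0Sn//.
  by apply: ler_wpM2l; [exact: ltW | rewrite ler_nat].
exact: aux.
Qed.

Lemma hsum_swap (I J : choiceType) (f : I * J -> C) S :
  hsum f S -> hsum (fun p : J * I => f (p.2, p.1)) S.
Proof.
move=> h; apply: (@hsum_bij _ _ (fun p => (p.2, p.1)) (fun p => (p.2, p.1))).
- by case.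
- by case.
- by apply: eq_hsum h => -[].
Qed.

Lemma hsum_le (I : choiceType) (f : I -> C) s M :
  (forall J, uniq J -> \sum_(i <- J) cabs (f i) <= M) -> hsum f s -> cabs s <= M.
Proof.
move=> hM h; apply/ler_addgt0Pr => e /h[J0 h0].
have sJ : {subset J0 <= undup J0} by move=> i; rewrite mem_undup.
have := h0 _ (undup_uniq _) sJ; have := hM _ (undup_uniq J0).
set S := \sum_(i <- _) f i => hS lt.
have -> : s = S - (S - s) by rewrite subKr.
apply: le_trans (cabsD _ _) _; rewrite cabsN lerD// ?(ltW lt)//.
exact: le_trans (cabs_sum _ _) hS.
Qed.

(** The sum is the supremum of the finite partial sums, which increase with the index set. *)
Lemma hsum_pos_ex (I : choiceType) (f : I -> R) :
  (forall i, 0 <= f i) -> bsum f -> exists s, hsum (fun i => (f i)%:C) s.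
Proof.
move=> f0 [M hM].
pose A := [set x | exists2 J, uniq J & x = \sum_(i <- J) f i]%classic.
have hA : has_sup A.
  split; first by exists 0, [::]; rewrite ?big_nil.
  by exists M => _ [J uJ ->]; exact: hM.
exists (sup A)%:C => e e0.
have [_ [J0 uJ0 ->] lt] := sup_adherent e0 hA.
exists J0 => J uJ sJ; rewrite -rmorph_sum -rmorphB cabs_real ltr_distl.
have le : \sum_(i <- J) f i <= sup A.
  by apply: ub_le_sup; [case: hA|exists J].
have le2 : \sum_(i <- J0) f i <= \sum_(i <- J) f i.
  exact: ler_sum_sub.
by rewrite (lt_le_trans lt le2) (le_lt_trans le)// ltrDl.
Qed.

Lemma le_bsum (I : choiceType) (f g : I -> R) :
  (forall i, f i <= g i) -> bsum g -> bsum f.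
Proof.
by move=> fg [M h]; exists M => J /h; apply: le_trans; exact: ler_sum.
Qed.

Lemma bsumZ (I : choiceType) (f : I -> R) c : 0 <= c -> bsum f -> bsum (fun i => c * f i).
Proof.
move=> c0 [M h]; exists (c * M) => J /h hJ.
by rewrite -big_distrr /= ler_wpM2l.
Qed.

Lemma bsumD (I : choiceType) (f g : I -> R) : bsum f -> bsum g -> bsum (fun i => f i + g i).
Proof.
move=> [M h] [N k]; exists (M + N) => J uJ.
by rewrite big_split /= lerD// ?h ?k.
Qed.

Lemma bsum_sum (I : choiceType) (J : Type) (s : seq J) (f : J -> I -> R) :
  (forall j, bsum (f j)) -> bsum (fun i => \sum_(j <- s) f j i).
Proof.
move=> h; elim: s => [|j s IH].
  by exists 0 => J' _; rewrite big1// => i _; rewrite big_nil.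
by apply: le_bsum (bsumD (h j) IH) => i; rewrite big_cons.
Qed.

(** Real and imaginary parts are each split into positive and negative parts, all dominated by the
    modulus. *)
Lemma hsum_ex (I : choiceType) (f : I -> C) :
  bsum (fun i => cabs (f i)) -> exists s, hsum f s.
Proof.
move=> bf.
have part (p : C -> R) : (forall z, `|p z| <= cabs z) -> exists s, hsum (fun i => (p (f i))%:C) s.
  move=> hp.
  have [||s hs] := @hsum_pos_ex _ (fun i => Num.max (p (f i)) 0).
  - by move=> i; rewrite le_max lexx orbT.
  - apply: le_bsum bf => i; rewrite ge_max cabs_ge0 andbT.
    exact: le_trans (ler_norm _) (hp _).
  have [||t ht] := @hsum_pos_ex _ (fun i => Num.max (- p (f i)) 0).
  - by move=> i; rewrite le_max lexx orbT.
  - apply: le_bsum bf => i; rewrite ge_max cabs_ge0 andbT.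
    by apply: le_trans (ler_norm _) _; rewrite normrN.
  exists (s + (-1) * t); apply: eq_hsum (hsumD hs (hsumZ (-1) ht)) => i.
  rewrite mulN1r -rmorphB; congr (_%:C).
  by rewrite /Num.max; do 2![case: ltP => ?]; lra.
have [s hs] := part _ (@cabs_Re R); have [t ht] := part _ (@cabs_Im R).
exists (s + 'i * t); apply: eq_hsum (hsumD hs (hsumZ 'i ht)) => i.
by rewrite -complexE.
Qed.

Lemma bsum_inj (I J : choiceType) (g : I -> J) (f : J -> R) :
  injective g -> bsum f -> bsum (fun i => f (g i)).
Proof.
move=> gI [M h]; exists M => K uK.
by have := h (map g K); rewrite big_map map_inj_uniq//; apply.
Qed.

(** A finite set of pairs lies in the product of its two projections, so bounds on finite pieces of
    rows suffice. *)
Lemma bsum_pair (I J : choiceType) (f : I * J -> R) (g : I -> R) :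
  (forall p, 0 <= f p) ->
  (forall i K, uniq K -> \sum_(j <- K) f (i, j) <= g i) -> bsum g -> bsum f.
Proof.
move=> f0 fg [M h]; exists M => K uK.
have := h (undup (map fst K)) (undup_uniq _); apply: le_trans.
pose L := [seq (i, j) | i <- undup (map fst K), j <- undup (map snd K)].
apply: (@le_trans _ _ (\sum_(p <- L) f p)).
  apply: ler_sum_sub => //.
    by apply: allpairs_uniq; rewrite ?undup_uniq// => -[? ?] [? ?] _ _ /= [-> ->].
  move=> [i j] p; apply/allpairsP; exists (i, j); rewrite !mem_undup.
  by split=> //; apply/mapP; exists (i, j).
by rewrite big_allpairs; apply: ler_sum => i _; rewrite fg// undup_uniq.
Qed.

End Hsum.

(** * Sums over integer matrices *)

Section Zsum.
Variable R : realType.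
Local Notation C := R[i].

Definition boxM p q (N : nat) : seq 'M[int]_(p,q) :=
  [seq map_mx (fun k : 'I_(N.*2.+1) => (k%:Z - N%:Z)%R) K | K : 'M['I_(N.*2.+1)]_(p,q)].

Lemma box_shift_inj p q N :
  injective (fun K : 'M['I_(N.*2.+1)]_(p,q) => map_mx (fun k : 'I_(N.*2.+1) => (k%:Z - N%:Z)%R) K).
Proof.
move=> K L /matrixP h; apply/matrixP => i j; have := h i j; rewrite !mxE.
by move=> /addIr [] /ord_inj.
Qed.

Lemma uniq_boxM p q N : uniq (boxM p q N).
Proof. by rewrite map_inj_uniq ?enum_uniq//; exact: box_shift_inj. Qed.

Lemma mem_boxM p q N (K : 'M[int]_(p,q)) :
  (forall i j, (`|K i j| <= N)%N) -> K \in boxM p q N.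
Proof.
move=> h; apply/mapP.
exists (\matrix_(i, j) inord `|(K i j + N%:Z)%R|%N); first by rewrite mem_enum.
apply/matrixP => i j; rewrite !mxE; move: (K i j) (h i j) => k hk.
by rewrite inordK; lia.
Qed.

Lemma boxM_sup p q (J : seq 'M[int]_(p,q)) :
  exists N0, forall N, (N0 <= N)%N -> {subset J <= boxM p q N}.
Proof.
exists (\max_(K <- J) \max_i \max_j `|K i j|)%N => N le K KJ.
apply: mem_boxM => i j; apply: leq_trans le.
apply: leq_trans (leq_bigmax_seq _ KJ _) => //.
by apply: leq_trans (leq_bigmax i); apply: leq_trans (leq_bigmax j).
Qed.

(** Boxes are finite sets that eventually contain any given finite set, so the limit over boxes is
    the unordered sum whenever the latter exists. *)
Lemma zsumE p q (f : 'M[int]_(p,q) -> C) s : hsum f s -> zsum f = s.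
Proof.
move=> h.
have bE N : box_sum N f = \sum_(K <- boxM p q N) f K.
  by rewrite /boxM big_image.
have lim (pr : C -> R) : (forall z, `|pr z| <= cabs z) -> (forall z w, pr (z - w) = pr z - pr w) ->
    limn (fun N => pr (box_sum N f)) = pr s.
  move=> pr1 pr2; apply: cvg_lim => //; apply/cvgrPdist_lt => e /h[J0 hJ].
  have [N0 hN] := boxM_sup J0.
  exists N0 => // N /= /hN sN; rewrite distrC -pr2 bE.
  by apply: le_lt_trans (pr1 _) _; apply: hJ; rewrite ?uniq_boxM.
rewrite /zsum /clim (lim (@complex.Re R)) ?(lim (@complex.Im R)); first by case: (s).
all: try by case=> ? ? [].
- exact: cabs_Im.
- exact: cabs_Re.
Qed.

(** A summable weight with which the Gaussians over the integers are compared. *)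
Definition wt (k : int) : R := (1 + k%:~R ^+ 2)^-1.

Lemma wt_gt0 k : 0 < wt k.
Proof. by rewrite invr_gt0 ltr_pwDl// sqr_ge0. Qed.

Lemma wt_ge0 k : 0 <= wt k.
Proof. exact/ltW/wt_gt0. Qed.

(** Telescoping: 1 / (1 + x^2) <= 2/x - 2/(x + 1) for x >= 1. *)
Lemma sum_wt_nat n : \sum_(k < n.+1) wt k <= 3 - 2 / n.+1%:R.
Proof.
elim: n => [|n IH]; first by rewrite big_ord1 /wt /= expr0n addr0 [2 / _]divr1 ?invr1; lra.
rewrite big_ord_recr /=; apply: le_trans (lerD IH (lexx _)) _.
rewrite /wt -pmulrn; set x : R := n.+1%:R; have x0 : 1 <= x by rewrite ler1n.
rewrite -[n.+2%:R]natr1 -/x.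
have E : 2 / x - 2 / (x + 1) - (1 + x ^+ 2)^-1 = (x ^+ 2 - x + 2) / (x * (x + 1) * (1 + x ^+ 2)).
  field; apply/and3P; split; apply: lt0r_neq0; nra.
have : 0 <= (x ^+ 2 - x + 2) / (x * (x + 1) * (1 + x ^+ 2)).
  by apply: divr_ge0; [nra|apply: mulr_ge0; nra].
rewrite -E; move: (2 / x) (2 / (x + 1)) ((1 + x ^+ 2)^-1) => ? ? ?; lra.
Qed.

Lemma sum_wt_box N : \sum_(k < N.*2.+1) wt (k%:Z - N%:Z) <= 6.
Proof.
have b n : \sum_(k < n) wt k <= 3.
  case: n => [|n]; first by rewrite big_ord0.
  by apply: le_trans (sum_wt_nat n) _; rewrite gerBl divr_ge0.
have eN : (N.*2.+1 = N + N.+1)%N by rewrite -addnn addnS.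
rewrite eN big_split_ord /= (_ : 6 = 3 + 3 :> R); last lra.
apply: lerD; last by under eq_bigr do rewrite PoszD addrC addKr; exact: b.
apply: (@le_trans _ _ (\sum_(k < N.+1) wt k)); last exact: b.
rewrite big_ord_recl (reindex_inj rev_ord_inj) /= -[leLHS]add0r lerD ?wt_ge0//.
apply: ler_sum => i _; rewrite /wt /bump /= le_eqVlt; apply/orP; left; apply/eqP.
congr (_^-1); congr (_ + _); rewrite -sqrrN -mulrNz; congr (_%:~R ^+ 2).
have := ltn_ord i; lia.
Qed.

Lemma bsum_wt : bsum wt.
Proof.
exists 6 => J uJ; pose N := (\max_(k <- J) `|k|)%N.
apply: le_trans (sum_wt_box N).
rewrite -(big_map (fun k : 'I_(N.*2.+1) => k%:Z - N%:Z) xpredT wt).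
apply: ler_sum_sub => //; last exact: wt_ge0.
  rewrite map_inj_uniq ?index_enum_uniq// => k l /addIr [] /ord_inj //.
move=> k kJ; have le : (`|k| <= N)%N by exact: leq_bigmax_seq.
apply/mapP; exists (inord `|(k + N%:Z)%R|%N); first by rewrite mem_index_enum.
by rewrite inordK; lia.
Qed.

(** Over a box the sum of products factors into one-dimensional sums, each at most 6. *)
Lemma bsum_wtM p q : bsum (fun K : 'M[int]_(p,q) => \prod_i \prod_j wt (K i j)).
Proof.
exists (\prod_(ij : 'I_p * 'I_q) 6) => J uJ.
have [N /(_ _ (leqnn _)) sN] := boxM_sup J.
apply: le_trans (ler_sum_sub uJ (uniq_boxM p q N) sN _) _.
  by move=> K; apply: prodr_ge0 => i _; apply: prodr_ge0 => j _; exact: wt_ge0.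
rewrite /boxM big_image /=.
apply: (@le_trans _ _ (\prod_(ij : 'I_p * 'I_q) \sum_(k < N.*2.+1) wt (k%:Z - N%:Z))); last first.
  apply: ler_prod => i _; rewrite sum_wt_box andbT.
  by apply: sumr_ge0 => j _; exact: wt_ge0.
rewrite bigA_distr_bigA /= (reindex (fun f => Matrix f)) /=; last first.
  by exists (@mx_val _ _ _) => // -[].
rewrite le_eqVlt; apply/orP; left; apply/eqP/eq_bigr => f _.
rewrite pair_bigA /=; apply: eq_bigr => -[i j] _ /=.
by rewrite mxE.
Qed.

End Zsum.

(** * The complex exponential and its power series *)

Section Cexp.
Variable R : realType.
Local Notation C := R[i].
Implicit Types z w : C.

Lemma cexp_real (x : R) : cexp x%:C = (expR x)%:C.
Proof. by rewrite /cexp /= cos0 sin0 mulr1. Qed.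

Lemma cexp0 : cexp (0 : C) = 1.
Proof. by rewrite (cexp_real 0) expR0. Qed.

Lemma cexpD z w : cexp (z + w) = cexp z * cexp w.
Proof.
case: z => a b; case: w => c d; rewrite /cexp /= expRD cosD sinD /toC.
by rewrite rmorphM mulrACA; congr (_ * _); simpc; congr (_ +i* _); ring.
Qed.

Lemma cabs_cexp z : cabs (cexp z) = expR (complex.Re z).
Proof.
rewrite /cexp cabsM cabs_real ger0_norm ?expR_ge0// /cabs normc_def /=.
by rewrite cos2Dsin2 sqrtr1 mulr1.
Qed.

Lemma cexp_neq0 z : cexp z != 0.
Proof. by rewrite -cabs_eq0 cabs_cexp gt_eqF// expR_gt0. Qed.

Lemma cexpN z : cexp (- z) = (cexp z)^-1.
Proof.
apply: (mulfI (cexp_neq0 z)).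
by rewrite -cexpD subrr cexp0 mulfV// cexp_neq0.
Qed.

Lemma cexpMn z k : cexp (z *+ k) = cexp z ^+ k.
Proof. by elim: k => [|k IH]; rewrite ?cexp0// mulrS cexpD IH exprS. Qed.

Lemma hsum_series (f : nat -> C) s (pr : C -> R) :
  (forall z, `|pr z| <= cabs z) -> {morph pr : x y / x + y} ->
  hsum f s -> limn (series (fun n => pr (f n))) = pr s.
Proof.
move=> pr1 pr2 h.
have pr0 : pr 0 = 0.
  by apply/normr0_eq0/le_anti; rewrite normr_ge0 andbT -(cabs0 R).
have prN x : pr (- x) = - pr x by apply/eqP; rewrite -addr_eq0 -pr2 addNr pr0.
apply: cvg_lim => //; apply/cvgrPdist_lt => e /h[J0 hJ].
exists (\max_(k <- J0) k.+1)%N => // N /= le.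
rewrite distrC /series /= -(big_morph pr pr2 pr0) -prN -pr2.
apply: le_lt_trans (pr1 _) _; rewrite /index_iota subn0; apply: hJ; first exact: iota_uniq.
move=> k kJ; rewrite mem_iota /=; apply: leq_trans le.
exact: leq_bigmax_seq.
Qed.

Lemma sum_exp_le (x : R) (J : seq nat) : 0 <= x -> uniq J ->
  \sum_(k <- J) x ^+ k / k`!%:R <= expR x.
Proof.
move=> x0 uJ; pose N := (\max_(k <- J) k.+1)%N.
apply: (@le_trans _ _ (series (exp_coeff x) N)).
  rewrite /series /= /index_iota subn0; apply: ler_sum_sub => //.
  - exact: iota_uniq.
  - by move=> k kJ; rewrite mem_iota /=; exact: leq_bigmax_seq.
  - by move=> k; rewrite divr_ge0 ?exprn_ge0.
apply: nondecreasing_cvgn_le; last exact: is_cvg_series_exp_coeff.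
by apply: nondecreasing_series => k _ _; exact: exp_coeff_ge0.
Qed.

Definition expt z (k : nat) : C := z ^+ k / k`!%:R.

Lemma cabs_expt z k : cabs (expt z k) = cabs z ^+ k / k`!%:R.
Proof. by rewrite /expt cabsM cabsV cabsX cabs_nat. Qed.

Lemma sum_expt_le z (J : seq nat) : uniq J ->
  \sum_(k <- J) cabs (expt z k) <= expR (cabs z).
Proof.
move=> uJ; under eq_bigr do rewrite cabs_expt.
exact: sum_exp_le (cabs_ge0 _) uJ.
Qed.

Lemma bsum_expt z : bsum (fun k => cabs (expt z k)).
Proof. by exists (expR (cabs z)) => J; exact: sum_expt_le. Qed.

Lemma bsumM (I J : choiceType) (f : I -> R) (g : J -> R) :
  (forall i, 0 <= f i) -> (forall j, 0 <= g j) -> bsum f -> bsum g ->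
  bsum (fun p : I * J => f p.1 * g p.2).
Proof.
move=> f0 g0 bf [M hM]; apply: (@bsum_pair _ _ _ _ (fun i => M * f i)).
- by move=> p; rewrite mulr_ge0.
- by move=> i K uK /=; rewrite -big_distrr /= mulrC ler_wpM2r ?hM.
- by apply: bsumZ => //; have := hM [::] isT; rewrite big_nil.
Qed.

(** Absolute summability makes the double sum exist; summing it by rows identifies its value. *)
Lemma hsumM (I J : choiceType) (f : I -> C) (g : J -> C) s t :
  bsum (fun i => cabs (f i)) -> bsum (fun i => cabs (g i)) ->
  hsum f s -> hsum g t -> hsum (fun p : I * J => f p.1 * g p.2) (s * t).
Proof.
move=> bf bg hf hg.
have [|S hS] := @hsum_ex _ _ (fun p : I * J => f p.1 * g p.2).
  have := bsumM (fun i => cabs_ge0 (f i)) (fun i => cabs_ge0 (g i)) bf bg.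
  by apply: le_bsum => p; rewrite cabsM.
suff -> : s * t = S by [].
have h1 := hsum_fubini hS (fun i => hsumZ (f i) hg).
exact: hsum_unique (hsumZr t hf) h1.
Qed.

Lemma iXn k : 'i ^+ k = ((~~ odd k)%:R * (-1) ^+ k./2) +i* ((odd k)%:R * (-1) ^+ k./2) :> C.
Proof.
rewrite -{1}(odd_double_half k) exprD -mul2n exprM sqr_i.
have -> : (-1) ^+ k./2 = ((-1) ^+ k./2)%:C :> C by rewrite rmorphXn rmorphN1.
by case: (odd k) => /=; rewrite ?expr1 ?expr0; simpc.
Qed.

(** [cexp] is built from the real exponential, cosine and sine. Their series give the cases of a
    real and of a purely imaginary argument, and the Cauchy product of the two, regrouped by total
    degree, gives the general one. *)
Lemma hsum_expt z : hsum (expt z) (cexp z).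
Proof.
have ex w : exists s, hsum (expt w) s by apply: hsum_ex; exact: bsum_expt.
have reD : {morph (@complex.Re R) : x y / x + y} by case=> ? ? [].
have imD : {morph (@complex.Im R) : x y / x + y} by case=> ? ? [].
have Hre (x : R) : hsum (expt x%:C) (expR x)%:C.
  have [s hs] := ex x%:C.
  have rp k : expt x%:C k = (x ^+ k / k`!%:R)%:C.
    by rewrite /expt rmorphM rmorphXn fmorphV rmorph_nat.
  have h1 := hsum_series (@cabs_Re R) reD hs.
  have h2 := hsum_series (@cabs_Im R) imD hs.
  suff -> : (expR x)%:C = s by [].
  case: s hs h1 h2 => a c _ /= <- <-; congr (_ +i* _).
    by congr (limn (series _)); apply/funext => k; rewrite rp.
  apply/esym/cvg_lim => //; apply: cvg_near_cst; near=> N.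
  by rewrite /series /= big1 // => i _; rewrite rp.
have Him (x : R) : hsum (expt ('i * x%:C)) (cos x +i* sin x).
  have [s hs] := ex ('i * x%:C).
  have rp k : expt ('i * x%:C) k = 'i ^+ k * (x ^+ k / k`!%:R)%:C.
    by rewrite /expt exprMn rmorphM rmorphXn fmorphV rmorph_nat mulrA.
  have h1 := hsum_series (@cabs_Re R) reD hs.
  have h2 := hsum_series (@cabs_Im R) imD hs.
  suff -> : cos x +i* sin x = s by [].
  case: s hs h1 h2 => a c _ /= <- <-; rewrite cos.unlock sin.unlock; congr (_ +i* _).
    congr (limn (series _)); apply/funext => k; rewrite rp iXn; simpc => /=.
    by rewrite /cos_coeff /= -mulrA.
  congr (limn (series _)); apply/funext => k; rewrite rp iXn; simpc => /=.
  rewrite /sin_coeff /= -mulrA; case: (boolP (odd k)) => o; last by rewrite !mul0r.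
  suff -> : k.-1./2 = k./2 by [].
  by case: k o => //= k /negbTE ok; rewrite uphalf_half ok.
have Hz := hsumM (bsum_expt _) (bsum_expt _) (Hre (complex.Re z)) (Him (complex.Im z)).
(* Terms of the Cauchy product by total degree [k], set to zero off the triangle so that all pairs
   are allowed as indices. *)
pose T (k : nat) (q : nat) := if (q <= k)%N then
   expt (complex.Re z)%:C (k - q) * expt ('i * (complex.Im z)%:C) q else 0.
have hT : hsum (fun p : nat * nat => T p.1 p.2) (cexp z).
  apply: (@hsum_inj _ _ _ (fun p : nat * nat => ((p.1 + p.2)%N, p.2))).
  - by move=> [a c] [a' c'] /= [] /[swap] -> /addIn ->.
  - move=> [a c]; rewrite /T /=; case: ifP => [le _|_]; last by rewrite eqxx.
    by exists ((a - c)%N, c); rewrite /= subnK.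
  - by apply: eq_hsum Hz => -[a c]; rewrite /T /= leq_addl addnK.
apply: hsum_fubini hT _ => k.
have -> : expt z k = \sum_(q <- iota 0 k.+1) T k q.
  rewrite -[iota 0 k.+1]/(index_iota 0 k.+1) big_mkord {1}/expt {1}(complexE z) exprDn big_distrl /=.
  apply: eq_bigr => q _; rewrite /T -ltnS ltn_ord /expt -mulr_natr.
  have qk : (q <= k)%N by rewrite -ltnS.
  have -> : k`!%:R = 'C(k, q)%:R * (q`!%:R * (k - q)`!%:R) :> C by rewrite -!natrM bin_fact.
  have n0 (n : nat) : n`!%:R != 0 :> C by rewrite pnatr_eq0 -lt0n fact_gt0.
  have b0 : 'C(k, q)%:R != 0 :> C by rewrite pnatr_eq0 -lt0n bin_gt0.
  by field; rewrite !n0 b0.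
apply: hsum_fin; first exact: iota_uniq.
by move=> q; rewrite mem_iota /= add0n ltnS /T => /negbTE ->.
Unshelve. all: by end_near.
Qed.
End Cexp.

(** * Families with all exponential moments *)

Section ExpFam.
Variable R : realType.
Local Notation C := R[i].

(* [herm k l rho] is the coefficient of [s ^+ k] in exp(s l + rho s^2). *)
Definition herm (k : nat) (l rho : C) : C :=
  \sum_(j < k.+1 | (j.*2 <= k)%N) expt rho j * expt l (k - j.*2).

(** The weights beat every exponential of [l], so that the sum of w exp(s l) is entire in s and may
    be expanded term by term. *)
Definition expfam (I : choiceType) (w l : I -> C) :=
  forall S : R, 0 <= S -> bsum (fun i => cabs (w i) * expR (S * cabs (l i))).

Lemma exptZ (s z : C) k : s ^+ k * expt z k = expt (s * z) k.
Proof. by rewrite /expt exprMn mulrA. Qed.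

Lemma hermZ k l rho s :
  s ^+ k * herm k l rho =
  \sum_(j < k.+1 | (j.*2 <= k)%N) expt (rho * s ^+ 2) j * expt (s * l) (k - j.*2).
Proof.
rewrite /herm big_distrr /=; apply: eq_bigr => j jk.
rewrite (mulrC rho) -!exptZ -exprM mul2n -{1}(subnKC jk) exprD.
ring.
Qed.

Lemma cabs_expt_le (z : C) k : cabs (expt z k) <= expR (cabs z).
Proof. by have := @sum_expt_le _ z [:: k] isT; rewrite big_seq1. Qed.

(** Every divided power of l is at most exp |l|; a single exponential moment therefore controls the
    Hermite moments of all orders. *)
Lemma herm_le k l rho :
  cabs (herm k l rho) <= (\sum_(j < k.+1) cabs (expt rho j)) * expR (cabs l).
Proof.
rewrite /herm big_mkcond /=; apply: le_trans (cabs_sum _ _) _.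
rewrite big_distrl /=; apply: ler_sum => j _; case: ifP => _; last first.
  by rewrite cabs0 mulr_ge0 ?cabs_ge0 ?expR_ge0.
by rewrite cabsM ler_wpM2l ?cabs_ge0 ?cabs_expt_le.
Qed.

Lemma expfam_moment_bsum (I : choiceType) (w l : I -> C) rho k :
  expfam w l -> bsum (fun i => cabs (w i * herm k (l i) rho)).
Proof.
move=> /(_ 1 ler01) H.
have c0 : 0 <= \sum_(j < k.+1) cabs (expt rho j) by apply: sumr_ge0 => *; exact: cabs_ge0.
apply: le_bsum (bsumZ c0 H) => i.
rewrite cabsM mul1r mulrCA ler_wpM2l ?cabs_ge0//; exact: herm_le.
Qed.

(** The expansion of both exponentials gives an absolutely summable family over [I] and two degrees.
    Summed over the degrees it is the left-hand series, summed over [I] at fixed total degree it is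
    the power series of moments. *)
Lemma expfam_series (I : choiceType) (w l : I -> C) rho : expfam w l ->
  exists m : nat -> C, (forall k, hsum (fun i => w i * herm k (l i) rho) (m k)) /\
    forall s, exists F, hsum (fun i => w i * cexp (s * l i + rho * s ^+ 2)) F /\
                        hsum (fun k => s ^+ k * m k) F.
Proof.
move=> H.
have /boolp.choice[m hm] k := hsum_ex (expfam_moment_bsum rho k H).
exists m; split => // s; set r := rho * s ^+ 2.
pose T (p : I * (nat * nat)) := w p.1 * (expt (s * l p.1) p.2.1 * expt r p.2.2).
have bT : bsum (fun p => cabs (T p)).
  apply: (@bsum_pair _ _ _ _ (fun i => expR (cabs r) * (cabs (w i) * expR (cabs s * cabs (l i))))).
  - by move=> p; exact: cabs_ge0.
  - move=> i K uK /=; under eq_bigr do rewrite /T /= cabsM.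
    rewrite -big_distrr /= mulrCA ler_wpM2l ?cabs_ge0//.
    pose L := [seq (a, c) | a <- undup (map fst K), c <- undup (map snd K)].
    apply: (@le_trans _ _ (\sum_(p <- L) cabs (expt (s * l i) p.1 * expt r p.2))).
      apply: ler_sum_sub => //.
      - by apply: allpairs_uniq; rewrite ?undup_uniq// => -[? ?] [? ?] _ _ /= [-> ->].
      - move=> [a c] p; apply/allpairsP; exists (a, c); rewrite !mem_undup.
        by split=> //; apply/mapP; exists (a, c).
      - by move=> p; exact: cabs_ge0.
    rewrite big_allpairs -cabsM [leRHS]mulrC /=.
    apply: (@le_trans _ _ (\sum_(a <- undup [seq i.1 | i <- K]) cabs (expt (s * l i) a) * expR (cabs r))).
      apply: ler_sum => a _; under eq_bigr do rewrite cabsM.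
      by rewrite -big_distrr /= ler_wpM2l ?cabs_ge0 ?sum_expt_le ?undup_uniq.
    by rewrite -big_distrl /= ler_wpM2r ?expR_ge0 ?sum_expt_le ?undup_uniq.
  - by apply: bsumZ; rewrite ?expR_ge0//; apply: H; exact: cabs_ge0.
have [F hF] := hsum_ex bT; exists F; split.
  apply: (@hsum_fubini _ _ _ (fun i p => T (i, p)) _ F).
    by apply: eq_hsum hF => -[].
  move=> i; rewrite cexpD.
  have h := hsumM (bsum_expt (s * l i)) (bsum_expt r) (hsum_expt (s * l i)) (hsum_expt r).
  by apply: eq_hsum (hsumZ (w i) h) => p.
(* Regrouping by the degree in [s], where a factor [rho * s ^+ 2] counts twice. *)
pose T' (p : nat * I) (q : nat) := if (q.*2 <= p.1)%N then T (p.2, ((p.1 - q.*2)%N, q)) else 0.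
have hT' : hsum (fun p : (nat * I) * nat => T' p.1 p.2) F.
  apply: (@hsum_inj _ _ _ (fun p : I * (nat * nat) => (((p.2.1 + p.2.2.*2)%N, p.1), p.2.2))).
  - by move=> [a [c d]] [a' [c' d']] /= [] /[swap] -> /[swap] -> /addIn ->.
  - move=> [[k i] q]; rewrite /T' /=; case: ifP => [le _|_]; last by rewrite eqxx.
    by exists (i, ((k - q.*2)%N, q)); rewrite /= subnK.
  - by apply: eq_hsum hF => -[a [c d]]; rewrite /T' /= leq_addl addnK.
have h2 : hsum (fun p : nat * I => s ^+ p.1 * (w p.2 * herm p.1 (l p.2) rho)) F.
  apply: hsum_fubini hT' _ => -[k i] /=.
  rewrite mulrCA hermZ -/r.
  have -> : w i * (\sum_(j < k.+1 | (j.*2 <= k)%N) expt r j * expt (s * l i) (k - j.*2)) =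
      \sum_(q <- iota 0 k.+1) T' (k, i) q.
    rewrite -[iota 0 k.+1]/(index_iota 0 k.+1) big_mkord big_distrr big_mkcond /=.
    by apply: eq_bigr => q _; rewrite /T' /T /=; case: ifP => // _; congr (_ * _); rewrite mulrC.
  apply: hsum_fin; first exact: iota_uniq.
  move=> q; rewrite mem_iota /= add0n ltnS /T' /= => n; case: ifP => // le.
  by case/negP: n; apply: leq_trans le; rewrite -addnn leq_addr.
exact: (hsum_fubini (f := fun k i => s ^+ k * (w i * herm k (l i) rho))) h2 (fun k => hsumZ (s ^+ k) (hm k)).
Qed.

(** A term outside [J0] is the difference of two partial sums, both within 1 of the limit. *)
Lemma hsum_bounded (I : choiceType) (f : I -> C) s : hsum f s -> exists B, forall i, cabs (f i) <= B.
Proof.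
move=> h; have [J0 hJ] := h 1 ltr01.
have sJ : {subset J0 <= undup J0} by move=> i; rewrite mem_undup.
exists (\sum_(i <- undup J0) cabs (f i) + 2) => i; case: (boolP (i \in J0)) => iJ.
  apply: (@le_trans _ _ (\sum_(i <- [:: i]) cabs (f i))); first by rewrite big_seq1.
  apply: ler_wpDr => //; apply: ler_sum_sub => //; rewrite ?undup_uniq//.
    by move=> k; rewrite inE => /eqP ->; rewrite mem_undup.
  by move=> ?; exact: cabs_ge0.
have h1 := hJ _ (undup_uniq J0) sJ.
have h2 : cabs (\sum_(k <- i :: undup J0) f k - s) < 1.
  apply: hJ; first by rewrite /= mem_undup iJ undup_uniq.
  by move=> k kJ; rewrite inE mem_undup kJ orbT.
have : cabs (f i) <= 2.
  have -> : f i = (\sum_(k <- i :: undup J0) f k - s) - (\sum_(k <- undup J0) f k - s).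
    by rewrite big_cons; ring.
  by apply: le_trans (cabsD _ _) _; rewrite cabsN; lra.
by apply: ler_wpDl; apply: sumr_ge0 => *; exact: cabs_ge0.
Qed.

Lemma sum_geom_le (r : R) n (J : seq nat) : 0 <= r <= 2^-1 -> uniq J ->
  (forall k, k \in J -> (n <= k)%N) -> \sum_(k <- J) r ^+ k <= 2 * r ^+ n.
Proof.
move=> /andP[r0 r1] uJ hJ; pose N := (\max_(k <- J) k)%N.
apply: (@le_trans _ _ (\sum_(k <- iota n N.+1) r ^+ k)).
  apply: ler_sum_sub => //; first exact: iota_uniq; last by move=> k; rewrite exprn_ge0.
  move=> k kJ; rewrite mem_iota hJ//= addnS ltnS; apply: leq_trans (leq_addl _ _).
  exact: leq_bigmax_seq.
have gen M : \sum_(k <- iota n M) r ^+ k <= 2 * r ^+ n - 2 * r ^+ (n + M).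
  elim: M => [|M IH]; first by rewrite /= big_nil addn0 subrr.
  rewrite -addn1 iotaD big_cat /= big_seq1 addnA addn1 exprS.
  have := exprn_ge0 (n + M) r0; move: (r ^+ (n + M)) IH => t le t0.
  have : r * t <= 2^-1 * t by rewrite ler_wpM2r.
  by move: (r * t) le => q; lra.
by apply: le_trans (gen _) _; rewrite gerBl mulr_ge0 ?exprn_ge0.
Qed.

(** Induction on the order: convergence at [eps] bounds the coefficients geometrically, so after
    division by s^n all later terms are O(s) and the n-th coefficient is arbitrarily small. Halving
    [eps] makes the ratio of the majorant at most 1/2. *)
Lemma pseries_unique0 (c : nat -> C) (eps : R) : 0 < eps ->
  (forall s : R, 0 < s <= eps -> hsum (fun k => s%:C ^+ k * c k) 0) -> forall n, c n = 0.
Proof.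
move=> e0 H n; elim/ltn_ind: n => n IH.
have eps1 : 0 < eps <= eps by rewrite e0 lexx.
have [B hB] := hsum_bounded (H eps eps1).
have B0 : 0 <= B by apply: le_trans (hB 0%N); exact: cabs_ge0.
have cB k : cabs (c k) <= B / eps ^+ k.
  rewrite ler_pdivlMr ?exprn_gt0// mulrC; apply: le_trans (hB k).
  by rewrite cabsM cabsX cabs_real gtr0_norm.
suff key (s : R) : 0 < s <= eps / 2 -> cabs (c n) <= 2 * B / eps ^+ n.+1 * s.
  apply: cabs_lt_eq => e ep; rewrite subr0.
  pose K := 2 * B / eps ^+ n.+1; have K0 : 0 <= K.
    by rewrite divr_ge0 ?mulr_ge0// exprn_ge0// ltW.
  have dp : 0 < e / (2 * (K + 1)) by rewrite divr_gt0// mulr_gt0// ltr_wpDl.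
  (* Small enough for [K * s < e]; the summand 1 in the denominator covers K = 0. *)
  pose s := Num.min (eps / 2) (e / (2 * (K + 1))).
  have s0 : 0 < s by rewrite lt_min dp divr_gt0.
  have sle : s <= e / (2 * (K + 1)) by rewrite ge_min lexx orbT.
  apply: le_lt_trans (key s _) _; first by rewrite s0 ge_min lexx.
  rewrite -/K; apply: (@le_lt_trans _ _ (K * (e / (2 * (K + 1))))); first by rewrite ler_wpM2l.
  have K1 : 0 < 2 * (K + 1) by rewrite mulr_gt0// ltr_wpDl.
  by rewrite mulrA ltr_pdivrMr//; nra.
move=> /andP[s0 s1].
have sN : s%:C != 0 :> C by rewrite -cabs_eq0 cabs_real gtr0_norm// gt_eqF.
have h0 : hsum (fun k => s%:C ^+ k * c k) 0 by apply: H; rewrite s0; lra.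
have h1 : hsum (fun k => if k == n then s%:C ^+ k * c k else 0) (s%:C ^+ n * c n).
  have := @hsum_fin R _ (fun k => if k == n then s%:C ^+ k * c k else 0) [:: n] isT.
  by rewrite big_seq1 eqxx; apply => k; rewrite inE => /negbTE ->.
(* The n-th term is removed and the lower ones vanish by induction: what is left has order at least
   n + 1 and sums to minus the n-th term. *)
have h2 := hsumD h0 (hsumZ (-1) h1).
have : cabs (0 + -1 * (s%:C ^+ n * c n)) <= B * (2 * (s / eps) ^+ n.+1).
  apply: hsum_le h2 => J uJ.
  rewrite (bigID (fun k => n < k)%N) /= [X in _ + X]big1 => [|k]; last first.
    rewrite -leqNgt leq_eqVlt => /orP[/eqP ->|lt]; first by rewrite eqxx mulN1r addrN cabs0.
    by rewrite (IH k lt) mulr0; case: ifP; rewrite ?mulr0 addr0 cabs0.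
  rewrite addr0 -big_filter.
  apply: (@le_trans _ _ (\sum_(k <- [seq k <- J | (n < k)%N]) B * (s / eps) ^+ k)).
    rewrite big_seq [leRHS]big_seq; apply: ler_sum => k; rewrite mem_filter => /andP[nk _].
    rewrite gtn_eqF// mulr0 addr0 cabsM cabsX cabs_real gtr0_norm// expr_div_n mulrCA.
    by rewrite ler_wpM2l ?cB// exprn_ge0// ltW.
  rewrite -big_distrr /= ler_wpM2l//; apply: sum_geom_le; first last.
  - by move=> k; rewrite mem_filter => /andP[].
  - exact: filter_uniq.
  - by rewrite divr_ge0 ?(ltW s0) ?(ltW e0)//= ler_pdivrMr//; lra.
rewrite add0r mulN1r cabsN cabsM cabsX cabs_real gtr0_norm// expr_div_n exprS.
have sn : 0 < s ^+ n by rewrite exprn_gt0.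
move=> le; rewrite -(ler_pM2l sn); apply: le_trans le _.
rewrite le_eqVlt; apply/orP; left; apply/eqP; field.
by rewrite expf_neq0// gt_eqF.
Qed.

(* Both sides are entire in [s] with the two families of moments as coefficients: agreement for small real [s] propagates to complex [s] and to each coefficient. *)
Lemma expfam_unique (I J : choiceType) (w l : I -> C) (w' l' : J -> C) rho rho' (eps : R) :
  expfam w l -> expfam w' l' -> 0 < eps ->
  (forall s : R, 0 < s <= eps -> exists F,
      hsum (fun i => w i * cexp (s%:C * l i + rho * s%:C ^+ 2)) F /\
      hsum (fun j => w' j * cexp (s%:C * l' j + rho' * s%:C ^+ 2)) F) ->
  (forall s : C, exists F,
      hsum (fun i => w i * cexp (s * l i + rho * s ^+ 2)) F /\
      hsum (fun j => w' j * cexp (s * l' j + rho' * s ^+ 2)) F) /\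
  (forall k, exists m,
      hsum (fun i => w i * herm k (l i) rho) m /\ hsum (fun j => w' j * herm k (l' j) rho') m).
Proof.
move=> /(expfam_series rho)[m [hm hs]] /(expfam_series rho')[m' [hm' hs']] e0 H.
have mm k : m k = m' k.
  apply/eqP; rewrite -subr_eq0; apply/eqP.
  apply: (@pseries_unique0 (fun k => m k - m' k) eps e0) => s /H[F [h1 h2]].
  have [F1 [g1 k1]] := hs s%:C; have [F2 [g2 k2]] := hs' s%:C.
  rewrite (hsum_unique g1 h1) in k1; rewrite (hsum_unique g2 h2) in k2.
  have := hsumD k1 (hsumZ (-1) k2); rewrite mulN1r subrr; apply: eq_hsum => j.
  by rewrite mulrBr mulN1r.
split=> [s|k]; last by exists (m k); rewrite {2}mm.
have [F1 [g1 k1]] := hs s; have [F2 [g2 k2]] := hs' s.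
exists F1; split=> //; suff -> : F1 = F2 by [].
by apply: hsum_unique k1 _; apply: eq_hsum k2 => k; rewrite mm.
Qed.

End ExpFam.

(** * Poisson summation for Gaussians *)

Section Tannery.
Variable R : realType.
Local Notation C := R[i].
Local Open Scope classical_set_scope.

Definition ccvg (u : nat -> C) (l : C) := cabs (u N - l) @[N --> \oo] --> (0 : R).

Lemma ccvg_unique u l l' : ccvg u l -> ccvg u l' -> l = l'.
Proof.
move=> h h'; apply: cabs_lt_eq => e e0.
have e2 : 0 < e / 2 by rewrite divr_gt0.
move/cvgrPdist_lt : h => /(_ _ e2) [N1 _ h1]; move/cvgrPdist_lt : h' => /(_ _ e2) [N2 _ h2].
have := h1 (maxn N1 N2) (leq_maxl _ _); have := h2 (maxn N1 N2) (leq_maxr _ _).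
rewrite /= !sub0r !normrN !ger0_norm ?cabs_ge0// => a2 a1.
rewrite (splitr e); apply: le_lt_trans (ltrD a1 a2).
by rewrite (cabsBC _ l) cabs_triB.
Qed.

Lemma ccvg_real (u : nat -> R) (l : R) : u N @[N --> \oo] --> l -> ccvg (fun N => (u N)%:C) l%:C.
Proof.
move=> /cvgrPdist_lt h; apply/cvgrPdist_lt => e /h; apply: filterS => N.
by rewrite distrC sub0r normrN -rmorphB cabs_real normr_id.
Qed.

Lemma ccvgM u v l l' : ccvg u l -> ccvg v l' -> ccvg (fun N => u N * v N) (l * l').
Proof.
move=> h h'; rewrite /ccvg.
apply: (@squeeze_cvgr _ _ _ _ (fun=> 0) (fun N => cabs (u N - l) * (cabs (v N - l') + cabs l') + cabs l * cabs (v N - l'))).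
- near=> N; rewrite cabs_ge0 /=.
  have -> : u N * v N - l * l' = (u N - l) * v N + l * (v N - l') by ring.
  apply: le_trans (cabsD _ _) _; rewrite !cabsM lerD2r ler_wpM2l ?cabs_ge0//.
  by rewrite -{1}(subrK l' (v N)) cabsD.
- exact: cvg_cst.
- have -> : 0 = 0 * (0 + cabs l') + cabs l * 0 :> R by rewrite mul0r mulr0 addr0.
  by apply: cvgD; apply: cvgM => //; try apply: cvgD => //; exact: cvg_cst.
Unshelve. all: by end_near.
Qed.

Lemma eq_ccvg u v l : (\forall N \near \oo, u N = v N) -> ccvg u l -> ccvg v l.
Proof.
move=> uv; rewrite /ccvg; apply: cvg_trans; apply: near_eq_cvg.
by apply: filterS uv => N /= ->.
Qed.

(** Dominated convergence for series: a finite set carries all but a small part of the majorant, and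
    on it termwise convergence is enough. The majorant passes to the limit [f0]. *)
Lemma tannery (I : choiceType) (f : nat -> I -> C) (f0 : I -> C) (g : I -> R) S S0 :
  bsum g -> (\forall N \near \oo, forall i, cabs (f N i) <= g i) ->
  (forall i, ccvg (f ^~ i) (f0 i)) ->
  (forall N, hsum (f N) (S N)) -> hsum f0 S0 -> ccvg S S0.
Proof.
move=> bg fg ff0 hS hS0.
have g0 i : 0 <= g i by case: fg => N _ /(_ N (leqnn N) i); apply: le_trans; exact: cabs_ge0.
have f0g i : cabs (f0 i) <= g i.
  apply/ler_addgt0Pr => e e0; move/cvgrPdist_lt : (ff0 i) => /(_ _ e0) [N1 _ h1].
  case: fg => N2 _ h2.
  have := h1 (maxn N1 N2) (leq_maxl _ _); have := h2 (maxn N1 N2) (leq_maxr _ _) i.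
  rewrite /= sub0r normrN ger0_norm ?cabs_ge0// => a2 a1.
  rewrite -[f0 i](subKr (f (maxn N1 N2) i)); apply: le_trans (cabsD _ _) _.
  by rewrite lerD// cabsN ltW.
have [s hs] := hsum_pos_ex g0 bg.
(* Two partial sums of the majorant within e/8 of [s] differ by at most e/4, which bounds the
   majorant off [J1]. The difference |f N - f0| <= 2 g costs e/2 there, and the finite set [J1] the
   other e/2. *)
apply/cvgrPdist_le => e e0; have e4 : 0 < e / 8 by rewrite divr_gt0.
have [J0 hJ0] := hs _ e4.
pose J1 := undup J0; have sJ1 : {subset J0 <= J1} by move=> i; rewrite mem_undup.
have tail J : uniq J -> {in J, forall i, i \notin J1} -> \sum_(i <- J) g i <= e / 4.
  move=> uJ dJ.
  have h1 := hJ0 _ (undup_uniq J0) sJ1.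
  have h2 : cabs (\sum_(i <- J ++ J1) (g i)%:C - s) < e / 8.
    apply: hJ0; last by move=> i iJ; rewrite mem_cat sJ1 ?orbT.
    rewrite cat_uniq uJ undup_uniq andbT /=; apply/hasPn => i iJ1.
    by apply: contraL iJ1 => /= /dJ.
  have : cabs (\sum_(i <- J) (g i)%:C) <= e / 4.
    rewrite -[X in cabs X](addrK (\sum_(i <- J1) (g i)%:C)) -big_cat /=.
    apply: le_trans (cabs_triB _ s _) _; rewrite (cabsBC s).
    by have := ltrD h2 h1; move=> /ltW /le_trans; apply; lra.
  by rewrite -rmorph_sum cabs_real ger0_norm// sumr_ge0.
have : \forall N \near \oo, \sum_(i <- J1) cabs (f N i - f0 i) < e / 2.
  have : (\sum_(i <- J1) cabs (f N i - f0 i)) @[N --> \oo] --> \sum_(i <- J1) (0 : R).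
    elim: J1 {sJ1 tail} => [|i J IH].
      by under eq_fun do rewrite big_nil; rewrite big_nil; exact: cvg_cst.
    by under eq_fun do rewrite big_cons; rewrite big_cons; apply: cvgD => //; exact: ff0.
  rewrite big1// => /cvgrPdist_lt /(_ (e / 2)); rewrite divr_gt0// => /(_ isT).
  apply: filterS => N; rewrite sub0r normrN ger0_norm//.
  by apply: sumr_ge0 => *; exact: cabs_ge0.
move=> hJ1; near=> N.
rewrite sub0r normrN ger0_norm ?cabs_ge0//.
have hD := hsumD (hS N) (hsumZ (-1) hS0).
have -> : S N - S0 = S N + -1 * S0 by rewrite mulN1r.
apply: hsum_le hD => J uJ.
rewrite (bigID (mem J1)) /= -!(big_filter J).
apply: (@le_trans _ _ (e / 2 + 2 * (e / 4))); last by lra.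
apply: lerD.
  apply: (@le_trans _ _ (\sum_(i <- J1) cabs (f N i - f0 i))); last by apply: ltW; near: N.
  under eq_bigr do rewrite mulN1r.
  apply: ler_sum_sub; rewrite ?filter_uniq ?undup_uniq//.
    by move=> i; rewrite mem_filter => /andP[].
  by move=> ?; exact: cabs_ge0.
apply: (@le_trans _ _ (\sum_(i <- [seq i <- J | i \notin J1]) 2 * g i)).
  apply: ler_sum => i _; apply: le_trans (cabsD _ _) _; rewrite mulN1r cabsN.
  rewrite mulr_natl mulr2n lerD//; move: (i); near: N; exact: fg.
rewrite -big_distrr /= ler_wpM2l//; apply: tail; first exact: filter_uniq.
by move=> i; rewrite mem_filter => /andP[].
Unshelve. all: by end_near.
Qed.

End Tannery.

(** * Even powers of the cosine *)

Section PolyaLimits.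
Variable R : realType.
Local Open Scope classical_set_scope.

Lemma cvg_fct (h : R -> R) (u : nat -> R) (l : R) : continuous h ->
  u N @[N --> \oo] --> l -> h (u N) @[N --> \oo] --> h l.
Proof. by move=> hc ul; apply: (cvg_comp _ _ ul (hc l)). Qed.

Lemma cvg_eqr (u : nat -> R) (l l' : R) : l = l' ->
  u N @[N --> \oo] --> l -> u N @[N --> \oo] --> l'.
Proof. by move=> ->. Qed.

Lemma sin_mvt (x : R) : 0 < x -> exists2 c, 0 < c < x & sin x = x * cos c.
Proof.
move=> x0; have [|c] := @MVT R sin cos 0 x x0 (fun x _ => is_derive_sin x).
  by apply: continuous_subspaceT; exact: continuous_sin.
by rewrite in_itv /= sin0 !subr0 mulrC => h e; exists c.
Qed.

Lemma cos_ge0_half (x : R) : 0 <= x <= pi / 2 -> 0 <= cos x.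
Proof. by move=> /andP[x0 x1]; apply: cos_ge0_pihalf; rewrite x1 andbT (le_trans _ x0)// oppr_le0 divr_ge0// pi_ge0. Qed.

Lemma cos_nincr (x y : R) : 0 <= x -> x <= y -> y <= pi -> cos y <= cos x.
Proof.
move=> x0; rewrite le_eqVlt => /orP[/eqP ->//|xy yp].
have hx : x \in `[0, pi]%R by rewrite in_itv /=; lra.
have hy : y \in `[0, pi]%R by rewrite in_itv /=; lra.
by apply: ltW; rewrite ltr_cos.
Qed.

(** Double angle and mean value: sin x = x cos c cos(x/2) with c < x/2, and 2 cos(x/2)^2 >= 1
    because cos x >= 0. *)
Lemma sin_ge_half (x : R) : 0 <= x <= pi / 2 -> x / 2 <= sin x.
Proof.
move=> /andP[]; rewrite le_eqVlt => /orP[/eqP <- _|x0 x1]; first by rewrite mul0r sin0.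
have pi0 := pi_gt0 R.
have t0 : 0 < x / 2 by lra.
have [c /andP[c0 c1] e] := sin_mvt t0.
have xE : x = x / 2 *+ 2 by rewrite mulr2n -splitr.
rewrite {2}xE sin_mulr2n e.
have cc : cos (x / 2) <= cos c by apply: cos_nincr; lra.
have c20 : 0 <= cos (x / 2) by apply: cos_ge0_half; lra.
have h : 0 <= cos x by apply: cos_ge0_half; lra.
rewrite xE cos_mulr2n in h; move: (cos (x/2)) (cos c) cc c20 h => C D cc c20 h.
have h2 : 1 <= 2 * (D * C) by nra.
have -> : C * (x / 2 * D) *+ 2 = x / 2 * (2 * (D * C)) by rewrite mulr2n; ring.
by rewrite ler_peMr// ltW.
Qed.

(** cos^2 = 1 - sin^2 <= 1 - x^2/4 <= exp(-x^2/4). This is the source of the majorant that is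
    uniform in the number of roots of unity. *)
Lemma cos_pow_le (x : R) m : `|x| <= pi / 2 -> cos x ^+ m.*2 <= expR (- (m%:R * (x ^+ 2 / 4))).
Proof.
wlog x0 : x / 0 <= x => [h|].
  case: (leP 0 x) => x0; first exact: h.
  by move=> hx; rewrite -cosN -sqrrN; apply: h; rewrite ?oppr_ge0 ?(ltW x0)// normrN.
rewrite ger0_norm// => x1; rewrite -mul2n exprM -mulrN expRM_natl.
apply: lerXn2r; rewrite ?nnegrE ?sqr_ge0 ?expR_ge0//.
apply: le_trans (expR_ge1Dx _).
have := @sin_ge_half x; rewrite x0 x1 => /(_ isT); have := cos2Dsin2 x.
move: (cos x) (sin x) => c s; nra.
Qed.

(** Squeeze between exp(-m u/(1 - u)) and exp(-m u); both bounds are 1 + x <= e^x, once for x = u/(1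
    - u) and once for x = -u. *)
Lemma pow1B_cvg (u : nat -> R) (m : nat -> nat) (c : R) :
  u N @[N --> \oo] --> (0 : R) -> (\forall N \near \oo, 0 <= u N) ->
  (m N)%:R * u N @[N --> \oo] --> c ->
  (1 - u N) ^+ m N @[N --> \oo] --> expR (- c).
Proof.
move=> u0 up mc.
have u1 : \forall N \near \oo, u N < 1.
  by move/cvgrPdist_lt : u0 => /(_ 1 ltr01); apply: filterS => N; rewrite sub0r normrN; apply: le_lt_trans; exact: ler_norm.
apply: (@squeeze_cvgr _ _ _ _ (fun N => expR (- ((m N)%:R * u N / (1 - u N)))) (fun N => expR (- ((m N)%:R * u N)))).
- near=> N.
  have a : 0 <= u N by near: N.
  have b : u N < 1 by near: N.
  have b0 : 0 < 1 - u N by rewrite subr_gt0.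
  rewrite -mulrA -!mulrN !expRM_natl; apply/andP; split.
    apply: lerXn2r; rewrite ?nnegrE ?expR_ge0 ?(ltW b0)//.
    rewrite mulrN expRN -[leRHS]invrK lef_pV2 ?posrE ?invr_gt0 ?expR_gt0//.
    apply: le_trans (expR_ge1Dx _); rewrite le_eqVlt; apply/orP; left; apply/eqP.
    by field; rewrite gt_eqF.
  apply: lerXn2r; rewrite ?nnegrE ?expR_ge0 ?(ltW b0)//.
  exact: expR_ge1Dx.
- apply: (cvg_fct (@continuous_expR R)).
  apply: cvgN; apply: (@cvg_eqr _ (c * (1 - 0)^-1)); first by rewrite subr0 invr1 mulr1.
  apply: cvgM => //; apply: cvgV; first by rewrite subr0 oner_eq0.
  by apply: cvgB => //; exact: cvg_cst.
- apply: (cvg_fct (@continuous_expR R)).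
  exact: cvgN.
Unshelve. all: by end_near.
Qed.

(** With cos^2 = 1 - sin^2 it suffices that m sin^2 x tends to c, and m sin^2 x lies between m x^2
    cos^2 x and m x^2. *)
Lemma cos_pow_cvg (x : nat -> R) (m : nat -> nat) (c : R) :
  x N @[N --> \oo] --> (0 : R) -> (m N)%:R * x N ^+ 2 @[N --> \oo] --> c ->
  cos (x N) ^+ (m N).*2 @[N --> \oo] --> expR (- c).
Proof.
move=> x0 mc.
have sle (t : R) : 0 <= sin t ^+ 2 <= t ^+ 2.
  wlog t0 : t / 0 < t => [h|].
    case: (ltgtP t 0) => [t0|t0|->]; [|exact: h|by rewrite sin0 expr0n lexx].
    by rewrite -sqrrN -sinN -(sqrrN t); apply: h; rewrite oppr_gt0.
  rewrite sqr_ge0 /=; have [d _ ->] := sin_mvt t0.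
  by rewrite exprMn ger_pMr ?exprn_gt0//; have := cos2Dsin2 d; have := sqr_ge0 (sin d); lra.
have sge (t : R) : `|t| <= pi / 2 -> t ^+ 2 * cos t ^+ 2 <= sin t ^+ 2.
  wlog t0 : t / 0 < t => [h|].
    case: (ltgtP t 0) => [t0|t0|->]; [|exact: h|by rewrite expr0n mul0r sqr_ge0].
    by rewrite -normrN -(sqrrN (sin t)) -sinN -(sqrrN t) -cosN; apply: h; rewrite oppr_gt0.
  rewrite gtr0_norm// => t1; have [d /andP[d0 d1] ->] := sin_mvt t0.
  rewrite exprMn ler_wpM2l ?sqr_ge0//; apply: lerXn2r; rewrite ?nnegrE.
  - by apply: cos_ge0_half; rewrite t1 ltW.
  - by apply: cos_ge0_half; lra.
  - by apply: cos_nincr; have := pi_gt0 R; lra.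
under eq_fun do rewrite -mul2n exprM cos2sin2.
have xs : x N ^+ 2 @[N --> \oo] --> (0 : R).
  have -> : 0 = 0 ^+ 2 :> R by rewrite expr0n.
  exact: (cvg_fct (@exprn_continuous R 2)).
apply: pow1B_cvg.
- apply: (@squeeze_cvgr _ _ _ _ (fun=> 0) (fun N => x N ^+ 2)) => //; last exact: cvg_cst.
  by near=> N; exact: sle.
- by near=> N; case/andP: (sle (x N)).
- apply: (@squeeze_cvgr _ _ _ _ (fun N => (m N)%:R * x N ^+ 2 * cos (x N) ^+ 2) (fun N => (m N)%:R * x N ^+ 2)) => //.
    near=> N; have px : `|x N| <= pi / 2.
      near: N; move/cvgrPdist_le : x0 => /(_ (pi / 2)); rewrite divr_gt0 ?pi_gt0// => /(_ isT).
      by apply: filterS => N; rewrite sub0r normrN.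
    by rewrite -mulrA !ler_wpM2l// ?sge//; case/andP: (sle (x N)).
  apply: (@cvg_eqr _ (c * cos 0 ^+ 2)); first by rewrite cos0 expr1n mulr1.
  apply: cvgM => //.
  apply: (cvg_fct (@exprn_continuous R 2)).
  exact: (cvg_fct (@continuous_cos R)).
Unshelve. all: by end_near.
Qed.

End PolyaLimits.

(** * Binomial coefficients near the centre *)

Section BinomialLimits.
Variable R : realType.
Local Open Scope classical_set_scope.

(** Normalised by the central coefficient: the value at j = 0 is 1 and the limit is a pure
    Gaussian. *)
Definition binr (m j : nat) : R := 'C(m.*2, m + j)%:R / 'C(m.*2, m)%:R.

Lemma bin_mid_gt0 m : 0 < 'C(m.*2, m)%:R :> R.
Proof. by rewrite ltr0n bin_gt0 -addnn leq_addr. Qed.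

Lemma binr0 m : binr m 0 = 1.
Proof. by rewrite /binr addn0 divff// gt_eqF// bin_mid_gt0. Qed.

Lemma binr_ge0 m j : 0 <= binr m j.
Proof. by rewrite divr_ge0. Qed.

Lemma binrS m j : binr m j.+1 = binr m j * ((m - j)%:R / (m + j.+1)%:R).
Proof.
rewrite /binr; have := mul_bin_left m.*2 (m + j).
rewrite -addnn subnDl addnn => /(congr1 (fun n => n%:R : R)); rewrite !natrM addnS => e.
have n0 : (m + j).+1%:R != 0 :> R by rewrite pnatr_eq0.
apply: (mulfI n0); rewrite mulrA e; move: (m + j).+1%:R n0 => x x0; field.
by rewrite x0 gt_eqF// bin_mid_gt0.
Qed.

Lemma natr_sqrS j : j%:R ^+ 2 + (j.*2.+1)%:R = j.+1%:R ^+ 2 :> R.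
Proof. by rewrite -!natrX -natrD; congr _%:R; rewrite -[in RHS]addn1 sqrnD -muln2; lia. Qed.

(** Successive ratios are 1 - (2j + 1)/(m + j + 1) <= exp(-(2j + 1)/(m + J)), and the odd numbers
    below 2j add up to j^2. The fixed [J] keeps the denominator constant during the induction. *)
Lemma binr_le m J j : (j <= J)%N -> (J <= m)%N ->
  binr m j <= expR (- (j%:R ^+ 2 / (m + J)%:R)).
Proof.
move=> + Jm; elim: j => [|j IH] jJ; first by rewrite binr0 expr0n /= mul0r oppr0 expR0.
have mJ : 0 < (m + J)%:R :> R by rewrite ltr0n; lia.
rewrite binrS; apply: (@le_trans _ _ (expR (- (j%:R ^+ 2 / (m + J)%:R)) * expR (- (j.*2.+1%:R / (m + J)%:R)))).
  apply: ler_pM; rewrite ?binr_ge0 ?divr_ge0//; first exact/IH/ltnW.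
  have q0 : 0 < (m + j.+1)%:R :> R by rewrite ltr0n; lia.
  apply: le_trans (_ : 1 - j.*2.+1%:R / (m + j.+1)%:R <= _).
    rewrite ler_pdivrMr// mulrBl mul1r divfK ?gt_eqF// natrB; last lia.
    rewrite lerBrDr addrAC -natrD lerBlDr -natrD ler_nat; lia.
  apply: le_trans (expR_ge1Dx _) _; rewrite ler_expR lerN2 ler_wpM2l// lef_pV2 ?posrE//.
  by rewrite ler_nat; lia.
rewrite -expRD ler_expR le_eqVlt; apply/orP; left; apply/eqP.
by rewrite -opprD -mulrDl natr_sqrS.
Qed.

(** The denominator 2m + 1 serves every j: beyond m the coefficient is zero, and it stays positive
    at m = 0. *)
Lemma binr_le_gauss m j : binr m j <= expR (- (j%:R ^+ 2 / (m.*2.+1)%:R)).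
Proof.
case: (leqP j m) => jm; last first.
  by rewrite /binr bin_small ?mul0r ?expR_ge0// -addnn ltn_add2l.
case: (posnP m) => [m0|m0].
  by move: jm; rewrite m0 leqn0 => /eqP ->; rewrite binr0 expr0n mul0r oppr0 expR0.
apply: le_trans (binr_le jm (leqnn m)) _; rewrite ler_expR lerN2.
rewrite addnn ler_wpM2l ?sqr_ge0// lef_pV2 ?posrE ?ltr0n ?ler_nat//; lia.
Qed.

(** Same telescoping with inverse ratios, which are 1 + (2j + 1)/(m - j). *)
Lemma binr_ge m J j : (j <= J)%N -> (J < m)%N ->
  expR (- (j%:R ^+ 2 / (m - J)%:R)) <= binr m j.
Proof.
move=> + Jm; elim: j => [|j IH] jJ; first by rewrite binr0 expr0n /= mul0r oppr0 expR0.
have mJ : 0 < (m - J)%:R :> R by rewrite ltr0n; lia.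
rewrite binrS; apply: (@le_trans _ _ (expR (- (j%:R ^+ 2 / (m - J)%:R)) * expR (- (j.*2.+1%:R / (m - J)%:R)))).
  rewrite -expRD ler_expR le_eqVlt; apply/orP; left; apply/eqP.
  by rewrite -opprD -mulrDl natr_sqrS.
apply: ler_pM; rewrite ?expR_ge0//; first exact/IH/ltnW.
have q0 : 0 < (m - j)%:R :> R by rewrite ltr0n; lia.
have p0 : 0 < (m + j.+1)%:R :> R by rewrite ltr0n; lia.
rewrite expRN -[leRHS]invrK lef_pV2 ?posrE ?invr_gt0 ?expR_gt0 ?divr_gt0// invf_div.
apply: le_trans (_ : 1 + j.*2.+1%:R / (m - j)%:R <= _).
  rewrite ler_pdivrMr// mulrDl mul1r divfK ?gt_eqF// -natrD ler_nat; lia.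
apply: le_trans (expR_ge1Dx _) _; rewrite ler_expR ler_wpM2l// lef_pV2 ?posrE//.
by rewrite ler_nat; lia.
Qed.

Lemma binr_cvg (m j : nat -> nat) (c : R) :
  (\forall N \near \oo, (j N < m N)%N) ->
  (j N)%:R / (m N)%:R @[N --> \oo] --> (0 : R) ->
  (j N)%:R ^+ 2 / (m N)%:R @[N --> \oo] --> c ->
  binr (m N) (j N) @[N --> \oo] --> expR (- c).
Proof.
move=> jm jm0 jc.
have lim (s : R) : (j N)%:R ^+ 2 / (m N)%:R * (1 + s * ((j N)%:R / (m N)%:R))^-1 @[N --> \oo] --> c.
  apply: (@cvg_eqr _ _ (c * (1 + s * 0)^-1)); first by rewrite mulr0 addr0 invr1 mulr1.
  apply: cvgM => //; apply: cvgV; first by rewrite mulr0 addr0 oner_eq0.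
  by apply: cvgD; [exact: cvg_cst | apply: cvgM => //; exact: cvg_cst].
apply: (@squeeze_cvgr _ _ _ _
  (fun N => expR (- ((j N)%:R ^+ 2 / (m N)%:R * (1 + (-1) * ((j N)%:R / (m N)%:R))^-1)))
  (fun N => expR (- ((j N)%:R ^+ 2 / (m N)%:R * (1 + 1 * ((j N)%:R / (m N)%:R))^-1)))).
- near=> N.
  have lt : (j N < m N)%N by near: N.
  have := binr_ge (leqnn (j N)) lt; have := binr_le (leqnn (j N)) (ltnW lt).
  rewrite natrD natrB; last exact: ltnW.
  have m0 : (m N)%:R != 0 :> R by rewrite pnatr_eq0; lia.
  have p0 : (m N)%:R + (j N)%:R != 0 :> R by rewrite -natrD pnatr_eq0; lia.
  have d0 : (m N)%:R - (j N)%:R != 0 :> R by rewrite -natrB ?pnatr_eq0 ?subn_eq0 -?ltnNge; lia.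
  have -> : (j N)%:R ^+ 2 / (m N)%:R * (1 + (-1) * ((j N)%:R / (m N)%:R))^-1 = (j N)%:R ^+ 2 / ((m N)%:R - (j N)%:R) :> R.
    by field; rewrite m0 d0.
  have -> : (j N)%:R ^+ 2 / (m N)%:R * (1 + 1 * ((j N)%:R / (m N)%:R))^-1 = (j N)%:R ^+ 2 / ((m N)%:R + (j N)%:R) :> R.
    by field; rewrite m0 p0.
  by move=> -> ->.
- by apply: (cvg_fct (@continuous_expR R)); apply: cvgN.
- by apply: (cvg_fct (@continuous_expR R)); apply: cvgN.
Unshelve. all: by end_near.
Qed.

Definition cbin (m : nat) : R := 'C(m.*2, m)%:R / 4 ^+ m.

Lemma cbin_gt0 m : 0 < cbin m.
Proof. by rewrite divr_gt0 ?bin_mid_gt0// exprn_gt0. Qed.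

Lemma cbinS m : cbin m.+1 = cbin m * ((m.*2.+1)%:R / (m.*2.+2)%:R).
Proof.
have h : (m.+1 * 'C(m.*2.+2, m.+1) = 2 * m.*2.+1 * 'C(m.*2, m))%N.
  have f0 : (0 < m`! * m`!)%N by rewrite muln_gt0 fact_gt0.
  have hf n : ('C(n.*2, n) * (n`! * n`!) = n.*2`!)%N.
    have le : (n <= n.*2)%N by rewrite -addnn leq_addr.
    by have := bin_fact le; have -> : (n.*2 - n = n)%N by rewrite -addnn addnK.
  have h1 := hf m; have h2 := hf m.+1; rewrite doubleS in h2.
  apply/eqP; rewrite -(eqn_pmul2r f0) -(eqn_pmul2r (ltn0Sn m)); apply/eqP.
  move: h2; rewrite [m.+1`!]factS [m.*2.+2`!]factS [m.*2.+1`!]factS -h1 => h2.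
  transitivity ('C(m.*2.+2, m.+1) * (m.+1 * m`! * (m.+1 * m`!)))%N; first by ring.
  by rewrite h2 -doubleS -mul2n; ring.
move/(congr1 (fun n => n%:R : R)) : h; rewrite !natrM => h.
rewrite /cbin exprS doubleS.
have n1 : m.+1%:R != 0 :> R by rewrite pnatr_eq0.
have e : (m.*2.+2)%:R = 2 * m.+1%:R :> R by rewrite -natrM mul2n doubleS.
rewrite e; apply: (mulfI n1); rewrite mulrA h; field.
by rewrite nat1r n1 expf_neq0// pnatr_eq0.
Qed.

(** Wallis: m cbin^2 increases while (2m + 1) cbin^2 decreases from 1, so a positive limit exists.
    Its value is determined later. *)
Lemma cbin_cvg : exists2 G : R, 0 < G & m%:R * cbin m ^+ 2 @[m --> \oo] --> G.
Proof.
pose G m := m%:R * cbin m ^+ 2.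
have stepP (m : nat) : (m.*2.+1)%:R = 2 * m%:R + 1 :> R by rewrite -addn1 natrD -mul2n natrM.
have stepQ (m : nat) : (m.*2.+2)%:R = 2 * m%:R + 2 :> R by rewrite -addn2 natrD -mul2n natrM.
have inc : {homo G : n m / (n <= m)%N >-> n <= m}.
  apply: homo_leq => [x|y x z|m]; [exact: lexx|exact: le_trans|].
  have -> : G m.+1 = cbin m ^+ 2 * (m.+1%:R * ((2 * m%:R + 1) / (2 * m%:R + 2)) ^+ 2).
    by rewrite /G cbinS stepP stepQ; ring.
  rewrite {1}/G (mulrC m%:R); apply: ler_wpM2l; first exact: sqr_ge0.
  rewrite -natr1; move: (m%:R) (ler0n R m) => x x0.
  rewrite expr_div_n mulrA ler_pdivlMr; last by rewrite exprn_gt0//; lra.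
  nra.
have ub m : (2 * m%:R + 1) * cbin m ^+ 2 <= 1.
  elim: m => [|m IH]; first by rewrite /cbin /= bin0 divr1 expr1n; lra.
  rewrite cbinS exprMn stepP stepQ -[m.+1%:R]natr1; apply: le_trans IH.
  rewrite mulrCA (mulrC _ (cbin m ^+ 2)); apply: ler_wpM2l; first exact: sqr_ge0.
  move: (m%:R) (ler0n R m) => x x0.
  rewrite expr_div_n mulrA ler_pdivrMr; last by rewrite exprn_gt0//; lra.
  rewrite -subr_ge0 [leRHS](_ : _ = 2 * x + 1); last by ring.
  lra.
have bd : has_ubound (range G).
  exists 1 => _ [m _ <-]; have := ub m; have := sqr_ge0 (cbin m); rewrite /G mulrDl; nra.
have cv := nondecreasing_cvgn inc bd.
exists (sup (range G)); last exact: cv.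
apply: (@lt_le_trans _ _ (G 1%N)); first by rewrite /G mul1r exprn_gt0// cbin_gt0.
by apply: ub_le_sup => //; exists 1%N.
Qed.

End BinomialLimits.

(** * The finite identity at roots of unity *)

Section Polya.
Variable R : realType.
Local Notation C := R[i].

Definition eir (t : R) : C := cexp ('i * (2 * pi * t)%:C).

Lemma Re_iM (y : R) : complex.Re ('i * y%:C) = 0.
Proof. by rewrite /= !mul0r mulr0 subrr. Qed.

Lemma Im_iM (y : R) : complex.Im ('i * y%:C) = y.
Proof. by rewrite /= mul0r mul1r add0r. Qed.

Lemma cexp_i (y : R) : cexp ('i * y%:C) = cos y +i* sin y.
Proof. by rewrite /cexp Re_iM Im_iM expR0 mul1r. Qed.

Lemma eirE t : eir t = cos (2 * pi * t) +i* sin (2 * pi * t).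
Proof. exact: cexp_i. Qed.

Lemma eirD t s : eir (t + s) = eir t * eir s.
Proof. by rewrite /eir -cexpD mulrDr rmorphD mulrDr. Qed.

Lemma eir0 : eir 0 = 1.
Proof. by rewrite /eir mulr0 mulr0 cexp0. Qed.

Lemma eir1 : eir 1 = 1.
Proof. by rewrite eirE mulr1 mulr_natl cos2pi sin2pi. Qed.

Lemma eirMn t k : eir (t *+ k) = eir t ^+ k.
Proof. by rewrite /eir -cexpMn -mulrnAr -rmorphMn mulrnAr. Qed.

Lemma eirN t : eir (- t) = (eir t)^-1.
Proof. by rewrite /eir -cexpN mulrN rmorphN mulrN. Qed.

Lemma cabs_eir t : cabs (eir t) = 1.
Proof. by rewrite /eir cabs_cexp Re_iM expR0. Qed.

Lemma eir_int (k : int) : eir k%:~R = 1.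
Proof.
case: k => n; first by rewrite -pmulrn eirMn eir1 expr1n.
by rewrite NegzE rmorphN /= eirN -pmulrn eirMn eir1 expr1n invr1.
Qed.

Lemma eir_neq1 (t : R) : 0 < t < 1 -> eir t != 1.
Proof.
move=> /andP[t0 t1]; rewrite eirE; apply/eqP => -[h _].
have e : 2 * pi * t = (pi * t) *+ 2 by rewrite -[RHS]mulr_natl mulrA.
have := h; rewrite e cos_mulr2n => h2.
have s0 : 0 < sin (pi * t).
  have p0 := pi_gt0 R; apply: sin_gt0_pi; rewrite mulr_gt0//=.
  by rewrite -[ltRHS]mulr1 ltr_pM2l.
have := cos2Dsin2 (pi * t); have : 0 < sin (pi * t) ^+ 2 by rewrite exprn_gt0.
by move: h2; rewrite mulr2n; lra.
Qed.

(** Orthogonality of characters: a geometric sum whose ratio is an l-th root of unity, equal to 1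
    only if l divides n. *)
Lemma char_sum (h : nat) (n : int) : let l := h.*2.+1 in
  \sum_(r < l) eir (r%:R * (n%:~R / l%:R)) = if (l%:Z %| n)%Z then l%:R else 0.
Proof.
move=> l; have l0 : l%:R != 0 :> R by rewrite pnatr_eq0.
have lz : l%:Z != 0 by [].
under eq_bigr => r _ do rewrite mulr_natl eirMn.
case: ifP => [/dvdzP[q ->]|ndiv].
  under eq_bigr => r _ do rewrite intrM -pmulrn mulfK// eir_int expr1n.
  by rewrite sumr_const card_ord.
set z := eir _.
have z1 : z != 1.
  rewrite /z (divz_eq n l) intrD intrM -[l%:Z%:~R]pmulrn mulrDl mulfK// eirD eir_int mul1r.
  have m0 := modz_ge0 n lz; have ml := ltz_pmod n (isT : 0 < l%:Z).
  have mn : (n %% l)%Z != 0 by apply: contraFN ndiv => /eqP e; apply/dvdz_mod0P.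
  apply: eir_neq1; rewrite divr_gt0 ?ltr0n ?ltr0z ?lt0r ?mn//=.
  by rewrite ltr_pdivrMr ?ltr0n// mul1r pmulrn ltr_int.
have zl : z ^+ l = 1 by rewrite /z -eirMn -[_ *+ l]mulr_natr divfK// eir_int.
have z1' : z - 1 != 0 by rewrite subr_eq0.
by apply: (mulfI z1'); rewrite -subrX1 zl subrr mulr0.
Qed.

Lemma cos_pow_expand (m : nat) (x : R) :
  (cos x ^+ m.*2)%:C * 4 ^+ m =
  \sum_(j < m.*2.+1) 'C(m.*2, j)%:R * cexp ('i * (2 * x * (m%:Z - j%:Z)%:~R)%:C) :> C.
Proof.
have e4 : 4 ^+ m = 2 ^+ m.*2 :> C by rewrite -mul2n exprM; congr (_ ^+ m); ring.
have c2 : (cos x)%:C * 2 = cexp ('i * x%:C) + cexp (- ('i * x%:C)).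
  rewrite -mulrN -rmorphN !cexp_i cosN sinN; simpc.
  by congr (_ +i* _); ring.
rewrite rmorphXn e4 -exprMn c2 exprDn; apply: eq_bigr => j _.
rewrite -mulr_natl -!cexpMn -cexpD; congr (_ * cexp _).
have le : (j <= m.*2)%N by rewrite -ltnS.
have dE : (m.*2)%:R = 2 * m%:R :> C by rewrite -mul2n natrM.
rewrite -[_ *+ (_ - _)]mulr_natl -[X in _ + X]mulr_natl natrB// dE.
have -> : (2 * x * (m%:Z - j%:Z)%:~R)%:C = 2 * x%:C * (m%:R - j%:R) :> C.
  by rewrite intrD rmorphN /= -!pmulrn !rmorphM rmorphB !rmorph_nat.
ring.
Qed.

(** Residues are taken from -h to h, so that they exhaust the integers as h grows. *)
Definition shiftr (h : nat) (r : 'I_h.*2.+1) : int := r%:Z - h%:Z.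

(* Expand the even power of the cosine binomially and sum over the [h.*2.+1]-st roots of unity: only the frequencies divisible by [h.*2.+1] survive. *)
Lemma polya_fin (s : R) (m h : nat) (S : C) : let l := h.*2.+1 in
  hsum (fun k : int => (binr R m (`|k| * l))%:C * eir (s * k%:~R)) S ->
  \sum_(r < l) (cos (pi * (((shiftr r)%:~R + s) / l%:R)) ^+ m.*2)%:C = (l%:R * cbin R m)%:C * S.
Proof.
move=> l hS.
have l0 : l%:R != 0 :> R by rewrite pnatr_eq0.
(* A function of the frequency, summed along the multiples of [l] in [hF] and along n = m - j in
   [hF2]; the two agree since the coefficients vanish for |n| > m. *)
pose F (n : int) : C := if (l%:Z %| n)%Z then (binr R m `|n|)%:C * eir (s * (n%:~R / l%:R)) else 0.
have hF : hsum F S.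
  apply: (@hsum_inj _ _ _ (fun k : int => k * l%:Z)).
  - by move=> k k' /mulIf; apply.
  - move=> n; rewrite /F; case: ifP => [/dvdzP[q ->] _|]; last by rewrite eqxx.
    by exists q.
  - apply: eq_hsum hS => k; rewrite /F dvdz_mull// abszM intrM -[l%:Z%:~R]pmulrn mulfK//.
have nj_inj : injective (fun j : 'I_m.*2.+1 => m%:Z - j%:Z).
  by move=> j j' /addrI /oppr_inj [] /ord_inj.
have hF2 : hsum F (\sum_(j < m.*2.+1) F (m%:Z - j%:Z)).
  apply: (hsum_inj nj_inj).
    move=> n; rewrite /F; case: ifP => [_|]; last by rewrite eqxx.
    case: (leqP `|n| m) => [le _|lt]; last first.
      by rewrite /binr bin_small ?mul0r ?eqxx// -addnn ltn_add2l.
    have lt : (`|(m%:Z - n)%R| < m.*2.+1)%N by lia.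
    by exists (Ordinal lt) => /=; lia.
  rewrite -[\sum_(j < _) _]big_enum /=; apply: hsum_fin; first exact: enum_uniq.
  by move=> j; rewrite mem_enum.
rewrite (hsum_unique hF hF2) => {hF hF2 hS}.
have p4 : 4 ^+ m != 0 :> C by rewrite expf_neq0// pnatr_eq0.
apply: (mulIf p4); rewrite big_distrl /=.
under eq_bigr => r _ do rewrite cos_pow_expand.
rewrite exchange_big /= big_distrr /= big_distrl /=; apply: eq_bigr => j _.
set n := m%:Z - j%:Z.
have binE : 'C(m.*2, j)%:R = (binr R m `|n| * 'C(m.*2, m)%:R)%:C :> C.
  rewrite /binr divfK ?gt_eqF ?bin_mid_gt0// rmorph_nat; congr _%:R.
  have jle : (j <= m.*2)%N by rewrite -ltnS.
  rewrite /n; case: (leqP j m) => jm.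
    by rewrite -[RHS]bin_sub; [congr 'C(_, _)|]; lia.
  by congr 'C(_, _); lia.
rewrite -big_distrr /=.
have rE (r : 'I_l) : cexp ('i * (2 * (pi * (((shiftr r)%:~R + s) / l%:R)) * n%:~R)%:C) =
    eir ((s - h%:R) * (n%:~R / l%:R)) * eir (r%:R * (n%:~R / l%:R)).
  rewrite -eirD /eir; congr (cexp (_ * _%:C)).
  rewrite /shiftr intrD rmorphN /= -!pmulrn; move: (pi : R) => P; field.
  by [].
under eq_bigr => r _ do rewrite rE.
rewrite -big_distrr /= char_sum /F -/l.
case: ifP => [/dvdzP[q nE]|_]; last by rewrite !mulr0 mul0r.
rewrite binE; have -> : n%:~R / l%:R = q%:~R :> R by rewrite nE intrM -[l%:Z%:~R]pmulrn mulfK.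
(* As [n] is the multiple q l, recentring the residues by [h] only contributes the integral phase -h
   q. *)
have -> : eir ((s - h%:R) * q%:~R) = eir (s * q%:~R).
  have -> : (s - h%:R) * q%:~R = s * q%:~R + (- h%:Z * q)%:~R :> R by rewrite intrM rmorphN /= -pmulrn; ring.
  by rewrite eirD eir_int mulr1.
have cE : (cbin R m)%:C * 4 ^+ m = ('C(m.*2, m)%:R)%:C :> C.
  have -> : 4 ^+ m = (4 ^+ m)%:C :> C by rewrite rmorphXn rmorph_nat.
  by rewrite -rmorphM divfK// expf_neq0// pnatr_eq0.
have ME (x y : R) : (x * y)%:C = x%:C * y%:C by exact: rmorphM.
rewrite (ME (binr R m _)) (ME l%:R) -cE [l%:R%:C]rmorph_nat; move: (l%:R : C) (4 ^+ m : C) (eir _) => a c d.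
by move: (cbin R m)%:C (binr R m _)%:C => e f; ring.
Qed.

End Polya.

(** * Passage to the limit and the real Poisson formula *)

Section PolyaLimit.
Variable R : realType.
Local Notation C := R[i].
Local Open Scope classical_set_scope.

Lemma sqr_absz (k : int) : (`|k|%N)%:R ^+ 2 = k%:~R ^+ 2 :> R.
Proof. by case: k => n //; rewrite NegzE rmorphN sqrrN. Qed.

Lemma gauss_wt (d x : R) : 0 < d -> expR (- (d * x ^+ 2)) <= (1 + d^-1) * (1 + x ^+ 2)^-1.
Proof.
move=> d0; have x2 := sqr_ge0 x.
rewrite expRN ler_pdivlMr ?ltr_pwDl// mulrC ler_pdivrMr ?expR_gt0//.
apply: le_trans (_ : (1 + d^-1) * (1 + d * x ^+ 2) <= _).
  rewrite -subr_ge0 [leRHS](_ : _ = d^-1 + d * x ^+ 2); last by field; rewrite gt_eqF.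
  by have dd := ltW d0; apply: addr_ge0; [rewrite invr_ge0 | exact: mulr_ge0].
rewrite ler_wpM2l ?addr_ge0 ?invr_ge0 ?(ltW d0)//; exact: expR_ge1Dx.
Qed.

Lemma bsum_gauss (d : R) : 0 < d -> bsum (fun k : int => expR (- (d * k%:~R ^+ 2))).
Proof.
move=> d0; apply: le_bsum (bsumZ _ (bsum_wt R)) => [k|]; first exact: gauss_wt.
by rewrite addr_ge0 ?invr_ge0 ?(ltW d0).
Qed.

(** For nonzero r the shift is at most |r|/2; the majorant can thus be chosen independent of s. *)
Lemma sqr_shift_ge (s : R) (r : int) : `|s| <= 2^-1 -> r%:~R ^+ 2 / 4 <= (r%:~R + s) ^+ 2.
Proof.
move=> s1; have [->|r0] := eqVneq r 0; first by rewrite expr0n mul0r sqr_ge0.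
have r1 : 1 <= `|r%:~R : R| by rewrite -intr_norm -[1]/(1%:~R) ler_int; lia.
rewrite ler_pdivrMr// -[_ * 4](_ : ((r%:~R + s) * 2) ^+ 2 = _); last by ring.
rewrite -ler_sqrt ?sqr_ge0// !sqrtr_sqr normrM [`|2|]ger0_norm//.
have : `|r%:~R| - `|s| <= `|r%:~R + s| by rewrite -[`|s|]normrN -{2}(opprK s) lerB_dist.
lra.
Qed.

(* With [m] close to [T * (h.*2.+1) ^ 2] both sides of [polya_fin] become Gaussian sums as [h] grows. *)
Section Seqs.
Variables (T s : R).
Hypotheses (T0 : 0 < T) (s1 : `|s| <= 2^-1).
Let l (h : nat) := h.*2.+1.
Let m (h : nat) := Num.trunc (T * (l h)%:R ^+ 2).

Let l0 h : 0 < (l h)%:R :> R. Proof. by rewrite ltr0n. Qed.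

Let m_le h : (m h)%:R <= T * (l h)%:R ^+ 2.
Proof. by rewrite truncn_le mulr_ge0 ?sqr_ge0 ?ltW. Qed.

Let m_gt h : T * (l h)%:R ^+ 2 - 1 <= (m h)%:R.
Proof.
have /andP[_] : (m h)%:R <= T * (l h)%:R ^+ 2 < (m h).+1%:R.
  by apply: truncn_itv; rewrite mulr_ge0 ?sqr_ge0 ?ltW.
by rewrite -natr1 => /ltW; lra.
Qed.

Let linv_cvg : (l h)%:R^-1 @[h --> \oo] --> (0 : R).
Proof.
apply: (@squeeze_cvgr _ _ _ _ (fun=> 0) (@harmonic R)); last exact: cvg_harmonic.
  near=> h; rewrite invr_ge0 ler0n /= lef_pV2 ?posrE//.
  by rewrite ler_nat /l ltnS -addnn leq_addr.
exact: cvg_cst.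
Unshelve. all: by end_near.
Qed.

Let ml_cvg : (m h)%:R * ((l h)%:R^-1) ^+ 2 @[h --> \oo] --> T.
Proof.
apply: (@squeeze_cvgr _ _ _ _ (fun h => T - ((l h)%:R^-1) ^+ 2) (fun=> T)).
- near=> h; have p : 0 < ((l h)%:R^-1 : R) ^+ 2 by rewrite exprn_gt0// invr_gt0.
  have e : (l h)%:R ^+ 2 * ((l h)%:R^-1) ^+ 2 = 1 :> R by rewrite -exprMn divff ?expr1n// gt_eqF.
  apply/andP; split.
    have := ler_wpM2r (ltW p) (m_gt h); rewrite mulrBl mul1r -mulrA e mulr1; exact.
  by have := ler_wpM2r (ltW p) (m_le h); rewrite -mulrA e mulr1.
- apply: (@cvg_eqr _ _ (T - 0 ^+ 2)); first by rewrite expr0n subr0.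
  by apply: cvgB; [exact: cvg_cst | apply: (cvg_fct (@exprn_continuous R 2))].
- exact: cvg_cst.
Unshelve. all: by end_near.
Qed.

Let m_half : \forall h \near \oo, T * (l h)%:R ^+ 2 / 2 <= (m h)%:R.
Proof.
have T2 : T / 2 < T by have := T0; lra.
move/cvgrPdist_lt : ml_cvg => /(_ (T / 2)); rewrite divr_gt0// => /(_ isT).
apply: filterS => h; rewrite ltr_distlC => /andP[lo _].
have := l0 h; move: (l h)%:R lo => x lo x0.
have x2 : 0 < x ^+ 2 by rewrite exprn_gt0.
rewrite exprVn ltr_pdivlMr// in lo; have : (T - T / 2) * x ^+ 2 = T * x ^+ 2 / 2 by field.
by move=> <-; exact: ltW.
Qed.

Let m_oo : m h @[h --> \oo] --> \oo.
Proof.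
apply/cvgnyPge => A; move: m_half; apply: filter_app; near=> h => le.
rewrite -(ler_nat R); apply: le_trans le.
have hA : 2 * A%:R / T <= h%:R :> R.
  near: h; exists (Num.trunc (2 * A%:R / T)).+1 => // h /= hh.
  have /truncn_itv /andP[_ /ltW /le_trans] : 0 <= 2 * A%:R / T by rewrite divr_ge0 ?mulr_ge0// ltW.
  by apply; rewrite ler_nat.
have hl : h%:R <= (l h)%:R ^+ 2 :> R.
  by rewrite -natrX ler_nat /l; nia.
rewrite ler_pdivrMr// in hA; have := ler_wpM2r (ltW T0) hl.
by rewrite (mulrC T); move: ((l h)%:R ^+ 2 * T) (h%:R * T) hA => p q; lra.
Unshelve. all: by end_near.
Qed.

(** The square of [l * cbin m] is m cbin^2 divided by m/l^2, hence tends to G/T. *)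
Lemma kappa_cvg (G : R) : 0 < G -> n%:R * cbin R n ^+ 2 @[n --> \oo] --> G ->
  (l h)%:R * cbin R (m h) @[h --> \oo] --> Num.sqrt (G / T).
Proof.
move=> G0 hG.
have h1 : (m h)%:R * cbin R (m h) ^+ 2 @[h --> \oo] --> G by apply: (cvg_comp _ _ m_oo hG).
have h2 : (m h)%:R * cbin R (m h) ^+ 2 * ((m h)%:R * ((l h)%:R^-1) ^+ 2)^-1 @[h --> \oo] --> G / T.
  by apply: cvgM => //; apply: cvgV => //; rewrite gt_eqF.
have := cvg_fct (@sqrt_continuous R) h2; apply: cvg_trans; apply: near_eq_cvg.
move: m_half; apply: filterS => h /= le.
have mp : 0 < (m h)%:R :> R by apply: lt_le_trans le; rewrite divr_gt0// mulr_gt0// exprn_gt0.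
have -> : (m h)%:R * cbin R (m h) ^+ 2 * ((m h)%:R * ((l h)%:R^-1) ^+ 2)^-1 =
   ((l h)%:R * cbin R (m h)) ^+ 2 by field; rewrite !gt_eqF.
by rewrite sqrtr_sqr ger0_norm// mulr_ge0// ltW// cbin_gt0.
Qed.

(** The cosine side extended by zero to all integers, to give dominated convergence a fixed index
    set. *)
Let fL (h : nat) (r : int) : C :=
  if (`|r| <= h)%N then (cos (pi * ((r%:~R + s) / (l h)%:R)) ^+ (m h).*2)%:C else 0.

Let fL_sum h : hsum (fL h) (\sum_(r < l h) (cos (pi * (((shiftr r)%:~R + s) / (l h)%:R)) ^+ (m h).*2)%:C).
Proof.
have in1 : injective (@shiftr h) by move=> r r' /addIr [] /ord_inj.
apply: (hsum_inj in1).
  move=> r; rewrite /fL; case: ifP => [le _|]; last by rewrite eqxx.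
  have lt : (`|(r + h%:Z)%R| < h.*2.+1)%N by lia.
  by exists (Ordinal lt); rewrite /shiftr /=; lia.
have -> : \sum_(r < l h) (cos (pi * (((shiftr r)%:~R + s) / (l h)%:R)) ^+ (m h).*2)%:C =
    \sum_(r <- enum 'I_(l h)) fL h (shiftr r).
  rewrite big_enum /=; apply: eq_bigr => r _; rewrite /fL.
  by have -> : (`|shiftr r| <= h)%N by have := ltn_ord r; rewrite /shiftr /l; lia.
by apply: hsum_fin; [exact: enum_uniq | move=> r; rewrite mem_enum].
Qed.

(** |r + s| <= h + 1/2 = l/2, which is exactly the range where the cosine bound holds. *)
Let angle_le h (r : int) : (`|r| <= h)%N -> `|pi * ((r%:~R + s) / (l h)%:R)| <= pi / 2.
Proof.
move=> rh; have p0 := pi_gt0 R.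
rewrite normrM [`|pi|]gtr0_norm// ler_pM2l// normf_div [`|(l h)%:R|]gtr0_norm// ler_pdivrMr//.
apply: le_trans (ler_normD _ _) _.
have r1 : `|r%:~R| <= h%:R :> R by rewrite -intr_norm pmulrn ler_int; lia.
have -> : (l h)%:R = 2 * h%:R + 1 :> R by rewrite /l -addn1 natrD -mul2n natrM.
by move: (`|_|) (`|s|) (h%:R) r1 s1 => a c d; lra.
Qed.

(** The constant 1/32 is 1/4 from the sine bound, 1/4 from the shift and 1/2 from m >= T l^2/2. *)
Let fL_dom : \forall h \near \oo, forall r, cabs (fL h r) <= expR (- (T * pi ^+ 2 / 32 * r%:~R ^+ 2)).
Proof.
move: m_half; apply: filterS => h le r; rewrite /fL; case: ifP => rh; last by rewrite cabs0 expR_ge0.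
rewrite cabs_real ger0_norm; last by rewrite -mul2n exprM exprn_ge0// sqr_ge0.
apply: le_trans (cos_pow_le _ (angle_le rh)) _; rewrite ler_expR lerN2.
have h1 := sqr_shift_ge r s1.
have L2 : 0 < (l h)%:R ^+ 2 :> R by rewrite exprn_gt0.
have p2 : 0 < (pi : R) ^+ 2 by rewrite exprn_gt0// pi_gt0.
rewrite exprMn expr_div_n; have Ln := gt_eqF L2.
move: (pi ^+ 2 : R) p2 (r%:~R ^+ 2) ((r%:~R + s) ^+ 2) h1 (sqr_ge0 (r%:~R + s)) ((l h)%:R ^+ 2) L2 Ln le => P P0 a c ac c0 L L0 Ln le.
apply: (@le_trans _ _ (T * P / 8 * c)).
  have -> : T * P / 32 * a = T * P / 8 * (a / 4) by field.
  by rewrite ler_wpM2l// divr_ge0// mulr_ge0// ltW.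
have -> : T * P / 8 * c = T * L / 2 * (P * (c / L) / 4) by field; rewrite Ln.
by rewrite ler_wpM2r// !mulr_ge0// ?invr_ge0 ltW.
Qed.

Let fL_cvg (r : int) : ccvg (fL ^~ r) (expR (- (T * (pi * (r%:~R + s)) ^+ 2)))%:C.
Proof.
apply: (@eq_ccvg _ (fun h => (cos (pi * ((r%:~R + s) / (l h)%:R)) ^+ (m h).*2)%:C)).
  by exists `|r|%N => // h /= rh; rewrite /fL rh.
apply: ccvg_real; apply: cos_pow_cvg.
  apply: (@cvg_eqr _ _ (pi * ((r%:~R + s) * 0))); first by rewrite !mulr0.
  by apply: cvgM; [exact: cvg_cst | apply: cvgM => //; exact: cvg_cst].
have -> : (fun h => (m h)%:R * (pi * ((r%:~R + s) / (l h)%:R)) ^+ 2) =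
    (fun h => (m h)%:R * ((l h)%:R^-1) ^+ 2 * (pi * (r%:~R + s)) ^+ 2).
  by apply/funext => h; rewrite mulrA exprMn; ring.
by apply: cvgM => //; exact: cvg_cst.
Qed.

Let fR (h : nat) (k : int) : C := (binr R (m h) (`|k| * l h))%:C * eir (s * k%:~R).

(** With m <= T l^2 and l >= 1, (k l)^2/(2m + 1) >= k^2/(2T + 1). *)
Let fR_dom h k : cabs (fR h k) <= expR (- ((2 * T + 1)^-1 * k%:~R ^+ 2)).
Proof.
rewrite cabsM cabs_eir mulr1 cabs_real ger0_norm ?binr_ge0//.
apply: le_trans (binr_le_gauss _ _ _) _; rewrite ler_expR lerN2.
have L1 : 1 <= (l h)%:R ^+ 2 :> R by rewrite exprn_ege1// ler1n.
have mE : (m h).*2.+1%:R = 2 * (m h)%:R + 1 :> R by rewrite -addn1 natrD -mul2n natrM.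
have kE : (`|k| * l h)%:R ^+ 2 = k%:~R ^+ 2 * (l h)%:R ^+ 2 :> R.
  by rewrite natrM exprMn sqr_absz.
rewrite mE kE ler_pdivlMr; last by rewrite ltr_wpDl// mulr_ge0.
rewrite mulrAC mulrC ler_wpM2l ?sqr_ge0// mulrC ler_pdivrMr; last by have := T0; lra.
have := m_le h; have := T0; move: ((l h)%:R ^+ 2) L1 ((m h)%:R) => L L1 M Tp; nra.
Qed.

Let fR_cvg (k : int) : ccvg (fR ^~ k) ((expR (- (k%:~R ^+ 2 / T)))%:C * eir (s * k%:~R)).
Proof.
apply: ccvgM; last first.
  by rewrite /ccvg subrr cabs0; exact: cvg_cst.
apply: ccvg_real.
have T0' : T != 0 by rewrite gt_eqF.
have mp : \forall h \near \oo, 0 < (m h)%:R :> R.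
  move: m_half; apply: filterS => h; apply: lt_le_trans.
  by rewrite divr_gt0// mulr_gt0// exprn_gt0.
have c0 : (`|k| * l h)%:R / (m h)%:R @[h --> \oo] --> (0 : R).
  apply: (@cvg_eqr _ _ (`|k|%:R * 0 * T^-1)); first by rewrite mulr0 mul0r.
  have : `|k|%:R * (l h)%:R^-1 * ((m h)%:R * ((l h)%:R^-1) ^+ 2)^-1 @[h --> \oo] --> `|k|%:R * 0 * T^-1.
    by apply: cvgM; [apply: cvgM => //; exact: cvg_cst | exact: cvgV].
  apply: cvg_trans; apply: near_eq_cvg; move: mp; apply: filterS => h h0 /=.
  by rewrite natrM; field; rewrite !gt_eqF.
apply: binr_cvg => //.
  move/cvgrPdist_lt : c0 => /(_ 1 ltr01) c1; move: mp; apply: filter_app; move: c1.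
  apply: filterS => h; rewrite sub0r normrN ger0_norm ?divr_ge0// => lt m0.
  by move: lt; rewrite ltr_pdivrMr// mul1r ltr_nat.
have : k%:~R ^+ 2 * ((m h)%:R * ((l h)%:R^-1) ^+ 2)^-1 @[h --> \oo] --> k%:~R ^+ 2 * T^-1.
  by apply: cvgM; [exact: cvg_cst | exact: cvgV].
apply: cvg_trans; apply: near_eq_cvg; move: mp; apply: filterS => h h0 /=.
rewrite natrM exprMn sqr_absz; move: (k%:~R) => x.
by field; rewrite !gt_eqF.
Qed.

(** The two finite sides agree for every h; dominated convergence is applied to each, and the factor
    is the limit of [l * cbin m]. *)
Lemma polya_limit (G : R) : 0 < G -> n%:R * cbin R n ^+ 2 @[n --> \oo] --> G ->
  exists S,
  hsum (fun r : int => (expR (- (T * (pi * (r%:~R + s)) ^+ 2)))%:C) ((Num.sqrt (G / T))%:C * S) /\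
  hsum (fun k : int => (expR (- (k%:~R ^+ 2 / T)))%:C * eir (s * k%:~R)) S.
Proof.
move=> G0 hG.
have p0 : 0 < (pi : R) by exact: pi_gt0.
have bL : bsum (fun r : int => expR (- (T * pi ^+ 2 / 32 * r%:~R ^+ 2))).
  by apply: bsum_gauss; rewrite divr_gt0// mulr_gt0// exprn_gt0.
have T1 : 0 < 2 * T + 1 by have := T0; lra.
have bR : bsum (fun k : int => expR (- ((2 * T + 1)^-1 * k%:~R ^+ 2))).
  by apply: bsum_gauss; rewrite invr_gt0.
have /boolp.choice[SR hSR] h : exists S, hsum (fR h) S.
  by apply: hsum_ex; apply: le_bsum bR; exact: fR_dom.
have [L hL] : exists L, hsum (fun r : int => (expR (- (T * (pi * (r%:~R + s)) ^+ 2)))%:C) L.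
  apply: hsum_ex; apply: le_bsum bL => r.
  rewrite cabs_real ger0_norm ?expR_ge0// ler_expR lerN2.
  have h1 := sqr_shift_ge r s1; rewrite exprMn [leRHS]mulrA.
  have P : 0 < T * pi ^+ 2 by rewrite mulr_gt0// exprn_gt0.
  move: (T * pi ^+ 2) P (r%:~R ^+ 2) ((r%:~R + s) ^+ 2) h1 (sqr_ge0 (r%:~R + s)) => Q Q0 a c ac c0.
  have -> : Q / 32 * a = Q * (a / 32) by ring.
  by rewrite ler_wpM2l ?(ltW Q0)//; lra.
have [S hS] : exists S, hsum (fun k : int => (expR (- (k%:~R ^+ 2 / T)))%:C * eir (s * k%:~R)) S.
  apply: hsum_ex; have := bsum_gauss (_ : 0 < T^-1); rewrite invr_gt0 => /(_ T0).
  apply: le_bsum => k; rewrite cabsM cabs_eir mulr1 cabs_real ger0_norm ?expR_ge0//.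
  by rewrite mulrC.
exists S; split=> //; suff <- : L = (Num.sqrt (G / T))%:C * S by [].
have c1 := tannery bL fL_dom fL_cvg fL_sum hL.
have c2 : ccvg SR S.
  by apply: tannery bR _ fR_cvg hSR hS; apply: filterE => h; exact: fR_dom.
apply: ccvg_unique c1 _.
have c3 := ccvgM (ccvg_real (kappa_cvg G0 hG)) c2.
apply: eq_ccvg c3; apply: filterE => h.
by rewrite (polya_fin (hSR h)).
Qed.

End Seqs.

(* At [T = pi^-1], [s = 0] both sides of [polya_limit] are the same series, which pins down the constant [G]. *)
Lemma cbin_cvg_pi : n%:R * cbin R n ^+ 2 @[n --> \oo] --> (pi^-1 : R).
Proof.
have [G G0 hG] := cbin_cvg R.
have p0 : 0 < (pi : R) by exact: pi_gt0.
have ip0 : 0 < (pi^-1 : R) by rewrite invr_gt0.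
have s0 : `|0 : R| <= 2^-1 by rewrite normr0 invr_ge0.
have [S [h1 h2]] := polya_limit ip0 s0 G0 hG.
have h3 : hsum (fun k : int => (expR (- (k%:~R ^+ 2 / pi^-1)))%:C * eir (0 * k%:~R)) ((Num.sqrt (G / pi^-1))%:C * S).
  apply: eq_hsum h1 => k; rewrite mul0r eir0 mulr1 addr0; congr (expR (- _))%:C.
  by move: (k%:~R : R) (pi : R) p0 => x P P0; field; rewrite gt_eqF.
have e := hsum_unique h3 h2.
(* All terms are positive and the one at 0 equals 1, so partial sums containing it stay away from
   0. *)
have S1 : S != 0.
  apply/eqP => S0; rewrite S0 in h2; have [J0 /(_ (undup (0 :: J0))) H] := h2 1 ltr01.
  have sJ : {subset J0 <= undup (0 :: J0)} by move=> i iJ; rewrite mem_undup inE iJ orbT.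
  have := H (undup_uniq _) sJ; rewrite subr0.
  under eq_bigr do rewrite mul0r eir0 mulr1.
  rewrite -rmorph_sum cabs_real ger0_norm; last by apply: sumr_ge0 => *; exact: expR_ge0.
  apply/negP; rewrite -leNgt.
  apply: le_trans (_ : \sum_(i <- [:: 0 : int]) expR (- (i%:~R ^+ 2 / pi^-1)) <= _).
    by rewrite big_seq1 expr0n mul0r oppr0 expR0.
  apply: ler_sum_sub => //; first exact: undup_uniq.
    by move=> i; rewrite inE => /eqP ->; rewrite mem_undup inE eqxx.
  by move=> i; exact: expR_ge0.
have {e} : Num.sqrt (G / pi^-1) = 1.
  by apply: cabs_inj; apply: (mulIf S1); rewrite e mul1r.
move=> /(congr1 (fun x => x ^+ 2)); rewrite sqr_sqrtr ?divr_ge0 ?ltW// expr1n => e.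
suff <- : G = pi^-1 by [].
by move/(congr1 (fun x => x * pi^-1)) : e; rewrite mul1r divfK// gt_eqF.
Qed.

(** The choice T = 1/(pi A) with G = 1/pi gives G/T = A. *)
Lemma poisson_real (A s : R) : 0 < A -> `|s| <= 2^-1 -> exists S,
  hsum (fun r : int => (expR (- (pi / A * (r%:~R + s) ^+ 2)))%:C) S /\
  hsum (fun k : int => (expR (- (pi * A * k%:~R ^+ 2)))%:C * eir (s * k%:~R)) ((Num.sqrt A)^-1%:C * S).
Proof.
move=> A0 s1; have p0 : 0 < (pi : R) by exact: pi_gt0.
have ip0 : 0 < (pi^-1 : R) by rewrite invr_gt0.
have T0 : 0 < (pi * A)^-1 by rewrite invr_gt0 mulr_gt0.
have [S [h1 h2]] := polya_limit T0 s1 ip0 cbin_cvg_pi.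
exists ((Num.sqrt A)%:C * S); split.
  have -> : A = pi^-1 / (pi * A)^-1.
    by move: (pi : R) p0 => P P0; field; rewrite !gt_eqF.
  apply: eq_hsum h1 => r; congr (expR (- _))%:C.
  by move: (r%:~R + s) (pi : R) p0 => x P P0; field; rewrite !gt_eqF.
rewrite mulrA -rmorphM mulVf ?mul1r; last by rewrite gt_eqF// sqrtr_gt0.
apply: eq_hsum h2 => k; congr ((expR (- _))%:C * _).
by rewrite invrK mulrC.
Qed.

End PolyaLimit.

(** * Two variables and polynomial weights *)

Section RealEmbedding.
Variable R : realType.
Local Notation C := R[i].

Lemma rcM (x y : R) : (x * y)%:C = x%:C * y%:C. Proof. exact: rmorphM. Qed.
Lemma rcD (x y : R) : (x + y)%:C = x%:C + y%:C. Proof. exact: rmorphD. Qed.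
Lemma rcN (x : R) : (- x)%:C = - x%:C. Proof. exact: rmorphN. Qed.
Lemma rcB (x y : R) : (x - y)%:C = x%:C - y%:C. Proof. exact: rmorphB. Qed.
Lemma rcX (x : R) k : (x ^+ k)%:C = x%:C ^+ k. Proof. exact: rmorphXn. Qed.
Lemma rcV (x : R) : (x^-1)%:C = (x%:C)^-1. Proof. exact: fmorphV. Qed.
Lemma rcn k : (k%:R : R)%:C = k%:R. Proof. exact: rmorph_nat. Qed.
Lemma rcz (k : int) : (k%:~R : R)%:C = k%:~R. Proof. exact: rmorph_int. Qed.

End RealEmbedding.

(** * Complex shifts and binary quadratic forms *)

Section Poisson.
Variable R : realType.
Local Notation C := R[i].

(** Completing the square: half of the quadratic term absorbs any linear one. *)
Lemma lin_sqr_le (d c x : R) : 0 < d -> - (d * x ^+ 2) + c * x <= - (d / 2 * x ^+ 2) + c ^+ 2 / (2 * d).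
Proof.
move=> d0; rewrite -subr_ge0 [leRHS](_ : _ = (d * x - c) ^+ 2 / (2 * d)); last first.
  by field; rewrite gt_eqF.
by rewrite divr_ge0 ?sqr_ge0// mulr_ge0// ltW.
Qed.

Lemma bsum_gauss1 (f : int -> R) (d c c0 : R) : 0 < d ->
  (forall k, f k <= expR (- (d * k%:~R ^+ 2) + c * k%:~R + c0)) -> bsum f.
Proof.
move=> d0 hf; have d2 : 0 < d / 2 by rewrite divr_gt0.
have := bsumZ (expR_ge0 (c ^+ 2 / (2 * d) + c0)) (bsum_gauss d2).
apply: le_bsum => k; apply: le_trans (hf k) _; rewrite -expRD ler_expR.
by have := lin_sqr_le c k%:~R d0; lra.
Qed.

Lemma bsum_gauss2 (f : int * int -> R) (d c1 c2 c0 : R) : 0 < d ->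
  (forall k, f k <= expR (- (d * (k.1%:~R ^+ 2 + k.2%:~R ^+ 2)) + (c1 * k.1%:~R + c2 * k.2%:~R) + c0)) ->
  bsum f.
Proof.
move=> d0 hf; have d2 : 0 < d / 2 by rewrite divr_gt0.
have g0 (k : int) : 0 <= expR (- (d / 2 * k%:~R ^+ 2)) by exact: expR_ge0.
have := bsumZ (expR_ge0 (c1 ^+ 2 / (2 * d) + c2 ^+ 2 / (2 * d) + c0)) (bsumM g0 g0 (bsum_gauss d2) (bsum_gauss d2)).
apply: le_bsum => k; apply: le_trans (hf k) _; rewrite -!expRD ler_expR.
have := lin_sqr_le c1 k.1%:~R d0; have := lin_sqr_le c2 k.2%:~R d0.
by move: (k.1%:~R : R) (k.2%:~R : R) => x z; rewrite mulrDr; lra.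
Qed.

Lemma absz_real (k : int) : cabs k%:~R = `|k%:~R| :> R.
Proof. by rewrite -cabs_real rmorph_int. Qed.

Lemma expfam_gauss (w l : int -> C) (d b c : R) : 0 < d -> 0 <= b ->
  (forall k, cabs (w k) <= expR (- (d * k%:~R ^+ 2) + c * k%:~R)) ->
  (forall k, cabs (l k) <= b * `|k%:~R|) -> expfam w l.
Proof.
move=> d0 b0 hw hl S S0; have d2 : 0 < d / 2 by rewrite divr_gt0.
apply: (@bsum_gauss1 _ (d / 2) c ((S * b) ^+ 2 / (2 * d)) d2) => k.
apply: (@le_trans _ _ (expR (- (d * k%:~R ^+ 2) + c * k%:~R) * expR (S * b * `|k%:~R|))).
  by apply: ler_pM; rewrite ?cabs_ge0 ?expR_ge0// ler_expR -mulrA ler_wpM2l.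
rewrite -expRD ler_expR.
have := lin_sqr_le (S * b) `|k%:~R| d0; rewrite -normrX [`|_ ^+ 2|]ger0_norm ?sqr_ge0//.
by lra.
Qed.

Lemma expfamZ (I : choiceType) (w l : I -> C) c : expfam w l -> expfam (fun i => c * w i) l.
Proof.
move=> H S /H; move=> /(bsumZ (cabs_ge0 c)); apply: le_bsum => i.
by rewrite cabsM mulrA.
Qed.

Lemma gauss_cexp (a : R) (k : int) : (expR (- (a * k%:~R ^+ 2)))%:C = cexp (- a%:C * k%:~R ^+ 2).
Proof.
rewrite -cexp_real; congr cexp.
by rewrite rcN rcM rcX rcz mulNr.
Qed.

(** Both sides are exponential families in the shift: frequencies 2 pi i k without quadratic term on
    the left, -2 pi r/A with quadratic coefficient -pi/A on the right. Their agreement for real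
    shifts in (0, 1/2] extends to all complex ones. *)
Lemma poisson1 (A : R) (z : C) : 0 < A -> exists S,
  hsum (fun k : int => cexp (- (pi * A)%:C * k%:~R ^+ 2 + 2 * (pi%:C) * 'i * (z * k%:~R))) S /\
  hsum (fun r : int => cexp (- (pi / A)%:C * (z + r%:~R) ^+ 2)) ((Num.sqrt A)%:C * S).
Proof.
move=> A0; have p0 : 0 < (pi : R) by exact: pi_gt0.
pose w (k : int) : C := (expR (- (pi * A * k%:~R ^+ 2)))%:C.
pose w' (k : int) : C := (expR (- (pi / A * k%:~R ^+ 2)))%:C.
have pA : 0 < pi / A by rewrite divr_gt0.
have pA' : 0 < pi * A by rewrite mulr_gt0.
have f1 : expfam w (fun k => 2 * (pi%:C) * 'i * k%:~R).
  apply: (@expfam_gauss _ _ (pi * A) (2 * pi) 0) => //; first by rewrite mulr_ge0// ltW.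
    by move=> k; rewrite /w cabs_real ger0_norm ?expR_ge0// mul0r addr0.
  move=> k; rewrite !cabsM absz_real cabs_real cabs_nat (ger0_norm (ltW p0)).
  have -> : cabs ('i : C) = 1 by rewrite /cabs normc_def /= expr0n expr1n add0r sqrtr1.
  by rewrite mulr1.
have f2 : expfam w' (fun r => - (2 * (pi / A))%:C * r%:~R).
  apply: (@expfam_gauss _ _ (pi / A) (2 * (pi / A)) 0) => //; first by rewrite mulr_ge0// ltW.
    by move=> k; rewrite /w' cabs_real ger0_norm ?expR_ge0// mul0r addr0.
  move=> k; rewrite cabsM cabsN absz_real cabs_real ger0_norm//.
  by rewrite mulr_ge0// ltW.
have e2 : 0 < 2^-1 :> R by rewrite invr_gt0.
have E1 (s : C) (k : int) : w k * cexp (s * (2 * (pi%:C) * 'i * k%:~R) + 0 * s ^+ 2) =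
    cexp (- (pi * A)%:C * k%:~R ^+ 2 + 2 * (pi%:C) * 'i * (s * k%:~R)).
  rewrite /w gauss_cexp -cexpD; congr (cexp (_ + _)); move: (pi%:C : C) => P; ring.
have E2 (s : C) (r : int) : w' r * cexp (s * (- (2 * (pi / A))%:C * r%:~R) + (- (pi / A)%:C) * s ^+ 2) =
    cexp (- (pi / A)%:C * (s + r%:~R) ^+ 2).
  rewrite /w' gauss_cexp -cexpD; congr cexp.
  have -> : (2 * (pi / A))%:C = 2 * (pi / A)%:C :> C by rewrite rcM rcn.
  by move: ((pi / A)%:C : C) => P; ring.
have [|H _] := expfam_unique (expfamZ (Num.sqrt A)%:C f1) f2 (rho := 0) (rho' := - (pi / A)%:C) e2.
  move=> s /andP[s0 s1]; have [|S [h1 h2]] := @poisson_real R A s A0; first by rewrite gtr0_norm.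
  exists S; split.
    have sA : (Num.sqrt A)%:C != 0 :> C by rewrite -cabs_eq0 cabs_real normr_eq0 gt_eqF// sqrtr_gt0.
    have := hsumZ (Num.sqrt A)%:C h2; rewrite mulrA -rmorphM divff ?mul1r; last by rewrite gt_eqF// sqrtr_gt0.
    apply: eq_hsum => k; rewrite -[in RHS]mulrA E1 gauss_cexp -cexpD; congr (_ * cexp (_ + _)).
    have -> : (2 * pi * (s * k%:~R))%:C = 2 * pi%:C * (s%:C * k%:~R) :> C.
      by rewrite 3!rcM rcn rcz.
    move: (pi%:C : C) => P; ring.
  apply: eq_hsum h1 => r; rewrite E2.
  have -> : (s%:C + r%:~R : C) = (s + r%:~R)%:C by rewrite rcD rcz.
  rewrite -cexp_real; congr cexp; rewrite rcN rcM rcX mulNr.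
  by rewrite addrC.
have [F [h1 h2]] := H z.
have sA : (Num.sqrt A)%:C != 0 :> C by rewrite -cabs_eq0 cabs_real normr_eq0 gt_eqF// sqrtr_gt0.
exists ((Num.sqrt A)%:C^-1 * F); split.
  apply: eq_hsum (hsumZ (Num.sqrt A)%:C^-1 h1) => k.
  by rewrite -[_ * w k * _]mulrA mulrA mulVf// mul1r E1.
by rewrite mulrA mulfV// mul1r; apply: eq_hsum h2 => r; rewrite E2.
Qed.

Definition gaussian2 (f : int * int -> C) := exists d c1 c2 c0 : R, 0 < d /\
  forall k, cabs (f k) <= expR (- (d * (k.1%:~R ^+ 2 + k.2%:~R ^+ 2)) + (c1 * k.1%:~R + c2 * k.2%:~R) + c0).

Lemma gaussian2_bsum f : gaussian2 f -> bsum (fun k => cabs (f k)).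
Proof. by move=> [d [c1 [c2 [c0 [d0 h]]]]]; exact: bsum_gauss2 d0 h. Qed.

Lemma gaussian2Z f c : gaussian2 f -> gaussian2 (fun k => c * f k).
Proof.
move=> [d [c1 [c2 [c0 [d0 h]]]]]; exists d, c1, c2, (c0 + cabs c); split=> // k.
rewrite cabsM mulrC addrA expRD; apply: ler_pM; rewrite ?cabs_ge0//.
by apply: le_trans (expR_ge1Dx _); rewrite lerDr.
Qed.

Lemma gaussian2_expfam w l (b0 b1 b2 : R) : gaussian2 w -> 0 <= b1 -> 0 <= b2 ->
  (forall k, cabs (l k) <= b1 * `|k.1%:~R| + b2 * `|k.2%:~R| + b0) -> expfam w l.
Proof.
move=> [d [c1 [c2 [c0 [d0 h]]]]] b1p b2p hl S S0; have d2 : 0 < d / 2 by rewrite divr_gt0.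
apply: (@bsum_gauss2 _ (d / 2) c1 c2 (c0 + S * b0 + (S * b1) ^+ 2 / (2 * d) + (S * b2) ^+ 2 / (2 * d)) d2) => k.
apply: (@le_trans _ _ (expR (- (d * (k.1%:~R ^+ 2 + k.2%:~R ^+ 2)) + (c1 * k.1%:~R + c2 * k.2%:~R) + c0)
    * expR (S * (b1 * `|k.1%:~R| + b2 * `|k.2%:~R| + b0)))).
  by apply: ler_pM; rewrite ?cabs_ge0 ?expR_ge0// ler_expR ler_wpM2l.
rewrite -expRD ler_expR.
have := lin_sqr_le (S * b1) `|k.1%:~R| d0; have := lin_sqr_le (S * b2) `|k.2%:~R| d0.
rewrite -!normrX ![`|_ ^+ 2|]ger0_norm ?sqr_ge0//.
by move: (`|k.1%:~R : R|) (`|k.2%:~R : R|) (k.1%:~R : R) (k.2%:~R : R) => x y x' y'; lra.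
Qed.

Definition qf (T : nzRingType) (p q r x y : T) : T := p * x ^+ 2 + 2 * q * x * y + r * y ^+ 2.

(** Determinant over trace bounds the smaller eigenvalue from below. After multiplication by (p +
    r)(p^2 + q^2) the difference is a sum of two squares. *)
Lemma qf_ge (p q r x y : R) : 0 < p -> 0 < p * r - q ^+ 2 ->
  (p * r - q ^+ 2) / (p + r) * (x ^+ 2 + y ^+ 2) <= qf p q r x y.
Proof.
move=> p0 D0; have r0 : 0 < r by nra.
have s0 : 0 < p + r by exact: addr_gt0.
rewrite mulrAC ler_pdivrMr// -subr_ge0.
have k0 : 0 < p ^+ 2 + q ^+ 2 by rewrite ltr_wpDr ?sqr_ge0// exprn_gt0.
rewrite -(pmulr_rge0 _ k0).
rewrite [leRHS](_ : _ = ((p ^+ 2 + q ^+ 2) * x + q * (p + r) * y) ^+ 2 + ((p * r - q ^+ 2) * y) ^+ 2); last by rewrite /qf; ring.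
by rewrite addr_ge0 ?sqr_ge0.
Qed.

Section Poisson2.
Variables (p q r : R) (z1 z2 : C).
Hypotheses (p0 : 0 < p) (D0 : 0 < p * r - q ^+ 2).
Let D := p * r - q ^+ 2.

(** [G1] is the original summand, [G2] the one after summation in the first variable only, [G3] the
    one after both. *)
Let G1 (e : int * int) := cexp (- pi%:C * qf p%:C q%:C r%:C e.1%:~R e.2%:~R
  + 2 * (pi%:C) * 'i * (z1 * e.1%:~R + z2 * e.2%:~R)).
Let G2 (e : int * int) := cexp (- (pi / p)%:C * (z1 + e.1%:~R + 'i * q%:C * e.2%:~R) ^+ 2
   - (pi * r)%:C * e.2%:~R ^+ 2 + 2 * (pi%:C) * 'i * (z2 * e.2%:~R)).
Let G3 (d : int * int) := cexp (- (pi / D)%:C * qf r%:C (- q%:C) p%:C (z1 + d.1%:~R) (z2 + d.2%:~R)).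

Let p0pi : 0 < (pi : R). Proof. exact: pi_gt0. Qed.
Let r0 : 0 < r. Proof. by move: p0 D0; nra. Qed.

Lemma gaussian2_poisson2_l : gaussian2 G1.
Proof.
have d0 : 0 < pi * (D / (p + r)) by rewrite mulr_gt0// divr_gt0// addr_gt0.
exists (pi * (D / (p + r))), (- (2 * pi * complex.Im z1)), (- (2 * pi * complex.Im z2)), 0; split=> //.
case=> e1 e2; rewrite /G1 cabs_cexp ler_expR /=.
have := qf_ge e1%:~R e2%:~R p0 D0; rewrite -/D -!rcz /qf.
move: (e1%:~R : R) (e2%:~R : R) (pi : R) p0pi => x y P P0 h.
have := ler_wpM2l (ltW P0) h; case: (z1) (z2) => a1 b1 [a2 b2] /=.
rewrite !(mulr0, mul0r, addr0, subr0, oppr0, add0r, mulr1, mul1r); lra.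
Qed.

Lemma bsum_poisson2_m : bsum (fun e => cabs (G2 e)).
Proof.
pose m := Num.min 1 D; have m0 : 0 < m by rewrite lt_min ltr01.
have d0 : 0 < pi / p * m by rewrite mulr_gt0// divr_gt0.
pose a1 := complex.Re z1; pose b1 := complex.Im z1; pose b2 := complex.Im z2.
apply: (bsum_gauss2 (c1 := - (2 * (pi / p) * a1)) (c2 := 2 * (pi / p) * b1 * q - 2 * pi * b2)
  (c0 := pi / p * (b1 ^+ 2 - a1 ^+ 2)) d0).
case=> e1 e2; rewrite /G2 cabs_cexp ler_expR /= -!rcz {}/a1 {}/b1 {}/b2.
have P0 : 0 < pi / p by rewrite divr_gt0.
have piE : pi = pi / p * p by rewrite divfK// gt_eqF.
set Q := pi / p in P0 piE *; move: Q (pi : R) P0 piE => Q P Q0 ->.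
move: (e1%:~R : R) (e2%:~R : R) => x y.
have h : m * (x ^+ 2 + y ^+ 2) <= x ^+ 2 + D * y ^+ 2.
  rewrite mulrDr; apply: lerD; last by rewrite ler_wpM2r ?sqr_ge0// ge_min lexx orbT.
  by rewrite ler_piMl ?sqr_ge0// ge_min lexx.
have := ler_wpM2l (ltW Q0) h; rewrite /D; case: (z1) (z2) => a1 b1 [a2 b2] /=.
rewrite !(mulr0, mul0r, addr0, subr0, oppr0, add0r, mulr1, mul1r) => h2.
lra.
Qed.

Lemma gaussian2_poisson2_r : gaussian2 G3.
Proof.
have D1 : 0 < r * p - (- q) ^+ 2 by rewrite sqrrN mulrC.
have P0 : 0 < pi / D by rewrite divr_gt0.
have d0 : 0 < pi / D * ((r * p - (- q) ^+ 2) / (r + p)) by rewrite mulr_gt0// divr_gt0// addr_gt0.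
pose a1 := complex.Re z1; pose b1 := complex.Im z1; pose a2 := complex.Re z2; pose b2 := complex.Im z2.
exists (pi / D * ((r * p - (- q) ^+ 2) / (r + p))), (- (pi / D * (2 * (r * a1 - q * a2)))),
  (- (pi / D * (2 * (p * a2 - q * a1)))), (- (pi / D * (qf r (- q) p a1 a2 - qf r (- q) p b1 b2))); split=> //.
case=> e1 e2; rewrite /G3 cabs_cexp ler_expR /= -!rcz {}/a1 {}/b1 {}/b2 {}/a2.
have := qf_ge e1%:~R e2%:~R r0 D1; rewrite /qf.
move: (pi / D) P0 (e1%:~R : R) (e2%:~R : R) => Q Q0 x y h.
have := ler_wpM2l (ltW Q0) h; case: (z1) (z2) => a1 b1 [a2 b2] /=.
rewrite !(mulr0, mul0r, addr0, subr0, oppr0, add0r, mulr1, mul1r, mulrDr); lra.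
Qed.

Lemma poisson2 : exists S, hsum G1 S /\ hsum G3 ((Num.sqrt D)%:C * S).
Proof.
have [S hS] := hsum_ex (gaussian2_bsum gaussian2_poisson2_l); exists S; split=> //.
have [T hT] := hsum_ex bsum_poisson2_m.
have [U hU] := hsum_ex (gaussian2_bsum gaussian2_poisson2_r).
have Dp : 0 < D / p by rewrite divr_gt0.
have pn : p != 0 by rewrite gt_eqF.
have pn' : p%:C != 0 :> C by rewrite -cabs_eq0 cabs_real normr_eq0.
have Dn : D != 0 by rewrite gt_eqF.
have Dn' : D%:C != 0 :> C by rewrite -cabs_eq0 cabs_real normr_eq0.
have ii : 'i * 'i = -1 :> C by rewrite -expr2 sqr_i.
(* For fixed e2 the mixed term 2 q e1 e2 acts as an imaginary shift of z1. *)
have /boolp.choice[h1 H1] (e2 : int) := poisson1 (z1 + 'i * q%:C * e2%:~R) p0.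
pose f (e2 : int) := cexp (- (pi * r)%:C * e2%:~R ^+ 2 + 2 * (pi%:C) * 'i * (z2 * e2%:~R)).
have g1 e2 : hsum (fun e1 => G1 (e1, e2)) (f e2 * h1 e2).
  apply: eq_hsum (hsumZ (f e2) (H1 e2).1) => e1.
  rewrite /f /G1 -cexpD; congr cexp; rewrite /= /qf 2!rcM.
  have -> : 2 * pi%:C * 'i * ((z1 + 'i * q%:C * e2%:~R) * e1%:~R) =
    2 * pi%:C * 'i * (z1 * e1%:~R) + ('i * 'i) * (2 * pi%:C * q%:C * e2%:~R * e1%:~R) by move: (pi%:C : C) => P; ring.
  by rewrite ii; move: (pi%:C : C) => P; ring.
have g2 e2 : hsum (fun d1 => G2 (d1, e2)) (f e2 * ((Num.sqrt p)%:C * h1 e2)).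
  apply: eq_hsum (hsumZ (f e2) (H1 e2).2) => d1.
  rewrite /f /G2 -cexpD; congr cexp => /=; move: ((pi / p)%:C) => Q; move: (pi%:C : C) (pi * r)%:C => P P'; ring.
have e1 := hsum_fubini (f := fun a c => G1 (c, a)) (hsum_swap hS) g1.
have e2 := hsum_fubini (f := fun a c => G2 (c, a)) (hsum_swap hT) g2.
have TE : T = (Num.sqrt p)%:C * S.
  apply: hsum_unique e2 _; apply: eq_hsum (hsumZ (Num.sqrt p)%:C e1) => k.
  by rewrite mulrCA.
(* Expanding the square in [G2] leaves the coefficient r - q^2/p = D/p on e2^2, and its mixed term
   shifts z2 by -(q/p)(z1 + d1). *)
have /boolp.choice[h3 H3] (d1 : int) := poisson1 (z2 - (q / p)%:C * (z1 + d1%:~R)) Dp.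
pose f3 (d1 : int) := cexp (- (pi / p)%:C * (z1 + d1%:~R) ^+ 2).
have g3 d1 : hsum (fun e2 => G2 (d1, e2)) (f3 d1 * h3 d1).
  apply: eq_hsum (hsumZ (f3 d1) (H3 d1).1) => k.
  rewrite /f3 /G2 -cexpD; congr cexp => /=.
  rewrite (_ : (pi * (D / p))%:C = pi%:C * (r%:C - q%:C ^+ 2 / p%:C)); last first.
    by rewrite -rcX -rcV -rcM -rcB -rcM; congr (_ * _)%:C; rewrite /D; field.
  rewrite (_ : (pi / p)%:C = pi%:C / p%:C); last by rewrite rcM rcV.
  rewrite (_ : (q / p)%:C = q%:C / p%:C); last by rewrite rcM rcV.
  rewrite (rcM pi r); move: (pi%:C : C) p%:C pn' q%:C r%:C (k%:~R : C) (d1%:~R : C) z1 z2 => P pp pp0 qq rr x y u v.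
  have -> : (u + y + 'i * qq * x) ^+ 2 = (u + y) ^+ 2 + 2 * (u + y) * 'i * qq * x + ('i * 'i) * (qq ^+ 2 * x ^+ 2) by ring.
  by rewrite ii; field.
have g4 d1 : hsum (fun d2 => G3 (d1, d2)) (f3 d1 * ((Num.sqrt (D / p))%:C * h3 d1)).
  apply: eq_hsum (hsumZ (f3 d1) (H3 d1).2) => k.
  rewrite /f3 /G3 -cexpD; congr cexp => /=.
  rewrite (_ : (pi / (D / p))%:C = pi%:C * p%:C / D%:C); last first.
    by rewrite -rcV -!rcM; congr _%:C; move: (pi : R) => P; field; rewrite pn Dn.
  rewrite (_ : (pi / p)%:C = pi%:C / p%:C); last by rewrite rcM rcV.
  rewrite (_ : (pi / D)%:C = pi%:C / D%:C); last by rewrite rcM rcV.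
  rewrite (_ : (q / p)%:C = q%:C / p%:C); last by rewrite rcM rcV.
  have DE : D%:C = p%:C * r%:C - q%:C ^+ 2 by rewrite rcB rcM rcX.
  move: Dn'; rewrite DE /qf.
  move: (pi%:C : C) p%:C pn' q%:C r%:C (k%:~R : C) (d1%:~R : C) z1 z2 => P pp pp0 qq rr x y u v dd0.
  by field; rewrite dd0 pp0.
have eta (F : int * int -> C) V : hsum F V -> hsum (fun p => F (p.1, p.2)) V by apply: eq_hsum; case.
have e3 := hsum_fubini (f := fun a c => G2 (a, c)) (eta _ _ hT) g3.
have e4 := hsum_fubini (f := fun a c => G3 (a, c)) (eta _ _ hU) g4.
suff <- : U = (Num.sqrt D)%:C * S by [].
have -> : (Num.sqrt D)%:C = (Num.sqrt (D / p))%:C * (Num.sqrt p)%:C :> C.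
  by rewrite -rcM -sqrtrM ?divfK// ltW.
rewrite -mulrA -TE; apply: hsum_unique e4 _.
by apply: eq_hsum (hsumZ (Num.sqrt (D / p))%:C e3) => k; rewrite mulrCA.
Qed.

End Poisson2.
End Poisson.

(** The nodes 0, ..., k are distinct in characteristic zero. The coefficients do not depend on [c],
    so they can be taken out of infinite sums. *)
Lemma vandermonde_inv (F : numFieldType) k : exists la : 'I_k.+1 -> 'I_k.+1 -> F,
  forall c h, c h = \sum_x la h x * (\sum_(h' < k.+1) x%:R ^+ h' * c h').
Proof.
pose V : 'M[F]_k.+1 := Vandermonde k.+1 (\row_x x%:R).
have uV : V^T \in unitmx.
  rewrite unitmx_tr unitmxE unitfE det_Vandermonde.
  apply/prodf_neq0 => i _; apply/prodf_neq0 => j ij.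
  by rewrite !mxE subr_eq0 eqr_nat gtn_eqF.
exists (invmx V^T) => c h.
pose v : 'cV[F]_k.+1 := \col_h c h.
have : v h 0 = (invmx V^T *m (V^T *m v)) h 0 by rewrite mulKmx.
rewrite {1}/v !mxE => ->; apply: eq_bigr => x _; congr (_ * _).
by rewrite !mxE; apply: eq_bigr => h' _; rewrite !mxE.
Qed.

(** * Poisson summation with polynomial weights *)

Section Moments.
Variable R : realType.
Local Notation C := R[i].
Variables (p q r a t1 t2 : R) (n1 n2 : C).
Hypotheses (p0 : 0 < p) (D0 : 0 < p * r - q ^+ 2) (a0 : 0 < a).
Let D := p * r - q ^+ 2.

(** In the application these are the pairings of the two columns with u_(z^perp): adding u e_j moves
    the j-th one by a e_j. *)
Definition shift_pt (e : int * int) : C * C :=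
  ((t1 + a * e.1%:~R)%:C, (t2 + a * e.2%:~R)%:C).
Definition wt_e (e : int * int) : C :=
  cexp (- (2 * pi / a)%:C * qf p%:C q%:C r%:C (shift_pt e).1 (shift_pt e).2
        + 2 * pi%:C * 'i / a%:C * (n1 * (shift_pt e).1 + n2 * (shift_pt e).2)).
Definition wt_d (d : int * int) : C :=
  cexp (- (pi / (2 * a * D))%:C * qf r%:C (- q%:C) p%:C (n1 + d.1%:~R) (n2 + d.2%:~R)
        - 2 * pi%:C * 'i / a%:C * (d.1%:~R * t1%:C + d.2%:~R * t2%:C)).
(** The vector (i/2) y^-1 (n + d) for y with entries p, q, r. Since i/2 = 1/(-2i), it becomes the (c
    taubar + d) y^-1 / (-2i) of the theorem. *)
Definition dual_pt (d : int * int) : C * C :=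
  ('i / 2 / D%:C * (r%:C * (n1 + d.1%:~R) - q%:C * (n2 + d.2%:~R)),
   'i / 2 / D%:C * (p%:C * (n2 + d.2%:~R) - q%:C * (n1 + d.1%:~R))).

Let p0pi : 0 < (pi : R). Proof. exact: pi_gt0. Qed.
Let p1 : 0 < 2 * a * p. Proof. by rewrite !mulr_gt0. Qed.
Let DE : 2 * a * p * (2 * a * r) - (2 * a * q) ^+ 2 = (2 * a) ^+ 2 * D.
Proof. by rewrite /D; ring. Qed.
Let D1 : 0 < 2 * a * p * (2 * a * r) - (2 * a * q) ^+ 2.
Proof. by rewrite DE mulr_gt0// exprn_gt0// mulr_gt0. Qed.
Let nz (x : R) : 0 < x -> x%:C != 0 :> C.
Proof. by move=> x0; rewrite -cabs_eq0 cabs_real normr_eq0 gt_eqF. Qed.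
Let ii : 'i * 'i = -1 :> C. Proof. by rewrite -expr2 sqr_i. Qed.

(** After expansion in [e], [K] collects the terms free of [e]; the terms linear in [e] become the
    complex shifts [z1] and [z2] below, affine in [s]. *)
Let K (x1 x2 : R) (s : C) := cexp (- (2 * pi / a)%:C * qf p%:C q%:C r%:C t1%:C t2%:C
  + 2 * pi%:C * 'i / a%:C * (n1 * t1%:C + n2 * t2%:C) + s * (x1%:C * t1%:C + x2%:C * t2%:C)
  - (a / (8 * pi * D))%:C * qf r%:C (- q%:C) p%:C x1%:C x2%:C * s ^+ 2).
Let z1 (x1 : R) (s : C) := n1 + 2 * 'i * (p%:C * t1%:C + q%:C * t2%:C) - 'i * a%:C / (2 * pi%:C) * (s * x1%:C).
Let z2 (x2 : R) (s : C) := n2 + 2 * 'i * (q%:C * t1%:C + r%:C * t2%:C) - 'i * a%:C / (2 * pi%:C) * (s * x2%:C).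

Let KG1 x1 x2 s e :
  K x1 x2 s * cexp (- pi%:C * qf (2 * a * p)%:C (2 * a * q)%:C (2 * a * r)%:C e.1%:~R e.2%:~R
    + 2 * (pi%:C) * 'i * (z1 x1 s * e.1%:~R + z2 x2 s * e.2%:~R)) =
  wt_e e * cexp (s * (x1%:C * (shift_pt e).1 + x2%:C * (shift_pt e).2) +
     - (a / (8 * pi * D))%:C * qf r%:C (- q%:C) p%:C x1%:C x2%:C * s ^+ 2).
Proof.
rewrite /K /wt_e -!cexpD; congr cexp; rewrite /shift_pt /= /z1 /z2.
rewrite !(rcD t1) !(rcD t2) (rcM _ e.1%:~R) (rcM _ e.2%:~R) !rcz.
rewrite [((2 * pi) / a)%:C]rcM (rcV a) (rcM 2 pi) rcn !(rcM (2 * a)) (rcM 2 a) rcn.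
have := nz a0; have := nz p0pi; have := ii.
move: ('i)%R (pi%:C : C) (a%:C : C) ((a / (8 * pi * D))%:C : C) => I P A X iE Pn An.
have -> : (n1 + 2 * I * (p%:C * t1%:C + q%:C * t2%:C) - I * A / (2 * P) * (s * x1%:C)) =
  n1 + I * (2 * (p%:C * t1%:C + q%:C * t2%:C) - A / (2 * P) * (s * x1%:C)) by ring.
have -> : (n2 + 2 * I * (q%:C * t1%:C + r%:C * t2%:C) - I * A / (2 * P) * (s * x2%:C)) =
  n2 + I * (2 * (q%:C * t1%:C + r%:C * t2%:C) - A / (2 * P) * (s * x2%:C)) by ring.
set y1 := (2 * _ - _); set y2 := (2 * _ - _).
have -> : 2 * P * I * ((n1 + I * y1) * e.1%:~R + (n2 + I * y2) * e.2%:~R) =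
   2 * P * I * (n1 * e.1%:~R + n2 * e.2%:~R) + (I * I) * (2 * P * (y1 * e.1%:~R + y2 * e.2%:~R)) by ring.
rewrite iE /y1 /y2 /qf; field.
by rewrite Pn An.
Qed.

(** The s^2 term put into [K] cancels the square of the s-part of the shifts, so the exponent on the
    dual side is linear in [s]. *)
Let KG3 x1 x2 s d :
  K x1 x2 s * cexp (- (pi / (2 * a * p * (2 * a * r) - (2 * a * q) ^+ 2))%:C *
     qf (2 * a * r)%:C (- (2 * a * q)%:C) (2 * a * p)%:C (z1 x1 s + d.1%:~R) (z2 x2 s + d.2%:~R)) =
  wt_d d * cexp (s * (x1%:C * (dual_pt d).1 + x2%:C * (dual_pt d).2) + 0 * s ^+ 2).
Proof.
rewrite DE /K /wt_d -!cexpD; congr cexp; rewrite /dual_pt /= /z1 /z2.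
have := nz a0; have := nz p0pi; have := nz D0; have := ii.
have -> : (pi / ((2 * a) ^+ 2 * D))%:C = pi%:C / ((2 * a%:C) ^+ 2 * D%:C) :> C.
  by rewrite rcM rcV rcM rcX rcM rcn.
have -> : (a / (8 * pi * D))%:C = a%:C / (8 * pi%:C * D%:C) :> C by rewrite rcM rcV 2!rcM rcn.
have -> : (pi / (2 * a * D))%:C = pi%:C / (2 * a%:C * D%:C) :> C by rewrite rcM rcV 2!rcM rcn.
have -> : (2 * pi / a)%:C = 2 * pi%:C / a%:C :> C by rewrite rcM rcV rcM rcn.
rewrite !(rcM (2 * a)) (rcM 2 a) rcn.
have DC : D%:C = p%:C * r%:C - q%:C ^+ 2 :> C by rewrite rcB rcM rcX.
rewrite -/D DC.
move: ('i)%R (pi%:C : C) (a%:C : C) p%:C q%:C r%:C x1%:C x2%:C t1%:C t2%:C (d.1%:~R : C) (d.2%:~R : C).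
move=> I P A pp qq rr y1 y2 u1 u2 v1 v2 iE Dn Pn An.
have split2 (X Y : C) : X + 2 * I * Y = X + I * (2 * Y) by ring.
set m1 := n1 + v1; set m2 := n2 + v2.
have e1 : n1 + 2 * I * (pp * u1 + qq * u2) - I * A / (2 * P) * (s * y1) + v1 =
  m1 + I * (2 * (pp * u1 + qq * u2) - A / (2 * P) * (s * y1)) by rewrite /m1; ring.
have e2 : n2 + 2 * I * (qq * u1 + rr * u2) - I * A / (2 * P) * (s * y2) + v2 =
  m2 + I * (2 * (qq * u1 + rr * u2) - A / (2 * P) * (s * y2)) by rewrite /m2; ring.
rewrite e1 e2.
have qfD (a1 b1 c1 X Y X' Y' : C) : qf a1 b1 c1 (X + I * X') (Y + I * Y') =
   qf a1 b1 c1 X Y + I * (2 * (a1 * X * X' + b1 * (X * Y' + X' * Y) + c1 * Y * Y')) + (I * I) * qf a1 b1 c1 X' Y'.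
  by rewrite /qf; ring.
rewrite qfD iE.
have -> : v1 = m1 - n1 by rewrite /m1; ring.
have -> : v2 = m2 - n2 by rewrite /m2; ring.
rewrite /qf; clear e1 e2; clearbody m1 m2; field.
by rewrite Dn Pn An.
Qed.

(* Apply [poisson2] with its argument shifted by a multiple of [s] and compare coefficients of [s ^+ k]. *)
Lemma moments (x1 x2 : R) k : exists m,
  hsum (fun e => wt_e e * herm k (x1%:C * (shift_pt e).1 + x2%:C * (shift_pt e).2)
         (- (a / (8 * pi * D))%:C * qf r%:C (- q%:C) p%:C x1%:C x2%:C)) m /\
  hsum (fun d => wt_d d * expt (x1%:C * (dual_pt d).1 + x2%:C * (dual_pt d).2) k)
    ((2 * a * Num.sqrt D)%:C * m).
Proof.
have K0 s : K x1 x2 s != 0 by exact: cexp_neq0.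
have G1 := gaussian2Z (K x1 x2 0) (gaussian2_poisson2_l (z1 x1 0) (z2 x2 0) p1 D1).
have G3 := gaussian2Z (K x1 x2 0) (gaussian2_poisson2_r (z1 x1 0) (z2 x2 0) p1 D1).
have ge : gaussian2 (wt_e : int * int -> C).
  case: G1 => [d [c1 [c2 [c0 [d0 h]]]]]; exists d, c1, c2, c0; split=> // j.
  by have := h j; rewrite KG1 mul0r add0r expr0n mulr0 cexp0 mulr1.
have gd : gaussian2 (wt_d : int * int -> C).
  case: G3 => [d [c1 [c2 [c0 [d0 h]]]]]; exists d, c1, c2, c0; split=> // j.
  by have := h j; rewrite KG3 mul0r add0r expr0n mulr0 cexp0 mulr1.
have lin (u v w : C) (x y : int) : cabs (u * x%:~R + v * y%:~R + w) <=
    cabs u * `|x%:~R| + cabs v * `|y%:~R| + cabs w.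
  apply: le_trans (cabsD _ _) _; rewrite lerD2r.
  by apply: le_trans (cabsD _ _) _; rewrite !cabsM !absz_real.
pose le (e : int * int) := x1%:C * (shift_pt e).1 + x2%:C * (shift_pt e).2.
pose ld (d : int * int) := x1%:C * (dual_pt d).1 + x2%:C * (dual_pt d).2.
have Ee : expfam (wt_e : int * int -> C) le.
  apply: (gaussian2_expfam (b0 := cabs (x1%:C * t1%:C + x2%:C * t2%:C))
      (b1 := cabs (x1%:C * a%:C)) (b2 := cabs (x2%:C * a%:C)) ge); rewrite ?cabs_ge0// => j.
  apply: le_trans (lin _ _ _ _ _); rewrite /le /shift_pt /= !(rcD t1) !(rcD t2) !(rcM a) !rcz.
  rewrite le_eqVlt; apply/orP; left; apply/eqP; congr cabs; ring.
have Ed : expfam (wt_d : int * int -> C) ld.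
  pose I2 : C := 'i / 2 / D%:C.
  apply: (gaussian2_expfam (b0 := cabs (I2 * (x1%:C * (r%:C * n1 - q%:C * n2) + x2%:C * (p%:C * n2 - q%:C * n1))))
      (b1 := cabs (I2 * (x1%:C * r%:C - x2%:C * q%:C))) (b2 := cabs (I2 * (x2%:C * p%:C - x1%:C * q%:C))) gd);
    rewrite ?cabs_ge0// => j.
  apply: le_trans (lin _ _ _ _ _); rewrite /ld /dual_pt /= -/I2.
  rewrite le_eqVlt; apply/orP; left; apply/eqP; congr cabs; ring.
have sD : Num.sqrt (2 * a * p * (2 * a * r) - (2 * a * q) ^+ 2) = 2 * a * Num.sqrt D.
  by rewrite DE sqrtrM ?sqr_ge0// sqrtr_sqr ger0_norm// mulr_ge0// ltW.
have c0 : (2 * a * Num.sqrt D)%:C != 0 :> C by apply: nz; rewrite !mulr_gt0// sqrtr_gt0.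
have [|_ H] := expfam_unique (expfamZ (2 * a * Num.sqrt D)%:C Ee) Ed
  (rho := - (a / (8 * pi * D))%:C * qf r%:C (- q%:C) p%:C x1%:C x2%:C) (rho' := 0) (ltr01 : 0 < 1 :> R).
  move=> s _; have [S [h1 h2]] := poisson2 (z1 x1 s%:C) (z2 x2 s%:C) p1 D1.
  exists ((2 * a * Num.sqrt D)%:C * (K x1 x2 s%:C * S)); split.
    apply: eq_hsum (hsumZ (2 * a * Num.sqrt D)%:C (hsumZ (K x1 x2 s%:C) h1)) => e.
    by rewrite KG1 mulrA.
  rewrite sD in h2; have h3 := hsumZ (K x1 x2 s%:C) h2.
  rewrite (mulrCA (K x1 x2 s%:C) (2 * a * Num.sqrt D)%:C S) in h3; apply: eq_hsum h3 => d.
  by rewrite KG3.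
have [m [h1 h2]] := H k.
exists ((2 * a * Num.sqrt D)%:C^-1 * m); split.
  apply: eq_hsum (hsumZ (2 * a * Num.sqrt D)%:C^-1 h1) => e.
  by rewrite -[_ * wt_e e * _]mulrA mulrA mulVf// mul1r.
rewrite mulrA mulfV// mul1r; apply: eq_hsum h2 => d; congr (_ * _).
(* When the quadratic parameter is zero only the index 0 survives in [herm], a plain divided
   power. *)
rewrite /herm (bigD1 ord0) //= [X in _ + X]big1 => [|j /andP[_ j0]].
  by rewrite addr0 subn0 /expt expr0 divr1 mul1r.
by rewrite /expt expr0n -(inj_eq val_inj) /= in j0 *; rewrite (negbTE j0) !mul0r.
Qed.

(* The forms [l1 + x l2], for [k.+1] values of [x], determine the monomials of degree [k] in [l1], [l2]. *)
Lemma moments_mono (E : nat -> nat -> int * int -> C) :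
  (forall k (x : nat) e, \sum_(h < k.+1) x%:R ^+ h * (E (k - h)%N h e / ((k - h)`!%:R * h`!%:R)) =
     herm k ((shift_pt e).1 + x%:R * (shift_pt e).2)
       (- (a / (8 * pi * D))%:C * qf r%:C (- q%:C) p%:C 1 x%:R)) ->
  forall h1 h2, exists m,
    hsum (fun e => wt_e e * E h1 h2 e) m /\
    hsum (fun d => wt_d d * ((dual_pt d).1 ^+ h1 * (dual_pt d).2 ^+ h2)) ((2 * a * Num.sqrt D)%:C * m).
Proof.
move=> HE h1 h2; pose k := (h1 + h2)%N.
have hk : (h2 < k.+1)%N by rewrite ltnS leq_addl.
pose h := Ordinal hk.
have kh : (k - h)%N = h1 by rewrite /k /= addnK.
have [la Hla] := vandermonde_inv C k.
have /boolp.choice[m Hm] (x : 'I_k.+1) := moments 1 x%:R k.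
have f0 : h1`!%:R * h2`!%:R != 0 :> C by rewrite mulf_neq0// pnatr_eq0 -lt0n fact_gt0.
pose M := \sum_x la h x * m x.
have s1 : hsum (fun e => wt_e e * (E h1 h2 e / (h1`!%:R * h2`!%:R))) M.
  have := hsum_sum (index_enum 'I_k.+1) (fun x => hsumZ (la h x) (Hm x).1).
  apply: eq_hsum => e.
  have := Hla (fun h => wt_e e * (E (k - h)%N h e / ((k - h)`!%:R * h`!%:R))) h.
  rewrite kh => ->; apply: eq_bigr => x _; congr (_ * _).
  rewrite rcn mul1r -HE big_distrr /=; apply: eq_bigr => h' _; exact: mulrCA.
have s2 : hsum (fun d => wt_d d * ((dual_pt d).1 ^+ h1 * (dual_pt d).2 ^+ h2 / (h1`!%:R * h2`!%:R)))
    ((2 * a * Num.sqrt D)%:C * M).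
  have := hsum_sum (index_enum 'I_k.+1) (fun x => hsumZ (la h x) (Hm x).2).
  have -> : \sum_x la h x * ((2 * a * Num.sqrt D)%:C * m x) = (2 * a * Num.sqrt D)%:C * M.
    by rewrite /M big_distrr /=; apply: eq_bigr => x _; exact: mulrCA.
  apply: eq_hsum => d.
  have := Hla (fun h => wt_d d * ((dual_pt d).1 ^+ (k - h) * (dual_pt d).2 ^+ h / ((k - h)`!%:R * h`!%:R))) h.
  rewrite kh => ->; apply: eq_bigr => x _; congr (_ * _).
  move: (dual_pt d) => v; rewrite rcn mul1r /expt exprDn big_distrl big_distrr /=; apply: eq_bigr => h' _.
  rewrite [RHS]mulrCA; congr (_ * _).
  have le : (h' <= k)%N by rewrite -ltnS.
  have bf : k`!%:R = 'C(k, h')%:R * (h'`!%:R * (k - h')`!%:R) :> C by rewrite -!natrM bin_fact.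
  have n0 (n : nat) : n`!%:R != 0 :> C by rewrite pnatr_eq0 -lt0n fact_gt0.
  have b0 : 'C(k, h')%:R != 0 :> C by rewrite pnatr_eq0 -lt0n bin_gt0.
  rewrite bf -[_ *+ 'C(k, h')]mulr_natr exprMn.
  move: ('C(k, h')%:R) b0 ((k - h')`!%:R) (n0 (k - h')%N) (h'`!%:R) (n0 h') => b b0 f1 f10 f2 f20.
  by field; rewrite b0 f10 f20.
exists ((h1`!%:R * h2`!%:R) * M); split.
  by apply: eq_hsum (hsumZ (h1`!%:R * h2`!%:R) s1) => e; rewrite mulrCA [_ * (_ / _)]mulrC divfK.
rewrite mulrCA.
by apply: eq_hsum (hsumZ (h1`!%:R * h2`!%:R) s2) => d; rewrite mulrCA [_ * (_ / _)]mulrC divfK.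
Qed.

End Moments.

(** * The operator exp(-tr(Delta y^-1)/8 pi) *)

Section RealPoints.
Variables (R : realType) (N : nat).
Local Notation C := R[i].
Local Notation poly := (mpoly.mpoly N C).
Implicit Types p : poly.

Lemma mderivXU i k : ('X_i : poly)^`M(k) = (i == k)%:R.
Proof.
rewrite mderivX mnm1E; case: eqP => [->|_]; last by rewrite scale0r.
have -> : (U_(k) - U_(k))%MM = 0%MM :> 'X_{1..N} by apply/mnmP => j; rewrite mnmBE mnm0E subnn.
by rewrite mpolyX0 scale1r.
Qed.

Definition line_poly (v w : 'I_N -> C) p : {poly C} := mmap (@polyC C) (fun k => (v k)%:P + w k *: 'X) p.

Lemma line_polyE v w p t : (line_poly v w p).[t] = p.@[fun k => v k + w k * t].
Proof.
rewrite /line_poly /meval /mmap horner_sum; apply: eq_bigr => m _.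
rewrite hornerM hornerC /mmap1 horner_prod; congr (_ * _); apply: eq_bigr => i _.
by rewrite horner_exp !hornerE.
Qed.

Lemma line_polyD v w p q : line_poly v w (p + q) = line_poly v w p + line_poly v w q.
Proof. exact: mmapD. Qed.

Lemma line_polyM v w p q : line_poly v w (p * q) = line_poly v w p * line_poly v w q.
Proof. exact: (mmap_is_multiplicative _ _).1. Qed.

Lemma line_poly0 v w : line_poly v w 0 = 0.
Proof. exact: mmap0. Qed.

(** Chain rule along a line: it holds for constants and variables and is preserved by sums and
    products. *)
Lemma deriv_line_poly v w p : (line_poly v w p)^`() = \sum_k w k *: line_poly v w p^`M(k).
Proof.
pose Q p := (line_poly v w p)^`() = \sum_k w k *: line_poly v w p^`M(k).
have QC c : Q c%:MP.
  rewrite /Q /line_poly mmapC derivC big1// => k _.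
  by rewrite mderivC mmap0 scaler0.
have QM f g : Q f -> Q g -> Q (f * g).
  rewrite /Q => hf hg; rewrite line_polyM derivM hf hg big_distrl big_distrr -big_split /=.
  apply: eq_bigr => k _; rewrite mderivM line_polyD !line_polyM scalerDr.
  by rewrite -scalerAl -scalerAr.
have QX i : Q 'X_i.
  have lX j : line_poly v w 'X_j = (v j)%:P + w j *: 'X.
    by rewrite /line_poly mmapX mmap1U.
  rewrite /Q lX derivD derivC derivZ derivX add0r (bigD1 i) //= big1 => [|k ki].
    by rewrite addr0 mderivXU eqxx /line_poly -mpolyC1 mmapC.
  by rewrite mderivXU eq_sym (negbTE ki) line_poly0 scaler0.
have QD f g : Q f -> Q g -> Q (f + g).
  rewrite /Q => hf hg; rewrite line_polyD derivD hf hg -big_split /=.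
  by apply: eq_bigr => k _; rewrite mderivD line_polyD scalerDr.
rewrite -/(Q p); elim/mpolyind: p => [|c m p _ _ IH].
  by rewrite -mpolyC0; exact: QC.
apply: (QD _ _ _ IH); rewrite -mul_mpolyC; apply: (QM _ _ (QC c)).
rewrite mpolyXE_id; elim/big_ind: _ => [|f g Qf Qg|i _].
- by rewrite -mpolyC1; exact: QC.
- exact: QM.
- elim: (m i) => [|k IHk]; first by rewrite expr0 -mpolyC1; exact: QC.
  by rewrite exprS; exact: (QM _ _ (QX i) IHk).
Qed.

Lemma poly_real0 (f : {poly C}) : (forall t : R, f.[t%:C] = 0) -> f = 0.
Proof.
move=> h; apply/eqP; apply: contraT => f0.
pose rs := [seq (k%:R : C) | k <- iota 0 (size f)].
have : (size rs < size f)%N.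
  apply: max_poly_roots f0 _ _.
    by apply/allP => x /mapP[k _ ->]; rewrite /root -(rcn R k) h.
  by rewrite map_inj_uniq ?iota_uniq// => i j /eqP; rewrite eqr_nat => /eqP.
by rewrite size_map size_iota ltnn.
Qed.

Definition rpt (v : 'I_N -> R) (k : 'I_N) : C := (v k)%:C.

(** The restriction to the line minus its value at [x] vanishes at all real parameters, hence
    identically; its derivative at 0 is the directional derivative. *)
Lemma line_const_deriv (w : 'I_N -> R) p :
  (forall (x : 'I_N -> R) t, p.@[rpt (fun k => x k + t * w k)] = p.@[rpt x]) ->
  forall x, (\sum_k (w k)%:C *: p^`M(k)).@[rpt x] = 0.
Proof.
move=> h x.
have : line_poly (rpt x) (rpt w) p - (p.@[rpt x])%:P = 0.
  apply: poly_real0 => t; rewrite hornerD hornerN hornerC line_polyE -(h x t).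
  apply/eqP; rewrite subr_eq0; apply/eqP; apply: meval_eq => k.
  by rewrite /rpt rcD rcM mulrC.
move/(congr1 (fun f => f^`().[0])); rewrite derivD derivN derivC subr0 deriv_line_poly deriv0 horner0.
rewrite horner_sum => e; rewrite -[RHS]e raddf_sum /=; apply: eq_bigr => k _.
rewrite mevalZ hornerZ line_polyE; congr (_ * _); apply: meval_eq => j.
by rewrite mulr0 addr0.
Qed.

Lemma vanish_deriv p k : (forall v, p.@[rpt v] = 0) -> forall v, (p^`M(k)).@[rpt v] = 0.
Proof.
move=> h v; have := @line_const_deriv (fun j => (j == k)%:R) p; rewrite (bigD1 k) //= eqxx big1.
  by rewrite addr0 scale1r; apply=> *; rewrite !h.
by move=> j /negbTE ->; rewrite scale0r.
Qed.

(** All derivatives vanish at real points too, and the m-th one at the origin is the m-th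
    coefficient times a product of factorials. *)
Lemma vanish_eq0 p : (forall v, p.@[rpt v] = 0) -> p = 0.
Proof.
move=> h; apply/mpolyP => m; rewrite mcoeff0.
have hm : forall v, (p^`M[m]).@[rpt v] = 0.
  rewrite mderivm_foldr; elim: (flatten _) => //= k s IH; by apply: vanish_deriv.
have := hm (fun=> 0).
have -> : (p^`M[m]).@[rpt (fun=> 0)] = (p^`M[m])@_0.
  rewrite {1}(mpolyE p^`M[m]) raddf_sum /= (bigID (pred1 0%MM)) /= [X in _ + X]big1 => [|m' m0].
    rewrite addr0 big_mkcond /=.
    case: (boolP (0%MM \in msupp p^`M[m])) => m0; last first.
      rewrite (memN_msupp_eq0 m0) big_seq big1// => i im; case: eqP => // i0.
      by move: m0; rewrite -i0 im.
    rewrite (bigD1_seq 0%MM) ?msupp_uniq //= eqxx big1 => [|i /negbTE ->//].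
    by rewrite addr0 mevalZ mpolyX0 meval1 mulr1.
  rewrite mevalZ mevalX.
  have [i mi] : exists i, m' i != 0%N.
    apply/existsP; rewrite -negb_forall; apply: contra m0 => /forallP m0.
    by apply/eqP/mnmP => i; rewrite mnm0E; exact/eqP.
  by rewrite (bigD1 i) //= /rpt expr0n (negbTE mi) mul0r mulr0.
rewrite mcoeff_mderivm addm0 => /eqP; rewrite -mulr_natr mulf_eq0 pnatr_eq0.
suff /negbTE -> : (\prod_(i < N) m i ^_ m i)%N != 0%N by rewrite orbF => /eqP.
by rewrite -lt0n prodn_gt0// => i; rewrite ffactnn fact_gt0.
Qed.

Lemma real_eq p q : (forall v, p.@[rpt v] = q.@[rpt v]) -> p = q.
Proof.
by move=> h; apply/eqP; rewrite -subr_eq0; apply/eqP/vanish_eq0 => v; rewrite mevalB h subrr.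
Qed.

End RealPoints.

Lemma second_deriv_expand (F : comNzRingType) (A : comAlgType F) (x y z : F) (d0 d1 d2 q q1 q2 q12 : A) :
  ((y * x) *: ((z * x) *: d2)) * q + ((y * x) *: d1) * q1 + (((z * x) *: d1) * q2 + d0 * q12) =
  (x ^+ 2 * (z * y)) *: (d2 * q) + (y *: d1) * (x *: q1) + (z *: d1) * (x *: q2) + d0 * q12.
Proof.
rewrite -!scalerAl -!scalerAr !scalerA addrA; congr (_ *: _ + _ + _ + _).
by ring.
Qed.

(** Second-order Leibniz rule in an abstract algebra: [d0], [d1], [d2] stand for a function of a
    linear form and its two derivatives, [q1] and [q2] for partial derivatives of the other factor.
    The mixed terms are derivatives of [q] in the direction [x] and cancel. *)
Lemma laplacian_expand (F : comNzRingType) (A : comAlgType F) (I J : finType) (x : I -> F)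
    (w : J -> F) (Y : J -> J -> F) (d0 d1 d2 q : A) (q1 : I -> J -> A) (q2 : I -> J -> J -> A) :
  (forall j, \sum_i x i *: q1 i j = 0) ->
  \sum_i \sum_j \sum_m Y j m *: ((x i ^+ 2 * (w j * w m)) *: (d2 * q) + (w m *: d1) * (x i *: q1 i j)
      + (w j *: d1) * (x i *: q1 i m) + d0 * q2 i j m) =
  ((\sum_i x i ^+ 2) * \sum_j \sum_m Y j m * (w j * w m)) *: (d2 * q)
    + d0 * \sum_i \sum_j \sum_m Y j m *: q2 i j m.
Proof.
move=> h.
have dsum f j : \sum_i f * (x i *: q1 i j) = 0 by rewrite -big_distrr /= h mulr0.
rewrite exchange_big /= [X in d0 * X]exchange_big !big_distrr scaler_suml -big_split; apply: eq_bigr => j _ /=.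
rewrite exchange_big /= [X in d0 * X]exchange_big !big_distrr scaler_suml -big_split; apply: eq_bigr => m _ /=.
under eq_bigr => i _ do rewrite !scalerDr.
rewrite !big_split /= -!scaler_sumr !dsum !scaler0 !addr0; congr (_ + _).
  rewrite -scaler_suml scalerA; congr (_ *: _).
  by rewrite -big_distrl /= mulrCA.
by rewrite -scalerAr -big_distrr.
Qed.

(** If [a] and [b] are divided powers of commuting operators X and Y, this is (X + Y) (X + Y)^m/m! =
    (m + 1) (X + Y)^(m+1)/(m + 1)!. *)
Lemma leibniz_step (F : comNzRingType) (A : comAlgType F) (a b : nat -> A) m :
  \sum_(j < m.+1) (j.+1%:R *: (a j.+1 * b (m - j)%N) + (m - j).+1%:R *: (a j * b (m - j).+1)) =
  m.+1%:R *: \sum_(j < m.+2) a j * b (m.+1 - j)%N.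
Proof.
rewrite big_split /= scaler_sumr.
pose f j := j%:R *: (a j * b (m.+1 - j)%N); pose g j := (m.+1 - j)%:R *: (a j * b (m.+1 - j)%N).
have -> : \sum_(j < m.+1) j.+1%:R *: (a j.+1 * b (m - j)%N) = \sum_(j < m.+2) f j.
  by rewrite [RHS]big_ord_recl {1}/f scale0r add0r; apply: eq_bigr => j _; rewrite /f /= /bump ?add1n ?subSS.
have -> : \sum_(j < m.+1) (m - j).+1%:R *: (a j * b (m - j).+1) = \sum_(j < m.+2) g j.
  rewrite [RHS]big_ord_recr /= {2}/g subnn scale0r addr0; apply: eq_bigr => j _.
  by rewrite /g subSn// -ltnS.
rewrite -big_split; apply: eq_bigr => j _ /=.
by rewrite /f /g -scalerDl -natrD subnKC// -ltnS.
Qed.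

Lemma scale_conv (F : comNzRingType) (A : comAlgType F) (a b : nat -> A) (k : F) m :
  k ^+ m *: (\sum_(j < m.+1) a j * b (m - j)%N) =
  \sum_(j < m.+1) (k ^+ j *: a j) * (k ^+ (m - j) *: b (m - j)%N).
Proof.
rewrite scaler_sumr; apply: eq_bigr => j _.
by rewrite -scalerAl -scalerAr scalerA -exprD subnKC// -ltnS.
Qed.

(** * The heat operator on products with powers of a linear form *)

Section Laplace.
Variables (R : realType) (b : nat).
Local Notation C := R[i].
Local Notation n := b.+2.
Local Notation poly := (mpoly.mpoly (n * 2) C).
Implicit Types p q : poly.

(** A degree bound by coefficients: it passes to sums and derivatives without knowledge of exact
    degrees. *)
Definition degb (k : nat) p := forall m, (k <= mdeg m)%N -> p@_m = 0.

Lemma degb_psize p : degb (psize p) p.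
Proof. by move=> m; rewrite /psize -msizeE => /msize_mdeg_ge /memN_msupp_eq0. Qed.

Lemma degb0 p : degb 0 p -> p = 0.
Proof. by move=> h; apply/mpolyP => m; rewrite mcoeff0 h. Qed.

Lemma degb_leq j k p : (j <= k)%N -> degb j p -> degb k p.
Proof. by move=> jk h m km; apply: h; apply: leq_trans km. Qed.

Lemma degb_sum k (I : Type) (r : seq I) (F : I -> poly) :
  (forall i, degb k (F i)) -> degb k (\sum_(i <- r) F i).
Proof. by move=> h m km; rewrite raddf_sum /= big1// => i _; exact: h. Qed.

Lemma degbZ k c p : degb k p -> degb k (c *: p).
Proof. by move=> h m km; rewrite mcoeffZ h// mulr0. Qed.

Lemma degb_deriv k i p : degb k p -> degb k.-1 (p^`M(i)).
Proof.
by move=> h m km; rewrite mcoeff_mderiv h ?mul0rn// mdegD mdeg1 addn1; case: k km {h}.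
Qed.

Lemma degb_lapl k yi p : degb k p -> degb k.-1 (lapl yi p).
Proof.
move=> h; rewrite /lapl; do 3!(apply: degb_sum => ?); apply: degbZ.
apply: (@degb_leq k.-2); first by case: k {h} => [|[]]//=.
exact/degb_deriv/degb_deriv.
Qed.

Lemma lapl_iterS k yi p : lapl_iter k.+1 yi p = lapl yi (lapl_iter k yi p).
Proof. by []. Qed.

Lemma lapl_iter_eq0 k yi p : degb k p -> lapl_iter k yi p = 0.
Proof.
move=> h; apply: degb0; rewrite -[0%N](subnn k).
elim: {2 3}k => [|j IH]; first by rewrite subn0.
by rewrite lapl_iterS subnS; exact: degb_lapl.
Qed.

Lemma laplD yi p q : lapl yi (p + q) = lapl yi p + lapl yi q.
Proof.
rewrite /lapl -big_split; apply: eq_bigr => i _ /=.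
rewrite -big_split; apply: eq_bigr => j _ /=; rewrite -big_split; apply: eq_bigr => l _ /=.
by rewrite !mderivD scalerDr.
Qed.

Lemma laplZ yi c p : lapl yi (c *: p) = c *: lapl yi p.
Proof.
rewrite /lapl scaler_sumr; apply: eq_bigr => i _ /=.
rewrite scaler_sumr; apply: eq_bigr => j _ /=; rewrite scaler_sumr; apply: eq_bigr => l _ /=.
by rewrite !mderivZ !scalerA mulrC.
Qed.

Lemma lapl0 yi : lapl yi (0 : poly) = 0.
Proof. by rewrite -{1}(scale0r (0 : poly)) laplZ scale0r. Qed.

Lemma lapl_sum yi (I : Type) (r : seq I) (F : I -> poly) :
  lapl yi (\sum_(i <- r) F i) = \sum_(i <- r) lapl yi (F i).
Proof. exact: (big_morph _ (laplD yi) (lapl0 yi)). Qed.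

Lemma lapl_iterD k yi p q : lapl_iter k yi (p + q) = lapl_iter k yi p + lapl_iter k yi q.
Proof. by elim: k => // k IH; rewrite !lapl_iterS IH laplD. Qed.

Lemma lapl_iterZ k yi c p : lapl_iter k yi (c *: p) = c *: lapl_iter k yi p.
Proof. by elim: k => // k IH; rewrite !lapl_iterS IH laplZ. Qed.

(** Terms past the degree vanish, so any larger cut-off is allowed; linearity then compares
    polynomials of different degrees under a common one. *)
Lemma expLapE N yi p : (psize p <= N)%N ->
  expLap yi p = \sum_(k < N) expcoef R k *: lapl_iter k yi p.
Proof.
have stab M M' : (psize p <= M)%N -> (M <= M')%N ->
    \sum_(k < M) expcoef R k *: lapl_iter k yi p = \sum_(k < M') expcoef R k *: lapl_iter k yi p.
  move=> pM MM; rewrite (big_ord_widen M' (fun k => expcoef R k *: lapl_iter k yi p) MM) big_mkcond /=.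
  apply: eq_bigr => k _; case: ltnP => // Mk; rewrite lapl_iter_eq0 ?scaler0//.
  exact: (degb_leq (leq_trans pM Mk) (degb_psize (p := p))).

move=> pN; rewrite /expLap -(stab (psize p) (psize p).+1)//.
exact: stab.
Qed.

Lemma expLapD yi p q : expLap yi (p + q) = expLap yi p + expLap yi q.
Proof.
pose N := maxn (psize (p + q)) (maxn (psize p) (psize q)).
rewrite !(@expLapE N) ?leq_max ?leqnn ?orbT// -big_split; apply: eq_bigr => k _ /=.
by rewrite lapl_iterD scalerDr.
Qed.

Lemma expLapZ yi c p : expLap yi (c *: p) = c *: expLap yi p.
Proof.
pose N := maxn (psize (c *: p)) (psize p).
rewrite !(@expLapE N) ?leq_max ?leqnn ?orbT// scaler_sumr; apply: eq_bigr => k _ /=.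
by rewrite lapl_iterZ !scalerA mulrC.
Qed.

Lemma expLap0 yi : expLap yi (0 : poly) = 0.
Proof. by rewrite -{1}(scale0r (0 : poly)) expLapZ scale0r. Qed.

Lemma expLap_sum yi (I : Type) (r : seq I) (F : I -> poly) :
  expLap yi (\sum_(i <- r) F i) = \sum_(i <- r) expLap yi (F i).
Proof. exact: (big_morph _ (expLapD yi) (expLap0 yi)). Qed.

(** Both sides are values at 1: of the product of two univariate polynomials, and of its factors. *)
Lemma convolution (T : comNzRingType) (A B : nat -> T) a c M :
  (forall j, (a <= j)%N -> A j = 0) -> (forall j, (c <= j)%N -> B j = 0) -> (a + c <= M)%N ->
  \sum_(m < M) \sum_(j < m.+1) A j * B (m - j)%N = (\sum_(j < a) A j) * (\sum_(i < c) B i).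
Proof.
move=> A0 B0 M0.
pose PA := \poly_(j < a) A j; pose PB := \poly_(j < c) B j.
have cA j : PA`_j = A j by rewrite coef_poly; case: ltnP => // /A0 ->.
have cB j : PB`_j = B j by rewrite coef_poly; case: ltnP => // /B0 ->.
have hA : PA.[1] = \sum_(j < a) A j by rewrite horner_poly; apply: eq_bigr => j _; rewrite expr1n mulr1.
have hB : PB.[1] = \sum_(j < c) B j by rewrite horner_poly; apply: eq_bigr => j _; rewrite expr1n mulr1.
rewrite -hA -hB -hornerM (@horner_coef_wide _ M).
  apply: eq_bigr => m _; rewrite expr1n mulr1 coefM; apply: eq_bigr => j _.
  by rewrite cA cB.
apply: leq_trans M0; apply: leq_trans (size_polyMleq _ _) _.
apply: leq_trans (leq_pred _) _.
by apply: leq_add; exact: size_poly.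
Qed.

Variable v : 'I_n -> R.
Variable yi : 'M[R]_2.

Lemma mxvec_index_inj r s (i i' : 'I_r) (j j' : 'I_s) :
  mxvec_index i j = mxvec_index i' j' -> i = i' /\ j = j'.
Proof. by move/cast_ord_inj/enum_rank_inj => []. Qed.

Definition dirD (j : 'I_2) p : poly := \sum_i (v i)%:C *: p^`M(mxvec_index i j).

Lemma dirDD j p q : dirD j (p + q) = dirD j p + dirD j q.
Proof. by rewrite /dirD -big_split; apply: eq_bigr => i _ /=; rewrite mderivD scalerDr. Qed.

Lemma dirDZ j c p : dirD j (c *: p) = c *: dirD j p.
Proof. by rewrite /dirD scaler_sumr; apply: eq_bigr => i _; rewrite mderivZ !scalerA mulrC. Qed.

Lemma dirD0 j : dirD j 0 = 0.
Proof. by rewrite -{1}(scale0r (0 : poly)) dirDZ scale0r. Qed.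

Lemma dirD_lapl j p : dirD j p = 0 -> dirD j (lapl yi p) = 0.
Proof.
move=> h.
have dd k q : dirD j q = 0 -> dirD j q^`M(k) = 0.
  move=> hq; have <- : (dirD j q)^`M(k) = 0 by rewrite hq mderiv0.
  rewrite /dirD raddf_sum; apply: eq_bigr => i _ /=.
  by rewrite mderivZ mderiv_comm.
rewrite /lapl (big_morph _ (dirDD j) (dirD0 j)); apply: big1 => i _.
rewrite (big_morph _ (dirDD j) (dirD0 j)); apply: big1 => k _.
rewrite (big_morph _ (dirDD j) (dirD0 j)); apply: big1 => l _.
by rewrite dirDZ (dd _ _ (dd _ _ h)) scaler0.
Qed.

Definition ell (j : 'I_2) : poly := \sum_i (v i)%:C *: 'X_(mxvec_index i j).

Lemma mderiv_ell i j k : (ell j)^`M(mxvec_index i k) = ((j == k)%:R * (v i)%:C)%:MP.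
Proof.
rewrite /ell raddf_sum (bigD1 i) //= big1 => [|i' i'i]; last first.
  rewrite mderivZ mderivXU; case: eqP => [e|_]; last by rewrite scaler0.
  by move: i'i; have [-> _] := mxvec_index_inj e; rewrite eqxx.
rewrite addr0 mderivZ mderivXU; have [->|jk] := eqVneq j k.
  by rewrite eqxx mul1r -mul_mpolyC mulr1.
case: eqP => [e|_]; last by rewrite mul0r scaler0 mpolyC0.
by move: jk; have [_ ->] := mxvec_index_inj e; rewrite eqxx.
Qed.

Section Ridge.
Variable w : 'I_2 -> C.
Variable k : nat.

Definition ridge : poly := \sum_j w j *: ell j.

Lemma mderiv_ridge i j : ridge^`M(mxvec_index i j) = (w j * (v i)%:C)%:MP.
Proof.
rewrite /ridge raddf_sum (bigD1 j) //= big1 => [|j' /negbTE j'j].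
  by rewrite addr0 mderivZ mderiv_ell eqxx mul1r -mul_mpolyC -mpolyCM.
by rewrite mderivZ mderiv_ell j'j mul0r mpolyC0 scaler0.
Qed.

(* The [i]-th derivative of t^k/k! at [t = ridge]. *)
Definition dpow (i : nat) : poly := if (i <= k)%N then (k - i)`!%:R^-1 *: ridge ^+ (k - i) else 0.

Lemma mderiv_exp (f : poly) x N : (f ^+ N.+1)^`M(x) = N.+1%:R *: (f ^+ N * f^`M(x)).
Proof.
elim: N => [|N IH]; first by rewrite expr1 expr0 mul1r scale1r.
rewrite exprS mderivM IH [N.+2%:R]mulrS scalerDl scale1r; congr (_ + _); first by rewrite mulrC.
by rewrite -scalerAr mulrA -exprS.
Qed.

Lemma mderiv_dpow i j l : (dpow l)^`M(mxvec_index i j) = (w j * (v i)%:C) *: dpow l.+1.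
Proof.
rewrite /dpow; case: (ltngtP l k) => [lk'|lk|->].
- rewrite mderivZ -{2}(subnSK lk') mderiv_exp mderiv_ridge mulrC mul_mpolyC.
  rewrite !scalerA; congr (_ *: _); rewrite -(subnSK lk') factS natrM.
  have f0 : (k - l.+1)`!%:R != 0 :> C by rewrite pnatr_eq0 -lt0n fact_gt0.
  have n0 : (k - l.+1).+1%:R != 0 :> C by rewrite pnatr_eq0.
  move: ((k - l.+1)`!%:R) f0 ((k - l.+1).+1%:R) n0 => f f0 N n0.
  by field; rewrite n0 f0.
- by rewrite mderiv0 scaler0.
- by rewrite subnn expr0 mderivZ -mpolyC1 mderivC !scaler0.
Qed.

(** The operator sends f(ridge) to this scalar times f''(ridge). *)
Definition ridge_norm : C := (\sum_i v i ^+ 2)%:C * \sum_j \sum_l (yi j l)%:C * (w j * w l).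

Lemma lapl_dpowM l q : (forall j, dirD j q = 0) ->
  lapl yi (dpow l * q) = ridge_norm *: (dpow l.+2 * q) + dpow l * lapl yi q.
Proof.
move=> hq.
have E i j m : (dpow l * q)^`M(mxvec_index i m)^`M(mxvec_index i j) =
   ((v i) ^+ 2)%:C * (w j * w m) *: (dpow l.+2 * q) + (w m *: dpow l.+1) * ((v i)%:C *: q^`M(mxvec_index i j))
   + (w j *: dpow l.+1) * ((v i)%:C *: q^`M(mxvec_index i m)) + dpow l * q^`M(mxvec_index i m)^`M(mxvec_index i j).
  rewrite mderivM mderiv_dpow mderivD !mderivM mderivZ !mderiv_dpow rcX.
  exact: second_deriv_expand.
rewrite /ridge_norm rmorph_sum /=; under [in RHS]eq_bigr => i _ do rewrite rcX.
have h j : \sum_i (v i)%:C *: q^`M(mxvec_index i j) = 0 by exact: (hq j).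
rewrite -(laplacian_expand w (fun j m => (yi j m)%:C) (dpow l) (dpow l.+1) (dpow l.+2) q
  (fun i j m => q^`M(mxvec_index i m)^`M(mxvec_index i j)) h).
rewrite /lapl; apply: eq_bigr => i _; apply: eq_bigr => j _; apply: eq_bigr => m _.
by rewrite E rcX.
Qed.

Lemma dirD_lapl_iter m q : (forall j, dirD j q = 0) -> forall j, dirD j (lapl_iter m yi q) = 0.
Proof. by move=> h j; elim: m => [|m IH]; [exact: h | exact: dirD_lapl]. Qed.

Let ca (j : nat) : poly := (ridge_norm ^+ j / j`!%:R) *: dpow j.*2.
Let cb (q : poly) (j : nat) : poly := j`!%:R^-1 *: lapl_iter j yi q.

Let fn0 (j : nat) : j`!%:R != 0 :> C.
Proof. by rewrite pnatr_eq0 -lt0n fact_gt0. Qed.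

Let lapl_cab q i j : (forall j, dirD j q = 0) ->
  lapl yi (ca j * cb q i) = j.+1%:R *: (ca j.+1 * cb q i) + i.+1%:R *: (ca j * cb q i.+1).
Proof.
move=> hq.
have S1 : (ridge_norm ^+ j / j`!%:R / i`!%:R) * ridge_norm = j.+1%:R * (ridge_norm ^+ j.+1 / j.+1`!%:R / i`!%:R).
  have n0 : j.+1%:R != 0 :> C by rewrite pnatr_eq0.
  rewrite exprS factS natrM; move: ridge_norm (j.+1%:R) n0 (j`!%:R) (fn0 j) (i`!%:R) (fn0 i) => c N n0 f f0 f' f0'.
  by field; rewrite n0 f0 f0'.
have S2 : (ridge_norm ^+ j / j`!%:R / i`!%:R) = i.+1%:R * (ridge_norm ^+ j / j`!%:R / i.+1`!%:R).
  have n0 : i.+1%:R != 0 :> C by rewrite pnatr_eq0.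
  rewrite factS natrM; move: ridge_norm (i.+1%:R) n0 (j`!%:R) (fn0 j) (i`!%:R) (fn0 i) => c N n0 f f0 f' f0'.
  by field; rewrite n0 f0 f0'.
have comb (x y : C) (f g : poly) : (x *: f) * (y *: g) = (x * y) *: (f * g).
  by rewrite -scalerAl -scalerAr scalerA.
rewrite /ca /cb !comb laplZ (lapl_dpowM _ (dirD_lapl_iter i hq)) scalerDr.
by rewrite !scalerA S1 -S2.
Qed.

(** As [q] is constant along [v], the operator acts as a sum of two commuting ones, one on each
    factor; [ca] and [cb] are their divided powers applied to [dpow 0] and to [q]. *)
Lemma lapl_iter_dpowM q m : (forall j, dirD j q = 0) ->
  lapl_iter m yi (dpow 0 * q) = m`!%:R *: \sum_(j < m.+1) ca j * cb q (m - j)%N.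
Proof.
move=> hq; elim: m => [|m IH].
  by rewrite big_ord1 /ca /cb /= !expr0 !fact0 !invr1 !mul1r !scale1r.
rewrite lapl_iterS IH laplZ lapl_sum.
have E : \sum_(j < m.+1) lapl yi (ca j * cb q (m - j)%N) = m.+1%:R *: \sum_(j < m.+2) ca j * cb q (m.+1 - j)%N.
  rewrite -leibniz_step; apply: eq_bigr => j _; exact: lapl_cab.
rewrite E scalerA factS natrM; congr (_ *: _); exact: mulrC.
Qed.

(** The image of ridge^k/k!, that is [herm k] at [ridge] with rho = -ridge_norm/(8 pi). *)
Definition herm_poly : poly :=
  \sum_(j < k.+1) ((toC (- (8 * pi)^-1)) ^+ j * (ridge_norm ^+ j / j`!%:R)) *: dpow j.*2.

Lemma expLap_dpowM q : (forall j, dirD j q = 0) ->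
  expLap yi (dpow 0 * q) = herm_poly * expLap yi q.
Proof.
move=> hq; pose M := maxn (psize (dpow 0 * q)) (k.+1 + psize q).
rewrite (@expLapE M) ?leq_maxl//.
have eE m : expcoef R m * m`!%:R = (toC (- (8 * pi)^-1)) ^+ m.
  rewrite /expcoef /toC; move: (- (8 * pi)^-1) => x.
  by rewrite rcM rcX rcV rcn divfK.
under eq_bigr => m _ do rewrite (lapl_iter_dpowM _ hq) scalerA eE scale_conv.
rewrite (@convolution _ (fun j => toC (- (8 * pi)^-1) ^+ j *: ca j)
  (fun j => toC (- (8 * pi)^-1) ^+ j *: cb q j) k.+1 (psize q)).
- congr (_ * _); first by apply: eq_bigr => j _; rewrite /ca scalerA.
  rewrite (@expLapE (psize q))//; apply: eq_bigr => i _; rewrite /cb scalerA -eE.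
  by rewrite mulfK.
- move=> j kj; rewrite /ca /dpow ifN ?scaler0// -ltnNge.
  by apply: leq_trans kj _; rewrite -addnn leq_addr.
- by move=> j qj; rewrite /cb lapl_iter_eq0 ?scaler0//; exact: (degb_leq qj (degb_psize (p := q))).
- exact: leq_maxr.
Qed.

Lemma expLap1 : expLap yi (1 : poly) = 1.
Proof.
have d1 : degb 1 (1 : poly) by move=> m; rewrite mcoeff1; case: eqP => // ->; rewrite mdeg0.
rewrite (@expLapE (psize (1 : poly)).+1)// big_ord_recl big1 => [|i _].
  by rewrite /expcoef /toC expr0 fact0 divr1 scale1r addr0.
by rewrite lapl_iter_eq0 ?scaler0//; exact: degb_leq d1.
Qed.

Lemma expLap_dpow : expLap yi (dpow 0) = herm_poly.
Proof.
rewrite -[dpow 0]mulr1 expLap_dpowM ?expLap1 ?mulr1// => j.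
by rewrite /dirD big1// => i _; rewrite -mpolyC1 mderivC scaler0.
Qed.

Lemma meval_exp (x : 'I_(n * 2) -> C) p j : (p ^+ j).@[x] = p.@[x] ^+ j.
Proof. by elim: j => [|j IH]; rewrite ?expr0 ?meval1// !exprS mevalM IH. Qed.

Lemma meval_herm_poly (x : 'I_(n * 2) -> C) :
  herm_poly.@[x] = herm k ridge.@[x] (toC (- (8 * pi)^-1) * ridge_norm).
Proof.
rewrite /herm_poly raddf_sum /= /herm [RHS]big_mkcond; apply: eq_bigr => j _ /=.
rewrite mevalZ /dpow /expt; case: ifP => _; last by rewrite meval0 mulr0.
rewrite mevalZ meval_exp; move: ridge_norm (toC _) => c u.
by rewrite exprMn [_^-1 * _]mulrC !mulrA.
Qed.

End Ridge.
Definition mono (h1 h2 : nat) : poly := ell 0 ^+ h1 * ell 1 ^+ h2.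

Definition slope (x : nat) (j : 'I_2) : C := if j == 0 then 1 else x%:R.

Lemma ridge_slope x : ridge (slope x) = ell 0 + x%:R *: ell 1.
Proof.
rewrite /ridge big_ord_recl big_ord1.
have -> : lift ord0 ord0 = 1 :> 'I_2 by exact: val_inj.
by rewrite /slope eqxx scale1r.
Qed.

Lemma dpow_mono x k : dpow (slope x) k 0 =
  \sum_(h < k.+1) x%:R ^+ h *: (((k - h)`!%:R * h`!%:R)^-1 *: mono (k - h) h).
Proof.
rewrite /dpow leq0n subn0 ridge_slope exprDn scaler_sumr; apply: eq_bigr => h _.
have le : (h <= k)%N by rewrite -ltnS.
have bf : k`!%:R = 'C(k, h)%:R * (h`!%:R * (k - h)`!%:R) :> C by rewrite -!natrM bin_fact.
have n0 (j : nat) : j`!%:R != 0 :> C by rewrite pnatr_eq0 -lt0n fact_gt0.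
have b0 : 'C(k, h)%:R != 0 :> C by rewrite pnatr_eq0 -lt0n bin_gt0.
rewrite exprZn -scalerAr -[_ *+ 'C(k, h)]scaler_nat -/(mono (k - h) h) !scalerA; congr (_ *: _).
rewrite bf; move: ('C(k, h)%:R) b0 ((k - h)`!%:R) (n0 (k - h)%N) (h`!%:R) (n0 h) => c c0 f1 f10 f2 f20.
by field; rewrite c0 f10 f20.
Qed.

Lemma vandermonde0 k (T : 'I_k.+1 -> poly) :
  (forall x : nat, \sum_(h < k.+1) x%:R ^+ h *: T h = 0) -> forall h, T h = 0.
Proof.
move=> H h; apply/mpolyP => m; rewrite mcoeff0.
have [la Hla] := vandermonde_inv C k.
rewrite (Hla (fun h => (T h)@_m) h) big1// => x _.
have := congr1 (mcoeff m) (H x); rewrite mcoeff0 raddf_sum /=.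
by under eq_bigr do rewrite mcoeffZ; move=> ->; rewrite mulr0.
Qed.

(** Known for powers of ell 0 + x ell 1; both sides are linear in the first factor, and k + 1 values
    of x isolate each monomial. *)
Lemma expLap_monoM h1 h2 q : (forall j, dirD j q = 0) ->
  expLap yi (mono h1 h2 * q) = expLap yi (mono h1 h2) * expLap yi q.
Proof.
move=> hq; pose k := (h1 + h2)%N.
have hk : (h2 < k.+1)%N by rewrite ltnS leq_addl.
have kh : (k - h2)%N = h1 by rewrite addnK.
pose T (h : 'I_k.+1) := ((k - h)`!%:R * h`!%:R)^-1 *:
  (expLap yi (mono (k - h) h * q) - expLap yi (mono (k - h) h) * expLap yi q).
have T0 : T (Ordinal hk) = 0.
  apply: vandermonde0 => x.
  have := expLap_dpowM (slope x) k hq; rewrite -expLap_dpow dpow_mono big_distrl !expLap_sum big_distrl /=.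
  move/eqP; rewrite -subr_eq0 -sumrB => /eqP e; rewrite -[RHS]e; apply: eq_bigr => h _.
  by rewrite /T -!scalerAl !expLapZ -!scalerAl -!scalerBr.
have f0 : (h1`!%:R * h2`!%:R)^-1 != 0 :> C.
  by rewrite invr_eq0 mulf_neq0// pnatr_eq0 -lt0n fact_gt0.
move: T0; rewrite /T /= kh => /eqP.
by rewrite scaler_eq0 (negbTE f0) /= subr_eq0 => /eqP.
Qed.

(** This is the shape of the hypothesis of [moments_mono]: the operator applied to monomials has
    Hermite polynomials as generating sums. *)
Lemma herm_expLap_mono k (x : nat) (y : 'I_(n * 2) -> C) :
  \sum_(h < k.+1) x%:R ^+ h * ((expLap yi (mono (k - h) h)).@[y] / ((k - h)`!%:R * h`!%:R)) =
  herm k ((ell 0).@[y] + x%:R * (ell 1).@[y]) (toC (- (8 * pi)^-1) * ridge_norm (slope x)).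
Proof.
have <- : (ridge (slope x)).@[y] = (ell 0).@[y] + x%:R * (ell 1).@[y].
  by rewrite ridge_slope mevalD mevalZ.
rewrite -meval_herm_poly -expLap_dpow dpow_mono expLap_sum raddf_sum /=; apply: eq_bigr => h _.
by rewrite !expLapZ !mevalZ; congr (_ * _); exact: mulrC.
Qed.

End Laplace.

(** * Square norms and growth *)

Section SquareNorm.
Variable R : realType.
Local Notation C := R[i].

Definition nrm2 p q (X : 'M[R]_(p,q)) : R := \sum_i \sum_j X i j ^+ 2.

Lemma nrm2_ge0 p q (X : 'M[R]_(p,q)) : 0 <= nrm2 X.
Proof. by apply: sumr_ge0 => i _; apply: sumr_ge0 => j _; exact: sqr_ge0. Qed.

Lemma nrm2D p q (X Y : 'M[R]_(p,q)) : nrm2 (X + Y) <= 2 * nrm2 X + 2 * nrm2 Y.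
Proof.
rewrite /nrm2 !big_distrr -big_split; apply: ler_sum => i _ /=.
rewrite !big_distrr -big_split; apply: ler_sum => j _ /=; rewrite mxE.
rewrite -subr_ge0 [leRHS](_ : _ = (X i j - Y i j) ^+ 2); last by ring.
exact: sqr_ge0.
Qed.

Lemma cauchy_schwarz (I : finType) (x z : I -> R) :
  (\sum_i x i * z i) ^+ 2 <= (\sum_i x i ^+ 2) * (\sum_i z i ^+ 2).
Proof.
set S := \sum_i x i * z i; set A := \sum_i x i ^+ 2; set B := \sum_i z i ^+ 2.
have B0 : 0 <= B by apply: sumr_ge0 => i _; exact: sqr_ge0.
have [Bz|Bn] := eqVneq B 0.
  have zz i : z i = 0.
    move/eqP: Bz; rewrite psumr_eq0 => [/allP /(_ i)|j _]; last exact: sqr_ge0.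
    by rewrite mem_index_enum => /(_ isT) /implyP /(_ isT); rewrite sqrf_eq0 => /eqP.
  by rewrite /S big1 => [|i _]; rewrite ?zz ?mulr0// expr0n /= mulr_ge0// sumr_ge0// => i _; exact: sqr_ge0.
have Bp : 0 < B by rewrite lt0r Bn.
have h : 0 <= \sum_i (x i * B - z i * S) ^+ 2 by apply: sumr_ge0 => i _; exact: sqr_ge0.
have e : \sum_i (x i * B - z i * S) ^+ 2 = B * (A * B - S ^+ 2).
  transitivity (\sum_i (x i ^+ 2 * B ^+ 2 + (x i * z i * (- 2 * B * S) + z i ^+ 2 * S ^+ 2))).
    by apply: eq_bigr => i _; ring.
  by rewrite !big_split /= -!big_distrl /= -/A -/B -/S; ring.
by move: h; rewrite e pmulr_rge0// subr_ge0.
Qed.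

Lemma nrm2M p q r (A : 'M[R]_(p,q)) (X : 'M[R]_(q,r)) : nrm2 (A *m X) <= nrm2 A * nrm2 X.
Proof.
rewrite {1 2}/nrm2 big_distrl; apply: ler_sum => i _ /=.
rewrite /nrm2 exchange_big big_distrr /=; apply: ler_sum => j _.
by rewrite mxE; exact: cauchy_schwarz.
Qed.

Lemma entry_le_nrm2 p q (X : 'M[R]_(p,q)) i j : X i j ^+ 2 <= nrm2 X.
Proof.
rewrite /nrm2 (bigD1 i) //= (bigD1 j) //= -addrA lerDl addr_ge0//.
  by apply: sumr_ge0 => *; exact: sqr_ge0.
by apply: sumr_ge0 => *; apply: sumr_ge0 => *; exact: sqr_ge0.
Qed.

Lemma bsum_gaussM p q (d : R) : 0 < d ->
  bsum (fun K : 'M[int]_(p,q) => expR (- (d * nrm2 (intM K)))).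
Proof.
move=> d0.
have c0 : 0 <= \prod_(i < p) \prod_(j < q) (1 + d^-1).
  by do 2!(apply: prodr_ge0 => ? _); rewrite addr_ge0// invr_ge0 ltW.
have := bsumZ c0 (bsum_wtM R p q); apply: le_bsum => K.
rewrite /nrm2 big_distrr /= -sumrN expR_sum -big_split /=; apply: ler_prod => i _.
rewrite expR_ge0 /= big_distrr -sumrN expR_sum -big_split /=; apply: ler_prod => j _.
by rewrite expR_ge0 /= mxE gauss_wt.
Qed.

(* Growth slower than every exponential of [N]: with [N] a squared norm this covers polynomials, and is absorbed by a Gaussian. *)
Definition subexp (T : Type) (N : T -> R) (f : T -> C) :=
  forall e : R, 0 < e -> exists2 M : R, 0 <= M & forall x, cabs (f x) <= M * expR (e * N x).

Section Subexp.
Variables (T : Type) (N : T -> R).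
Hypothesis N0 : forall x, 0 <= N x.

Lemma subexp_cst c : subexp N (fun=> c).
Proof.
move=> e e0; exists (cabs c) => [|x]; first exact: cabs_ge0.
by rewrite ler_peMr ?cabs_ge0// -expR0 ler_expR mulr_ge0// ltW.
Qed.

Lemma subexpM f g : subexp N f -> subexp N g -> subexp N (fun x => f x * g x).
Proof.
move=> hf hg e e0; have e2 : 0 < e / 2 by rewrite divr_gt0.
have [M M0 hM] := hf _ e2; have [M' M0' hM'] := hg _ e2.
exists (M * M') => [|x]; first exact: mulr_ge0.
rewrite cabsM; have -> : e * N x = e / 2 * N x + e / 2 * N x by field.
by rewrite expRD mulrACA ler_pM ?cabs_ge0.
Qed.

Lemma subexpD f g : subexp N f -> subexp N g -> subexp N (fun x => f x + g x).
Proof.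
move=> hf hg e e0; have [M M0 hM] := hf _ e0; have [M' M0' hM'] := hg _ e0.
exists (M + M') => [|x]; first exact: addr_ge0.
by apply: le_trans (cabsD _ _) _; rewrite mulrDl lerD.
Qed.

Lemma subexp_sum (I : Type) (r : seq I) (f : I -> T -> C) :
  (forall i, subexp N (f i)) -> subexp N (fun x => \sum_(i <- r) f i x).
Proof.
move=> h; elim: r => [|i r IH] e e0.
  have [M M0 hM] := subexp_cst 0 e0; exists M => // x; rewrite big_nil; exact: hM.
have [M M0 hM] := subexpD (h i) IH e0; exists M => // x; rewrite big_cons; exact: hM.
Qed.

Lemma subexpX f k : subexp N f -> subexp N (fun x => f x ^+ k).
Proof.
move=> hf; elim: k => [|k IH] e e0.
  have [M M0 hM] := subexp_cst 1 e0; exists M => // x; rewrite expr0; exact: hM.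
have [M M0 hM] := subexpM hf IH e0; exists M => // x; rewrite exprS; exact: hM.
Qed.

Lemma subexp_prod (I : Type) (r : seq I) (f : I -> T -> C) :
  (forall i, subexp N (f i)) -> subexp N (fun x => \prod_(i <- r) f i x).
Proof.
move=> h; elim: r => [|i r IH] e e0.
  have [M M0 hM] := subexp_cst 1 e0; exists M => // x; rewrite big_nil; exact: hM.
have [M M0 hM] := subexpM (h i) IH e0; exists M => // x; rewrite big_cons; exact: hM.
Qed.

Lemma subexp_real (f : T -> R) : (forall x, f x ^+ 2 <= N x) -> subexp N (fun x => (f x)%:C).
Proof.
(* From |f| <= 1 + N and (1 + 1/e)(1 + e N) >= 1 + N. *)
move=> h e e0; exists (1 + e^-1) => [|x]; first by rewrite addr_ge0// invr_ge0 ltW.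
rewrite cabs_real.
have f1 : `|f x| <= 1 + N x.
  have := h x; rewrite -(ger0_norm (sqr_ge0 (f x))) normrX.
  by move: (`|f x|) (normr_ge0 (f x)) => y y0; nra.
apply: le_trans f1 _; apply: (@le_trans _ _ ((1 + e^-1) * (1 + e * N x))); last first.
  by rewrite ler_wpM2l ?expR_ge1Dx// addr_ge0// invr_ge0 ltW.
rewrite -subr_ge0 [leRHS](_ : _ = e^-1 + e * N x); last by field; rewrite gt_eqF.
by rewrite addr_ge0 ?mulr_ge0 ?invr_ge0// ltW.
Qed.

(** Half of the Gaussian pays for the growth, the other half remains as majorant. *)
Lemma subexp_gauss f d : 0 < d -> subexp N f -> exists2 M : R, 0 <= M &
  forall x, cabs (f x) * expR (- (d * N x)) <= M * expR (- (d / 2 * N x)).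
Proof.
move=> d0 hf; have d2 : 0 < d / 2 by rewrite divr_gt0.
have [M M0 hM] := hf _ d2; exists M => // x.
apply: le_trans (ler_wpM2r (expR_ge0 _) (hM x)) _.
by rewrite -(mulrA M) -expRD ler_wpM2l// ler_expR; lra.
Qed.

End Subexp.

Lemma subexp_peval b (p : mpoly.mpoly (b.+2 * 2) C) : subexp (@nrm2 b.+2 2) (fun X => peval p X).
Proof.
rewrite /peval /pevalC => e e0.
have : subexp (@nrm2 b.+2 2) (fun X => \sum_(m <- msupp p) p@_m * \prod_i (mxvec (toCM X)) 0 i ^+ m i).
  apply: (subexp_sum (@nrm2_ge0 _ _)) => m; apply: subexpM; first exact: (subexp_cst (@nrm2_ge0 _ _)).
  apply: (subexp_prod (@nrm2_ge0 _ _)) => i; apply: (subexpX (@nrm2_ge0 _ _)).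
  case/mxvec_indexP: i => i j e' e0'.
  have [M M0 hM] := subexp_real (@nrm2_ge0 _ _) (fun X => entry_le_nrm2 X i j) e0'.
  by exists M => // X; rewrite mxvecE mxE; exact: hM.
by move=> /(_ e e0)[M M0 hM]; exists M => // X; rewrite mevalE; exact: hM.
Qed.

End SquareNorm.

(** * Splitting off the plane spanned by u and u' *)

Section Geometry.
Variables (R : realType) (b : nat).
Local Notation C := R[i].
Local Notation n := b.+2.
Implicit Types (x y : 'cV[R]_n) (X Y : 'M[R]_(n,2)).

Lemma bilE x y : bil x y = \sum_(i < n) (if (i < b)%N then 1 else -1) * (x i 0 * y i 0).
Proof.
rewrite /bil -mulmxA mxE; apply: eq_bigr => i _.
by rewrite mul_diag_mx !mxE mulrCA.
Qed.

Lemma bilC x y : bil x y = bil y x.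
Proof. by rewrite !bilE; apply: eq_bigr => i _; rewrite (mulrC (x i 0)). Qed.

Lemma bilDr x y z : bil x (y + z) = bil x y + bil x z.
Proof. by rewrite /bil mulmxDr mxE. Qed.

Lemma bilZr c x y : bil x (c *: y) = c * bil x y.
Proof. by rewrite /bil -scalemxAr mxE. Qed.

Lemma bilDl x y z : bil (x + y) z = bil x z + bil y z.
Proof. by rewrite bilC bilDr !(bilC z). Qed.

Lemma bilZl c x y : bil (c *: x) y = c * bil x y.
Proof. by rewrite bilC bilZr bilC. Qed.

Lemma bilNr x y : bil x (- y) = - bil x y.
Proof. by rewrite -scaleN1r bilZr mulN1r. Qed.

Lemma bilNl x y : bil (- x) y = - bil x y.
Proof. by rewrite bilC bilNr bilC. Qed.

Lemma bilBr x y z : bil x (y - z) = bil x y - bil x z.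
Proof. by rewrite bilDr bilNr. Qed.

Lemma bilBl x y z : bil (x - y) z = bil x z - bil y z.
Proof. by rewrite bilDl bilNl. Qed.

Variable g : 'M[R]_n.
Hypothesis gSO : isSO g.

Lemma g_unit : g \in unitmx.
Proof. by rewrite unitmxE gSO.2 unitr1. Qed.

Lemma bil_g x y : bil (g *m x) (g *m y) = bil x y.
Proof.
case: gSO => gQ _; rewrite /bil trmx_mul.
by rewrite -[in RHS]gQ !mulmxA.
Qed.

Lemma P0_row x (i : 'I_n) : (P0 R b *m x) i 0 = if (i < b)%N then 0 else x i 0.
Proof. by rewrite /P0 mul_diag_mx !mxE; case: ifP => _; rewrite ?mul0r ?mul1r. Qed.

Lemma bil_P0 x y : bil (P0 R b *m x) y = bil x (P0 R b *m y).
Proof.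
by rewrite !bilE; apply: eq_bigr => i _; rewrite !P0_row; case: ifP => _; rewrite ?mul0r ?mulr0.
Qed.

Lemma P0_idem : P0 R b *m P0 R b = P0 R b.
Proof.
apply/matrixP => i j; rewrite mul_diag_mx !mxE.
by case: ifP => _; rewrite ?mul0r ?mul1r ?mul0rn.
Qed.

Lemma g_Pz x : g *m (Pz g *m x) = P0 R b *m (g *m x).
Proof. by rewrite /Pz !mulmxA mulmxV ?g_unit// mul1mx. Qed.

Lemma bil_Pz x y : bil (Pz g *m x) y = bil x (Pz g *m y).
Proof. by rewrite -bil_g g_Pz bil_P0 -g_Pz bil_g. Qed.

Lemma Pz_idem : Pz g *m Pz g = Pz g.
Proof.
rewrite /Pz !mulmxA -[_ *m g *m _]mulmxA mulmxV ?g_unit// mulmx1.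
by rewrite -[X in X *m g = _]mulmxA P0_idem.
Qed.

Lemma bil_Pzp x y : bil (Pzp g *m x) y = bil x (Pzp g *m y).
Proof. by rewrite /Pzp !mulmxBl !mul1mx bilBl bilBr bil_Pz. Qed.

Lemma Pzp_idem : Pzp g *m Pzp g = Pzp g.
Proof. by rewrite /Pzp mulmxBl mul1mx mulmxBr mulmx1 Pz_idem subrr subr0. Qed.

Lemma Pz_Pzp : Pz g *m Pzp g = 0.
Proof. by rewrite /Pzp mulmxBr mulmx1 Pz_idem subrr. Qed.

Lemma Pzp_Pz : Pzp g *m Pz g = 0.
Proof. by rewrite /Pzp mulmxBl mul1mx Pz_idem subrr. Qed.

Lemma g_Pzp_row x (i : 'I_n) : (g *m (Pzp g *m x)) i 0 = if (i < b)%N then (g *m x) i 0 else 0.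
Proof.
have -> : g *m (Pzp g *m x) = g *m x - P0 R b *m (g *m x) by rewrite /Pzp mulmxBl mul1mx mulmxBr g_Pz.
by rewrite mxE [X in _ + X]mxE P0_row; case: ifP => _; rewrite ?subr0 ?subrr.
Qed.

Variables u u' : 'cV[R]_n.
Hypotheses (uu : bil u u = 0) (uu1 : bil u u' = 1).

Let uz := Pz g *m u.
Let uzp := Pzp g *m u.
Let a := bil uzp uzp.

Lemma u_split : u = uzp + uz.
Proof. by rewrite /uzp /Pzp mulmxBl mul1mx subrK. Qed.

Lemma bil_uzp_uz : bil uzp uz = 0.
Proof. by rewrite /uzp bil_Pzp mulmxA Pzp_Pz mul0mx -(mul0mx _ (0 : 'cV_n)) bilC /bil mul0mx trmx0 !mul0mx mxE. Qed.

Lemma bil_uz_uz : bil uz uz = - a.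
Proof.
have := uu; rewrite u_split bilDl !bilDr (bilC uz uzp) bil_uzp_uz addr0 add0r => /eqP.
by rewrite addrC addr_eq0 => /eqP.
Qed.

(** The direction g u_(z^perp). It lies in the positive coordinates, so Euclidean sums against it
    compute the bilinear form. *)
Definition vplus (i : 'I_n) : R := (g *m uzp) i 0.

Lemma vplus_neg (i : 'I_n) : ~~ (i < b)%N -> vplus i = 0.
Proof. by move=> /negbTE ib; rewrite /vplus /uzp g_Pzp_row ib. Qed.

Lemma sum_vplus2 : \sum_i vplus i ^+ 2 = a.
Proof.
rewrite /a -bil_g bilE; apply: eq_bigr => i _; rewrite -/(vplus i).
by case: ifP => ib; rewrite ?mul1r ?expr2// vplus_neg ?ib// !mulr0.
Qed.

Lemma bil_vplus x : \sum_i vplus i * (g *m x) i 0 = bil x uzp.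
Proof.
rewrite bilC -bil_g bilE; apply: eq_bigr => i _; rewrite -/(vplus i).
by case: ifP => ib; rewrite ?mul1r// vplus_neg ?ib// !mul0r mulr0.
Qed.

(** If a = 0, both components of u have norm zero in definite spaces, so u = 0, against (u, u') =
    1. *)
Lemma a_gt0 : 0 < a.
Proof.
have a0 : 0 <= a by rewrite -sum_vplus2; apply: sumr_ge0 => i _; exact: sqr_ge0.
rewrite lt0r a0 andbT; apply/eqP => az.
have gu i : (g *m u) i 0 = 0.
  case: (boolP (i < b)%N) => ib.
    have : vplus i ^+ 2 = 0.
      apply/eqP; have := sum_vplus2; rewrite az => /eqP; rewrite psumr_eq0 => [/allP /(_ i)|j _]; last exact: sqr_ge0.
      by rewrite mem_index_enum => /(_ isT).
    by move/eqP; rewrite sqrf_eq0 /vplus /uzp g_Pzp_row ib => /eqP.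
  have := bil_uz_uz; rewrite az oppr0 -bil_g g_Pz bilE => /eqP.
  have -> : \sum_(i < n) (if (i < b)%N then 1 else -1) * ((P0 R b *m (g *m u)) i 0 * (P0 R b *m (g *m u)) i 0) =
     - \sum_i ((P0 R b *m (g *m u)) i 0) ^+ 2.
    rewrite -sumrN; apply: eq_bigr => j _; rewrite P0_row.
    by case: ifP => _; rewrite ?mulr0 ?expr0n ?oppr0// mulN1r expr2.
  rewrite oppr_eq0 psumr_eq0 => [/allP /(_ i)|j _]; last exact: sqr_ge0.
  rewrite mem_index_enum P0_row (negbTE ib) => /(_ isT) /=.
  by rewrite sqrf_eq0 => /eqP.
have : g *m u = 0 by apply/matrixP => i j; rewrite ord1 gu mxE.
move/(congr1 (mulmx (invmx g))); rewrite mulmx0 mulKmx ?g_unit// => u0.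
by have := uu1; rewrite u0 /bil trmx0 !mul0mx mxE => /eqP; rewrite eq_sym oner_eq0.
Qed.

Lemma Pline_mul x (A : 'cV[R]_n) : Pline A *m x = (bil A x / bil A A) *: A.
Proof.
rewrite /Pline -scalemxAl -mulmxA.
have -> : A^T *m Qf R b *m x = (bil A x)%:M by rewrite /bil -mx11_scalar.
by rewrite mul_mx_scalar scalerA mulrC.
Qed.

Lemma Pwp_mul x : Pwp g u *m x = Pzp g *m x - (bil x uzp / a) *: uzp.
Proof.
rewrite /Pwp mulmxBl -(mulmxA (Pline _)) Pline_mul -/uzp -/a.
have -> // : bil uzp (Pzp g *m x) = bil x uzp.
by rewrite bilC bil_Pzp /uzp mulmxA Pzp_idem.
Qed.

Lemma Pw_mul x : Pw g u *m x = Pz g *m x + (bil x uz / a) *: uz.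
Proof.
rewrite /Pw mulmxBl -(mulmxA (Pline _)) Pline_mul -/uz bil_uz_uz invrN mulrN scaleNr opprK; congr (_ + (_ / a) *: _).
by rewrite bilC bil_Pz /uz mulmxA Pz_idem.
Qed.

Let an0 : a != 0. Proof. by rewrite gt_eqF// a_gt0. Qed.

Lemma Pwp_uzp : Pwp g u *m uzp = 0.
Proof.
rewrite Pwp_mul -/a divff// scale1r /uzp mulmxA Pzp_idem; exact: subrr.
Qed.

Lemma Pwp_uz : Pwp g u *m uz = 0.
Proof.
rewrite Pwp_mul (bilC uz) bil_uzp_uz mul0r scale0r subr0 /uz mulmxA Pzp_Pz; exact: mul0mx.
Qed.

Lemma Pw_uzp : Pw g u *m uzp = 0.
Proof.
rewrite Pw_mul bil_uzp_uz mul0r scale0r addr0 /uzp mulmxA Pz_Pzp; exact: mul0mx.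
Qed.

Lemma Pw_uz : Pw g u *m uz = 0.
Proof.
by rewrite Pw_mul bil_uz_uz mulNr divff// scaleN1r /uz mulmxA Pz_idem subrr.
Qed.

Lemma Pwp_u : Pwp g u *m u = 0.
Proof. by rewrite [in X in _ *m X]u_split mulmxDr Pwp_uzp Pwp_uz addr0. Qed.

Lemma Pw_u : Pw g u *m u = 0.
Proof. by rewrite [in X in _ *m X]u_split mulmxDr Pw_uzp Pw_uz addr0. Qed.

Lemma eq_mulmx (A A' : 'M[R]_n) : (forall x, A *m x = A' *m x) -> A = A'.
Proof.
move=> h; apply/matrixP => i j.
have := h (delta_mx j 0); move/matrixP/(_ i 0).
by rewrite -!colE !mxE.
Qed.

Lemma Pwp_idem : Pwp g u *m Pwp g u = Pwp g u.
Proof.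
apply: eq_mulmx => x; rewrite -mulmxA [in X in _ *m X]Pwp_mul mulmxBr -scalemxAr Pwp_uzp scaler0 subr0.
rewrite !Pwp_mul mulmxA Pzp_idem.
have -> // : bil (Pzp g *m x) uzp = bil x uzp.
by rewrite bil_Pzp /uzp mulmxA Pzp_idem.
Qed.

Lemma Pwp_Pw : Pwp g u *m Pw g u = 0.
Proof.
apply: eq_mulmx => x; rewrite -mulmxA [in X in _ *m X]Pw_mul mulmxDr -scalemxAr Pwp_uz scaler0 addr0 mul0mx.
rewrite Pwp_mul mulmxA Pzp_Pz mul0mx bil_Pz /uzp mulmxA Pz_Pzp mul0mx.
by rewrite bilC /bil trmx0 !mul0mx mxE mul0r scale0r subr0.
Qed.

Lemma decomp x : x = Pwp g u *m x + Pw g u *m x + (bil x uzp / a) *: uzp - (bil x uz / a) *: uz.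
Proof.
rewrite Pwp_mul Pw_mul -{1}[x]mul1mx -(subrK (Pz g) 1%:M) -/(Pzp g) mulmxDl.
move: (Pzp g *m x) (Pz g *m x) (_ *: uzp) (_ *: uz) => A B D E.
apply/matrixP => i j; rewrite !mxE; ring.
Qed.

Lemma bil_Pwp_uzp x : bil (Pwp g u *m x) uzp = 0.
Proof.
by rewrite Pwp_mul bilBl bilZl -/a divfK// bil_Pzp /uzp mulmxA Pzp_idem subrr.
Qed.

End Geometry.

(** * Polynomials constant along a direction *)

Section SplitExpLap.
Variables (R : realType) (b : nat).
Local Notation C := R[i].
Local Notation n := b.+2.
Local Notation poly := (mpoly.mpoly (n * 2) C).
Implicit Types (p q : poly) (X Y : 'M[R]_(n,2)).

Lemma peval_rpt p Y : peval p Y = p.@[rpt (fun k => mxvec Y 0 k)].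
Proof.
apply: meval_eq => k; case/mxvec_indexP: k => i j.
by rewrite /rpt !mxvecE mxE.
Qed.

Lemma peval_eq p q : (forall Y, peval p Y = peval q Y) -> p = q.
Proof.
move=> h; apply: real_eq => v; have := h (vec_mx (\row_k v k)).
by rewrite !peval_rpt vec_mxK; under meval_eq do rewrite /rpt mxE; under [in RHS]meval_eq do rewrite /rpt mxE.
Qed.

Lemma sum_mxvec (V : nmodType) (F : 'I_(n * 2) -> V) :
  \sum_k F k = \sum_i \sum_j F (mxvec_index i j).
Proof.
rewrite pair_bigA /= (reindex (uncurry (@mxvec_index n 2))) /=; last exact: curry_mxvec_bij.
by apply: eq_bigr => -[i j] _.
Qed.

(* A polynomial factoring through [A] is constant along the kernel of [A]; here [dirD] is the derivative along [N] placed in column [j]. *)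
Lemma dirD_translate (A : 'M[R]_n) (N : 'cV[R]_n) j p :
  (forall X, peval p X = peval p (A *m X)) -> A *m N = 0 ->
  dirD (fun i => N i 0) j p = 0.
Proof.
move=> hA AN; pose w (k : 'I_(n * 2)) : R := mxvec (\matrix_(i, l) (if l == j then N i 0 else 0)) 0 k.
have -> : dirD (fun i => N i 0) j p = \sum_k (w k)%:C *: p^`M(k).
  rewrite sum_mxvec /dirD; apply: eq_bigr => i _.
  rewrite (bigD1 j) //= big1 => [|l lj]; first by rewrite /w mxvecE mxE eqxx addr0.
  by rewrite /w mxvecE mxE (negbTE lj) scale0r.
apply: vanish_eq0; apply: line_const_deriv => x t.
pose X : 'M[R]_(n,2) := vec_mx (\row_k x k).
pose M : 'M[R]_(n,2) := \matrix_(i, l) (if l == j then N i 0 else 0).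
have e1 : p.@[rpt (fun k => x k + t * w k)] = peval p (X + t *: M).
  rewrite peval_rpt; apply: meval_eq => k; rewrite /rpt linearD linearZ /= mxE.
  by rewrite /X vec_mxK !mxE.
have e2 : p.@[rpt x] = peval p X.
  by rewrite peval_rpt /X vec_mxK; apply: meval_eq => k; rewrite /rpt mxE.
rewrite e1 e2 hA mulmxDr -scalemxAr; have -> : A *m M = 0.
  apply/matrixP => i l; rewrite !mxE; have := congr1 (fun Z : 'cV[R]_n => Z i 0) AN; rewrite !mxE => h.
  case: (eqVneq l j) => [->|lj]; first by rewrite -[RHS]h; apply: eq_bigr => k _; rewrite mxE eqxx.
  by rewrite big1// => k _; rewrite mxE (negbTE lj) mulr0.
by rewrite scaler0 addr0 -hA.
Qed.

Lemma dirD_expLap v yi j p : dirD v j p = 0 -> dirD v j (expLap yi p) = 0.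
Proof.
move=> h; have hk k : dirD v j (lapl_iter k yi p) = 0.
  by elim: k => [|k IH]; [exact: h | rewrite lapl_iterS dirD_lapl].
rewrite /expLap (big_morph _ (dirDD v j) (dirD0 v j)); apply: big1 => k _.
by rewrite dirDZ hk scaler0.
Qed.

Lemma deriv0_const (f : {poly C}) x y : f^`() = 0 -> f.[x] = f.[y].
Proof.
move=> h; suff -> : f = (f`_0)%:P by rewrite !hornerC.
apply/polyP => -[|k]; rewrite coefC //=.
have := congr1 (fun q : {poly C} => q`_k) h; rewrite coef_deriv coef0 => /eqP.
by rewrite -mulr_natr mulf_eq0 pnatr_eq0 orbF => /eqP.
Qed.

(** Converse of [dirD_translate], with an independent direction in each column: on the line from Y
    to Y + N the restriction has zero derivative. *)
Lemma peval_translate (N : 'M[R]_(n,2)) p Y :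
  (forall j, dirD (fun i => N i j) j p = 0) -> peval p (Y + N) = peval p Y.
Proof.
move=> h; pose w (k : 'I_(n * 2)) : C := (mxvec N 0 k)%:C.
pose f := line_poly (rpt (fun k => mxvec Y 0 k)) w p.
have f0 : f^`() = 0.
  rewrite /f deriv_line_poly.
  have lZ c q : line_poly (rpt (fun k => mxvec Y 0 k)) w (c *: q) = c *: line_poly (rpt (fun k => mxvec Y 0 k)) w q.
    by rewrite -mul_mpolyC line_polyM /line_poly mmapC mul_polyC.
  under eq_bigr => k _ do rewrite -lZ.
  rewrite -(big_morph _ (line_polyD _ _) (line_poly0 _ _)).
  have -> : \sum_k w k *: p^`M(k) = 0.
    rewrite sum_mxvec exchange_big big1// => j _; rewrite -[RHS](h j) /dirD.
    by apply: eq_bigr => i _; rewrite /w mxvecE.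
  exact: line_poly0.
have := deriv0_const 1 0 f0; rewrite /f !line_polyE => e.
rewrite !peval_rpt; transitivity (p.@[fun k => rpt (fun k => mxvec Y 0 k) k + w k * 1]).
  by apply: meval_eq => k; rewrite /rpt /w mulr1 linearD mxE rcD.
by rewrite e; apply: meval_eq => k; rewrite mulr0 addr0.
Qed.

End SplitExpLap.

(** * The operator on the split polynomial *)

Section SplitTheta.
Variables (R : realType) (b m : nat).
Local Notation C := R[i].
Local Notation n := b.+2.
Local Notation poly := (mpoly.mpoly (n * 2) C).
Variables (g : 'M[R]_n) (u u' : 'cV[R]_n) (P : poly) (Ps : 'I_m.+1 -> 'I_m.+1 -> poly).
Hypotheses (gSO : isSO g) (uu : bil u u = 0) (uu1 : bil u u' = 1).
Hypothesis Psplit : split_polys g u P Ps.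
Let uzp := Pzp g *m u.
Let v := vplus g u.

Lemma col_mulmx (A : 'M[R]_n) (X : 'M[R]_(n,2)) j : col j (A *m X) = A *m col j X.
Proof. by rewrite !colE mulmxA. Qed.

Lemma peval_ell (X : 'M[R]_(n,2)) j : peval (ell v j) (g *m X) = (bil (col j X) uzp)%:C.
Proof.
rewrite peval_rpt /ell raddf_sum /= -(bil_vplus gSO u) rmorph_sum; apply: eq_bigr => i _.
by rewrite mevalZ mevalXU /rpt mxvecE -rcM -col_mulmx [X in _ = _ (_ * X)]mxE.
Qed.

Lemma Pgwp_gw (X : 'M[R]_(n,2)) : Pgwp g u *m gw g u X = Pgwp g u *m (g *m X).
Proof.
have gK (Z : 'M[R]_(n,2)) : invmx g *m (g *m Z) = Z by rewrite mulKmx// (g_unit gSO).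
rewrite /Pgwp /gw -!mulmxA !gK mulmxDr !mulmxA.
by rewrite (Pwp_idem gSO uu uu1) (Pwp_Pw gSO uu) mul0mx addr0 mulmxA.
Qed.

Lemma peval_Ps_gw h1 h2 (X : 'M[R]_(n,2)) : peval (Ps h1 h2) (gw g u X) = peval (Ps h1 h2) (g *m X).
Proof. by case: Psplit => inv _; rewrite inv Pgwp_gw -inv. Qed.

(** The splitting is given only at real arguments g X; these exhaust the real points, which
    determine a polynomial. *)
Lemma split_mono : P = \sum_(h1 < m.+1) \sum_(h2 < m.+1) mono v h1 h2 * Ps h1 h2.
Proof.
apply: peval_eq => Y.
have -> : Y = g *m (invmx g *m Y) by rewrite mulKVmx// (g_unit gSO).
set X := invmx g *m Y; case: Psplit => _ ->.
rewrite [RHS]peval_rpt raddf_sum; apply: eq_bigr => h1 _ /=.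
rewrite raddf_sum; apply: eq_bigr => h2 _ /=.
rewrite !mevalM !meval_exp -!peval_rpt !peval_ell peval_Ps_gw.
by congr (_ * _); rewrite /toC rcM !rcX.
Qed.

Lemma dirD_Ps (N : 'cV[R]_n) j h1 h2 : Pgwp g u *m N = 0 -> dirD (fun i => N i 0) j (Ps h1 h2) = 0.
Proof. by move=> NP; apply: dirD_translate NP => X; case: Psplit => inv _; exact: inv. Qed.

Lemma Pgwp_v : Pgwp g u *m (g *m uzp) = 0.
Proof. by rewrite /Pgwp -mulmxA mulKmx ?(g_unit gSO)// -mulmxA (Pwp_uzp gSO uu uu1) mulmx0. Qed.

Lemma dirD_v_Ps j h1 h2 : dirD v j (Ps h1 h2) = 0.
Proof. exact: (@dirD_Ps (g *m uzp) j h1 h2 Pgwp_v). Qed.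

(** Each split polynomial is constant along v, so the operator is multiplicative on every
    summand. *)
Lemma expLap_split yi (X : 'M[R]_(n,2)) :
  peval (expLap yi P) (g *m X) =
  \sum_(h1 < m.+1) \sum_(h2 < m.+1) peval (expLap yi (mono v h1 h2)) (g *m X) * peval (expLap yi (Ps h1 h2)) (gw g u X).
Proof.
rewrite {1}split_mono expLap_sum peval_rpt raddf_sum; apply: eq_bigr => h1 _ /=.
rewrite expLap_sum raddf_sum; apply: eq_bigr => h2 _ /=.
rewrite (expLap_monoM _ _ _ (fun j => dirD_v_Ps j h1 h2)) mevalM -!peval_rpt; congr (_ * _).
(* The vector g X - gw X is killed by [Pgwp], and the operator preserves constancy along such
   directions. *)
rewrite -(subrKC (gw g u X) (g *m X)) peval_translate// => j.
apply: dirD_expLap.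
have NP : Pgwp g u *m col j (g *m X - gw g u X) = 0.
  by rewrite -col_mulmx mulmxBr Pgwp_gw subrr; apply/matrixP => ? ?; rewrite !mxE.
have := @dirD_Ps _ j h1 h2 NP; rewrite /dirD => e; rewrite -[RHS]e.
by apply: eq_bigr => i _; rewrite !mxE.
Qed.

End SplitTheta.

(** * The theta function *)

Lemma sum2 (V : nmodType) (F : 'I_2 -> V) : \sum_i F i = F 0 + F 1.
Proof. by rewrite big_ord_recl big_ord1; congr (_ + F _); exact: val_inj. Qed.

Lemma ord2P (i : 'I_2) : {i = 0} + {i = 1}.
Proof. by case: (eqVneq i 0) => [|ni]; [left | right; apply/val_inj; case: i ni => -[|[]]]. Qed.

Lemma det2 (T : comNzRingType) (A : 'M[T]_2) : \det A = A 0 0 * A 1 1 - A 0 1 * A 1 0.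
Proof.
rewrite (expand_det_row _ 0) sum2 /cofactor !det_mx11 !mxE /= expr0 expr1 mul1r mulN1r mulrN.
by congr (_ * A _ _ - _ * A _ _); exact: val_inj.
Qed.

Lemma tr_outer (T : comNzRingType) (v w : 'rV[T]_2) (Y : 'M[T]_2) :
  \tr (v^T *m w *m Y) = v 0 0 * (w *m Y) 0 0 + v 0 1 * (w *m Y) 0 1.
Proof. by rewrite /mxtrace sum2 -mulmxA !(mxE, big_ord1). Qed.

Lemma toC_pairing (R : realType) (x a1 a2 : R) (k1 k2 l1 l2 : int) :
  toC (x^-1 * (l1%:~R * (a1 - k1%:~R / 2) + l2%:~R * (a2 - k2%:~R / 2))) =
  (x%:C)^-1 * (l1%:~R * (a1%:C - k1%:~R / 2) + l2%:~R * (a2%:C - k2%:~R / 2)).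
Proof. by rewrite /toC rcM rcV rcD 2!rcM 2!rcB 2!(rcM _ 2^-1) rcV rcn !rcz. Qed.

Lemma qfC (R : realType) (p q r x y : R) : (qf p q r x y)%:C = qf p%:C q%:C r%:C x%:C y%:C.
Proof. by rewrite /qf !expr2 !rcD !rcM rcn. Qed.

Section ThetaSplit.
Variables (R : realType) (b : nat).
Local Notation C := R[i].
Local Notation n := b.+2.
Variables (B : 'M[R]_n) (u u' : 'cV[R]_n) (m : nat) (P : mpoly.mpoly (n * 2) C).
Variables (g : 'M[R]_n) (tau : 'M[C]_2) (Ps : 'I_m.+1 -> 'I_m.+1 -> mpoly.mpoly (n * 2) C).
Variable sigma : 'M[R]_(n, 2).
Hypotheses (LB : even_lattice B) (uL : inLat B u) (u'L : inLat B u').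
Hypotheses (uu : bil u u = 0) (u'u' : bil u' u' = 0) (uu1 : bil u u' = 1).
Hypotheses (gSO : isSO g) (tauS : siegel tau) (Psplit : split_polys g u P Ps).
Hypothesis sigD : cols (inDual B) sigma.

Let uz := Pz g *m u.
Let uzp := Pzp g *m u.
Let a := bil uzp uzp.
Let mu := - u' + (2 * bil uzp uzp)^-1 *: uzp + (2 * bil uz uz)^-1 *: uz.
Let muM := projM u u' mu.
Let y := imM tau.
Let yi := invmx y.
Let p := y 0 0.
Let q := y 0 1.
Let r := y 1 1.
Let D := p * r - q ^+ 2.

Let a0 : 0 < a. Proof. exact: (a_gt0 gSO uu uu1). Qed.
Let an0 : a != 0. Proof. by rewrite gt_eqF. Qed.

Let y10 : y 1 0 = q.
Proof. by case: tauS => sym _; rewrite /q /y !mxE -{1}sym mxE. Qed.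

Let p0 : 0 < p.
Proof.
case: tauS => _ pos; pose v : 'rV[R]_2 := \row_j (if j == 0 then 1 else 0).
have := pos v; have -> : v != 0.
  by apply/eqP => /matrixP /(_ 0 0); rewrite !mxE /= => /eqP; rewrite oner_eq0.
move=> /(_ isT); rewrite mxE sum2 !mxE !sum2 !mxE /=.
by rewrite !mul0r !mulr0 !mul1r !addr0 mulr1 /p /y mxE.
Qed.

Let D0 : 0 < D.
Proof.
(* On (-q, p) the form of y takes the value p D. *)
case: tauS => _ pos; pose v : 'rV[R]_2 := \row_j (if j == 0 then - q else p).
have := pos v; have -> : v != 0.
  by apply/eqP => /matrixP /(_ 0 1); rewrite !mxE /= => /eqP; rewrite gt_eqF.
move=> /(_ isT); rewrite mxE sum2 -!/y !mxE !sum2 ![v _ _]mxE /= -/y -/p -/q -/r y10 => h.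
suff : 0 < p * D by rewrite pmulr_rgt0.
by rewrite /D; move: h; rewrite -/p -/q -/r; nra.
Qed.

Let detY : \det y = D.
Proof.
by rewrite det2 y10 -/p -/q -/r /D; ring.
Qed.

Let yiE : yi = \matrix_(i, j) (D^-1 * (if i == 0 then (if j == 0 then r else - q) else (if j == 0 then - q else p))).
Proof.
have yU : y \in unitmx by rewrite unitmxE detY unitfE gt_eqF.
have Dn : D != 0 by rewrite gt_eqF.
rewrite /yi; set Z := \matrix_(i, j) _.
have yZ : y *m Z = 1%:M.
  apply/matrixP => i j; rewrite mxE sum2 ![Z _ _]mxE [RHS]mxE.
  by case: (ord2P i) => ->; case: (ord2P j) => -> /=; rewrite ?y10 -/p -/q -/r;
    apply: (mulfI Dn); rewrite ?mulr1 ?mulr0 ?[in RHS]/D; field.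
by rewrite -[LHS]mulmx1 -yZ mulKmx.
Qed.

Let toC_nz (x : R) : 0 < x -> x%:C != 0 :> C.
Proof. by move=> x0; rewrite -cabs_eq0 cabs_real normr_eq0 gt_eqF. Qed.

Definition pr (e : int * int) (j : 'I_2) : int := if j == 0 then e.1 else e.2.
Definition rowz (e : int * int) : 'rV[int]_2 := \row_j pr e j.

Lemma qpairE (X : 'M[R]_(n,2)) i j : qpair X i j = 2^-1 * bil (col i X) (col j X).
Proof.
rewrite /qpair mxE /bil; congr (_ * _).
by rewrite !mxE; apply: eq_bigr => k _; rewrite !mxE; congr (_ * _); apply: eq_bigr => l _; rewrite !mxE.
Qed.

Lemma trpairE (X Y : 'M[R]_(n,2)) : trpair X Y = \sum_j bil (col j X) (col j Y).
Proof.
rewrite /trpair /mxtrace; apply: eq_bigr => j _; rewrite /bil.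
by rewrite !mxE; apply: eq_bigr => k _; rewrite !mxE; congr (_ * _); apply: eq_bigr => l _; rewrite !mxE.
Qed.

Lemma col_mulr (x : 'cV[R]_n) (e : int * int) j : col j (x *m intM (rowz e)) = (pr e j)%:~R *: x.
Proof.
apply/matrixP => i k; rewrite !mxE big_ord1 !mxE mulrC; congr (_ * x _ _).
by apply: val_inj; case: k => -[].
Qed.

Lemma colD (X Y : 'M[R]_(n,2)) j : col j (X + Y) = col j X + col j Y.
Proof. by apply/matrixP => i k; rewrite !mxE. Qed.

Lemma toCME k l (A : 'M[R]_(k,l)) i j : toCM A i j = (A i j)%:C.
Proof. by rewrite mxE. Qed.

(* A vector of [sigma + L^2] is written [lamT KM c e], with [c] its pairing with [u] and [e] its pairing with [u']; [guard KM] says that [B *m intM KM] lies in [M^2]. *)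
Let sM := projMpair u u' sigma.
Let guard (KM : 'M[int]_(n,2)) :=
  [forall j : 'I_2, (bil (col j (B *m intM KM)) u == 0) && (bil (col j (B *m intM KM)) u' == 0)].
Let base (KM : 'M[int]_(n,2)) := sM + B *m intM KM.
Let lbf KM (c : int * int) := base KM + - (muM *m intM (rowz c)).
Let lamT KM (c e : int * int) := base KM + u' *m intM (rowz c) + u *m intM (rowz e).
Let t0 KM c j := bil (col j (base KM + u' *m intM (rowz c))) uzp.

Let col_projM X j : col j (projMpair u u' X) = projM u u' (col j X).
Proof. by apply/matrixP => i k; rewrite ord1 !mxE. Qed.

Let projM_perp x : bil (projM u u' x) u = 0 /\ bil (projM u u' x) u' = 0.
Proof.
rewrite /projM !bilBl !bilZl uu u'u' uu1 (bilC u' u) uu1 !mulr0 !mulr1 !subr0.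
by rewrite !subrr.
Qed.

Let base_perp KM j : guard KM -> bil (col j (base KM)) u = 0 /\ bil (col j (base KM)) u' = 0.
Proof.
move=> /forallP /(_ j) /andP[/eqP h1 /eqP h2].
rewrite /base colD !bilDl h1 h2 !addr0 /sM col_projM; exact: projM_perp.
Qed.

Let bil_u_uzp : bil u uzp = a.
Proof. by rewrite {1}(u_split g u) bilDl -/uz -/uzp (bilC uz) (bil_uzp_uz gSO) addr0. Qed.

Let bil_u_uz : bil u uz = - a.
Proof. by rewrite {1}(u_split g u) bilDl -/uz -/uzp (bil_uzp_uz gSO) add0r (bil_uz_uz gSO uu). Qed.

Let muE : mu = - u' + (2 * a)^-1 *: (uzp - uz).
Proof.
by rewrite /mu (bil_uz_uz gSO uu) -/uzp -/a mulrN invrN scaleNr scalerBr addrA.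
Qed.

(** The sum is -1 + (a + a)/(2a). Hence mu and its projection differ by a multiple of u, which the
    projections to w and w^perp kill. *)
Let bil_mu_u : bil mu u = 0.
Proof.
rewrite muE bilDl bilNl bilZl bilBl (bilC u') uu1 !(bilC _ u) bil_u_uzp bil_u_uz.
by field; rewrite an0.
Qed.

Let muME : muM = mu - bil mu u' *: u.
Proof. by rewrite /muM /projM bil_mu_u scale0r subr0. Qed.

Let Pwp_muM : Pwp g u *m muM = - (Pwp g u *m u').
Proof.
rewrite muME muE mulmxBr mulmxDr -!scalemxAr mulmxBr (Pwp_u gSO uu uu1) (Pwp_uzp gSO uu uu1) (Pwp_uz gSO).
by rewrite subrr !scaler0 subr0 addr0 mulmxN.
Qed.

Let Pw_muM : Pw g u *m muM = - (Pw g u *m u').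
Proof.
rewrite muME muE mulmxBr mulmxDr -!scalemxAr mulmxBr (Pw_u gSO uu uu1) (Pw_uzp gSO uu) (Pw_uz gSO uu uu1).
by rewrite subrr !scaler0 subr0 addr0 mulmxN.
Qed.

(* [u] is killed by both projections and [u'] agrees with [- muM] there: this is why [beta = - muM c]. *)
Let Pwp_lam KM c e : Pwp g u *m lamT KM c e = Pwp g u *m lbf KM c.
Proof.
rewrite /lamT /lbf !mulmxDr mulmxN !mulmxA (Pwp_u gSO uu uu1) mul0mx addr0 Pwp_muM.
by rewrite mulNmx opprK.
Qed.

Let Pw_lam KM c e : Pw g u *m lamT KM c e = Pw g u *m lbf KM c.
Proof.
rewrite /lamT /lbf !mulmxDr mulmxN !mulmxA (Pw_u gSO uu uu1) mul0mx addr0 Pw_muM.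
by rewrite mulNmx opprK.
Qed.

Let gw_lam KM c e : gw g u (lamT KM c e) = gw g u (lbf KM c).
Proof. by rewrite /gw Pwp_lam Pw_lam. Qed.

Let t_lam KM c e j : bil (col j (lamT KM c e)) uzp = t0 KM c j + a * (pr e j)%:~R.
Proof. by rewrite /lamT colD bilDl col_mulr bilZl bil_u_uzp mulrC. Qed.

Let c_lam KM c e j : guard KM -> bil (col j (lamT KM c e)) u = (pr c j)%:~R.
Proof.
move=> gK; have [h1 _] := base_perp j gK.
by rewrite /lamT 2!colD !bilDl !col_mulr !bilZl uu (bilC u') uu1 mulr0 mulr1 addr0 h1 add0r.
Qed.

Let e_lam KM c e j : guard KM -> bil (col j (lamT KM c e)) u' = (pr e j)%:~R.
Proof.
move=> gK; have [_ h1] := base_perp j gK.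
by rewrite /lamT 2!colD !bilDl !col_mulr !bilZl u'u' uu1 mulr0 mulr1 addr0 h1 add0r.
Qed.

(** The pairing with u_z is c minus the pairing with u_(z^perp): one variable t describes both
    lines. *)
Let s_lam KM c e j : guard KM ->
  bil (col j (lamT KM c e)) uz = (pr c j)%:~R - (t0 KM c j + a * (pr e j)%:~R).
Proof.
move=> gK; rewrite -(c_lam c e j gK) -t_lam.
move: (col j _) => z; rewrite [X in bil z X - _](u_split g u).
by rewrite bilDr addrAC subrr add0r.
Qed.

Let bil_Pzp2 x x' : bil (Pzp g *m x) (Pzp g *m x') = bil (Pwp g u *m x) (Pwp g u *m x') + bil x uzp * bil x' uzp / a.
Proof.
have E z : Pzp g *m z = Pwp g u *m z + (bil z uzp / a) *: uzp by rewrite (Pwp_mul gSO) subrK.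
rewrite !E bilDl !bilDr !bilZl !bilZr (bil_Pwp_uzp gSO uu uu1) (bilC uzp) (bil_Pwp_uzp gSO uu uu1) -/a.
by field.
Qed.

Let bil_Pz2 x x' : bil (Pz g *m x) (Pz g *m x') = bil (Pw g u *m x) (Pw g u *m x') - bil x uz * bil x' uz / a.
Proof.
have E z : Pz g *m z = Pw g u *m z - (bil z uz / a) *: uz by rewrite (Pw_mul gSO uu) addrK.
have W z : bil (Pw g u *m z) uz = 0.
  rewrite (Pw_mul gSO uu) bilDl bilZl (bil_uz_uz gSO uu) -/uzp -/a (bil_Pz gSO) /uz mulmxA (Pz_idem gSO) -/uz.
  by field.
rewrite !E bilBl !bilBr !bilZl !bilZr W (bilC uz) W (bil_uz_uz gSO uu) -/uzp -/a.
by field.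
Qed.

Let tb := conjM tau.
Let nn (c : int * int) j : C := (pr c 0)%:~R * tb 0 j + (pr c 1)%:~R * tb 1 j.
Let cc (c : int * int) : C := nn c 0 * (pr c 0)%:~R + nn c 1 * (pr c 1)%:~R.
Let expo (X : 'M[R]_(n,2)) : C :=
  \tr (toCM (qpair (Pzp g *m X)) *m tau) + \tr (toCM (qpair (Pz g *m X)) *m conjM tau).
Let expoW (X : 'M[R]_(n,2)) : C :=
  \tr (toCM (qpair (Pwp g u *m X)) *m tau) + \tr (toCM (qpair (Pw g u *m X)) *m conjM tau).

Let tauE i j : tau i j = tb i j + 2 * 'i * (y i j)%:C.
Proof.
rewrite !mxE; case: (tau i j) => x z /=; apply/eqP; rewrite eq_complex /=.
by rewrite !(mulr0, mul0r, addr0, subr0, oppr0, add0r, mulr1, mul1r) /=; apply/andP; split; apply/eqP; ring.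
Qed.

Let tb_sym : tb 1 0 = tb 0 1.
Proof. by case: tauS => sym _; rewrite /tb !mxE -{1}sym mxE. Qed.

Let tr2 (A B' : 'M[C]_2) : \tr (A *m B') = A 0 0 * B' 0 0 + A 0 1 * B' 1 0 + (A 1 0 * B' 0 1 + A 1 1 * B' 1 1).
Proof. by rewrite /mxtrace sum2 !mxE !sum2. Qed.

(** The two lines contribute (t tau t - (c - t) taubar (c - t))/(2a). As tau - taubar = 2 i y, the
    quadratic part in t is i t y t/a; the linear one has coefficient c taubar, written [nn]. *)
Let expo_lam KM c e : guard KM ->
  expo (lamT KM c e) = expoW (lbf KM c) - ((2 * a)%:C)^-1 * cc c
   + (a%:C)^-1 * ('i * qf p%:C q%:C r%:C (shift_pt a (t0 KM c 0) (t0 KM c 1) e).1 (shift_pt a (t0 KM c 0) (t0 KM c 1) e).2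
       + (nn c 0 * (shift_pt a (t0 KM c 0) (t0 KM c 1) e).1 + nn c 1 * (shift_pt a (t0 KM c 0) (t0 KM c 1) e).2)).
Proof.
move=> gK; rewrite /expo /expoW !tr2.
have E1 i j : qpair (Pzp g *m lamT KM c e) i j = qpair (Pwp g u *m lbf KM c) i j
    + (2 * a)^-1 * ((t0 KM c i + a * (pr e i)%:~R) * (t0 KM c j + a * (pr e j)%:~R)).
  by rewrite -(Pwp_lam KM c e) !qpairE !col_mulmx bil_Pzp2 !t_lam; field.
have E2 i j : qpair (Pz g *m lamT KM c e) i j = qpair (Pw g u *m lbf KM c) i j
    - (2 * a)^-1 * (((pr c i)%:~R - (t0 KM c i + a * (pr e i)%:~R)) * ((pr c j)%:~R - (t0 KM c j + a * (pr e j)%:~R))).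
  by rewrite -(Pw_lam KM c e) !qpairE !col_mulmx bil_Pz2 !(s_lam _ _ _ gK); field.
have F1 i j : toCM (qpair (Pzp g *m lamT KM c e)) i j = toCM (qpair (Pwp g u *m lbf KM c)) i j
    + ((2 * a%:C)^-1 * ((t0 KM c i + a * (pr e i)%:~R)%:C * (t0 KM c j + a * (pr e j)%:~R)%:C)).
  by rewrite !toCME E1 (rcD (qpair _ _ _)) rcM (rcM (_ + _)) rcV (rcM 2) rcn.
have F2 i j : toCM (qpair (Pz g *m lamT KM c e)) i j = toCM (qpair (Pw g u *m lbf KM c)) i j
    - ((2 * a%:C)^-1 * (((pr c i)%:~R - (t0 KM c i + a * (pr e i)%:~R)%:C) * ((pr c j)%:~R - (t0 KM c j + a * (pr e j)%:~R)%:C))).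
  by rewrite !toCME E2 (rcB (qpair _ _ _)) rcM (rcM (_ - _)) rcV (rcM 2) rcn !(rcB (pr _ _)%:~R) !rcz.
clear E1 E2; move: F1 F2; rewrite -/tb.
generalize (toCM (qpair (Pzp g *m lamT KM c e))) (toCM (qpair (Pz g *m lamT KM c e))).
generalize (toCM (qpair (Pwp g u *m lbf KM c))) (toCM (qpair (Pw g u *m lbf KM c))).
move=> M1 M2 N1 N2 F1 F2; rewrite !F1 !F2 {F1 F2 N1 N2}.
rewrite /cc /nn /qf /shift_pt (rcM 2) rcn.
have := tauE 0 0; have := tauE 0 1; have := tauE 1 0; have := tauE 1 1; rewrite y10 -/p -/q -/r tb_sym.
move=> -> -> -> ->; rewrite /pr /=.
have an := toC_nz a0.
move: (t0 KM c 0 + a * e.1%:~R)%:C (t0 KM c 1 + a * e.2%:~R)%:C ((c.1)%:~R : C) ((c.2)%:~R : C) => T1 T2 c1 c2.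
move: (M1 0 0) (M1 0 1) (M1 1 0) (M1 1 1) (M2 0 0) (M2 0 1) (M2 1 0) (M2 1 1) (tb 0 0) (tb 0 1) (tb 1 1) => m1 m2 m3 m4 k1 k2 k3 k4 b1 b2 b3.
move: (a%:C) an (p%:C) (q%:C) (r%:C) ('i)%R => A An pp qq rr I.
by field.
Qed.

Let eeD (x z : C) : ee (x + z) = ee x * ee z.
Proof. by rewrite /ee mulrDr cexpD. Qed.

Let eeE (z : C) : ee z = cexp (2 * pi%:C * 'i * z).
Proof. by []. Qed.

Let W KM c := wt_e p q r a (t0 KM c 0) (t0 KM c 1) (nn c 0) (nn c 1).
Let Wd KM c := wt_d p q r a (t0 KM c 0) (t0 KM c 1) (nn c 0) (nn c 1).

Let ii : 'i * 'i = -1 :> C. Proof. by rewrite -expr2 sqr_i. Qed.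

Let ee_lam KM c e : guard KM ->
  ee (expo (lamT KM c e)) = ee (expoW (lbf KM c)) * ee (- ((2 * a)%:C)^-1 * cc c) * W KM c e.
Proof.
move=> gK; rewrite (expo_lam c e gK) 2!eeD mulNr; congr (_ * _).
rewrite eeE /W /wt_e; move: (shift_pt _ _ _ _) => [T1 T2] /=; congr cexp.
have -> : (2 * pi / a)%:C = 2 * pi%:C / a%:C :> C by rewrite rcM rcV rcM rcn.
have := toC_nz a0; have := ii.
move: (qf _ _ _ _ _) (nn c 0) (nn c 1) (a%:C) ('i)%R (pi%:C) => Q n1 n2 A I PI iE An.
rewrite [LHS](_ : _ = 2 * PI / A * ((I * I) * Q + I * (n1 * T1 + n2 * T2))); last by field.
by rewrite iE; field.
Qed.

Let avec (c d : int * int) j : C := nn c j + (pr d j)%:~R.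

Let Amx c d := toCM (intM (rowz c)) *m tau + toCM (intM (rowz d)).
Let Abmx c d := toCM (intM (rowz c)) *m conjM tau + toCM (intM (rowz d)).

Let toC_int k l (K : 'M[int]_(k,l)) i j : toCM (intM K) i j = (K i j)%:~R :> C.
Proof. by rewrite toCME mxE rcz. Qed.

Let rowzE c j : rowz c 0 j = pr c j. Proof. by rewrite mxE. Qed.

Let AbmxE c d j : Abmx c d 0 j = avec c d j.
Proof. by rewrite /Abmx mxE toC_int mxE sum2 !toC_int !rowzE. Qed.

Let AmxE c d j : Amx c d 0 j = avec c d j + 2 * 'i * ((pr c 0)%:~R * (y 0 j)%:C + (pr c 1)%:~R * (y 1 j)%:C).
Proof.
rewrite /Amx mxE toC_int mxE sum2 !toC_int !rowzE !tauE /avec /nn.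
by move: (tb 0 j) (tb 1 j) (y 0 j)%:C (y 1 j)%:C ('i)%R => *; ring.
Qed.

Let yiC0 i j : (yi i j)%:C = (D%:C)^-1 * (if i == 0 then (if j == 0 then r%:C else - q%:C) else (if j == 0 then - q%:C else p%:C)).
Proof. by rewrite yiE mxE rcM rcV; do 2!case: ifP => _; rewrite ?rcN. Qed.

Let yiC i j : toCM yi i j = (D%:C)^-1 * (if i == 0 then (if j == 0 then r%:C else - q%:C) else (if j == 0 then - q%:C else p%:C)).
Proof. by rewrite toCME yiC0. Qed.

Let vE c d : (Abmx c d *m toCM yi) 0 0 = (D%:C)^-1 * (r%:C * avec c d 0 - q%:C * avec c d 1) /\
  (Abmx c d *m toCM yi) 0 1 = (D%:C)^-1 * (p%:C * avec c d 1 - q%:C * avec c d 0).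
Proof.
split; rewrite mxE sum2 !AbmxE !yiC /=; move: (avec c d 0) (avec c d 1) => u1 u2; ring.
Qed.

Let dual_ptE c d j : (if j == 0 :> 'I_2 then (dual_pt p q r (nn c 0) (nn c 1) d).1 else (dual_pt p q r (nn c 0) (nn c 1) d).2)
  = (Abmx c d *m toCM yi) 0 j / (- (2%:R * 'i)).
Proof.
have [v0 v1] := vE c d.
have i0 : ('i)%R != 0 :> C by apply/eqP => i0; have := ii; rewrite i0 mul0r => /eqP; rewrite eq_sym oppr_eq0 oner_eq0.
have key x : 'i / 2 / D%:C * x = (D%:C)^-1 * x / (- (2%:R * 'i)).
  have := toC_nz D0; have := ii; move: i0; move: (D%:C) ('i)%R => DD I i0 iE Dn.
  have I2 : - (2 * I) != 0 by rewrite oppr_eq0 mulf_neq0 ?pnatr_eq0.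
  apply: (mulIf I2); rewrite divfK//.
  by rewrite [LHS](_ : _ = - (I * I) * (DD^-1 * x)); [rewrite iE opprK mul1r | field].
by case: (ord2P j) => -> /=; rewrite ?v0 ?v1 /dual_pt /avec -/D /pr /= key.
Qed.

(** For x orthogonal to u its pairings with u_z and u_(z^perp) are opposite, so the two halves of mu
    add up. *)
Let bil_muM_l x : bil x u = 0 -> bil x u' = 0 -> bil x muM = bil x uzp / a.
Proof.
move=> xu xu'; rewrite muME muE bilBr bilZr xu mulr0 subr0 bilDr bilNr xu' oppr0 add0r bilZr bilBr.
have : bil x uzp + bil x uz = 0 by rewrite -bilDr -[uzp + uz](u_split g u).
by move=> /eqP; rewrite addrC addr_eq0 => /eqP ->; field.
Qed.

Let bil_muM2 : bil muM muM = (1 - 2 * bil u' uzp) / a.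
Proof.
have [h1 h2] := projM_perp mu; rewrite bil_muM_l//; congr (_ / _).
rewrite muME muE bilBl bilZl bilDl bilNl bilZl bilBl bil_u_uzp -/a (bilC uz) (bil_uzp_uz gSO).
rewrite bilDl bilNl u'u' bilZl bilBl.
have h : bil u' uzp + bil u' uz = 1 by rewrite -bilDr -[uzp + uz](u_split g u) bilC.
have h2' : bil u' uz = 1 - bil u' uzp by rewrite -h addrAC subrr add0r.
by rewrite ?bilBr !(bilC _ u') h2'; field.
Qed.

Let t0E KM c j : t0 KM c j = bil (col j (base KM)) uzp + (pr c j)%:~R * bil u' uzp.
Proof. by rewrite /t0 colD bilDl col_mulr bilZl. Qed.

Let trpair_mu KM c d : guard KM ->
  trpair (base KM + 2^-1 *: - (muM *m intM (rowz c))) (muM *m intM (rowz d)) =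
  a^-1 * ((pr d 0)%:~R * (t0 KM c 0 - (pr c 0)%:~R / 2) + (pr d 1)%:~R * (t0 KM c 1 - (pr c 1)%:~R / 2)).
Proof.
move=> gK.
have E j : bil (col j (base KM + 2^-1 *: - (muM *m intM (rowz c)))) (col j (muM *m intM (rowz d))) =
    a^-1 * ((pr d j)%:~R * (t0 KM c j - (pr c j)%:~R / 2)).
  have [h1 h2] := base_perp j gK.
  have cZ (X : 'M[R]_(n,2)) : col j (2^-1 *: - X) = - (2^-1 *: col j X) by apply/matrixP => i k; rewrite !mxE mulrN.
  rewrite colD cZ !col_mulr bilZr bilBl !bilZl bil_muM2 (bil_muM_l h1 h2) t0E.
  by field.
by rewrite trpairE sum2 !E -mulrDr.
Qed.

(** Since c tau + d = (c taubar + d) + 2 i c y, the trace is the dual Gaussian form plus 2 i c (c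
    taubar + d)^t. This accounts for [cc]; the remaining c d^t cancels against the beta/2 in the
    phase of Theta_M. *)
Let Wd_E KM c d : guard KM ->
  ee (- ((2 * a)%:C)^-1 * cc c) * Wd KM c d =
  cexp (- toC (pi / (2 * a)) * \tr ((Amx c d)^T *m Abmx c d *m toCM yi)) *
  ee (- toC (trpair (base KM + 2^-1 *: - (muM *m intM (rowz c))) (muM *m intM (rowz d)))).
Proof.
move=> gK; rewrite trpair_mu// !eeE /Wd /wt_d -!cexpD; congr cexp.
have trE : \tr ((Amx c d)^T *m Abmx c d *m toCM yi) =
    Amx c d 0 0 * ((D%:C)^-1 * (r%:C * avec c d 0 - q%:C * avec c d 1)) +
    Amx c d 0 1 * ((D%:C)^-1 * (p%:C * avec c d 1 - q%:C * avec c d 0)).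
  have [v0 v1] := vE c d.
  by rewrite tr_outer v0 v1.
rewrite trE (AmxE c d 0) (AmxE c d 1) y10 -/p -/q -/r -/D {trE}; rewrite /qf; rewrite /avec /cc; rewrite /pr /=.
have DC : D%:C = p%:C * r%:C - q%:C ^+ 2 :> C by rewrite rcB rcM rcX.
have -> : (pi / (2 * a * D))%:C = pi%:C / (2 * a%:C * D%:C) :> C by rewrite rcM rcV 2!rcM rcn.
have -> : toC (pi / (2 * a)) = pi%:C / (2 * a%:C) :> C by rewrite /toC rcM rcV rcM rcn.
rewrite (rcM 2) rcn toC_pairing.
have := toC_nz a0; have := toC_nz D0; rewrite DC; have := ii.
move: (nn c 0) (nn c 1) (t0 KM c 0)%:C (t0 KM c 1)%:C (c.1%:~R : C) (c.2%:~R : C) (d.1%:~R : C) (d.2%:~R : C) => n1 n2 t1 t2 c1 c2 d1 d2.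
move: (p%:C) (q%:C) (r%:C) (a%:C) (pi%:C) ('i)%R => pp qq rr A PI I iE Dn An.
by field; rewrite An Dn.
Qed.

Let vp := vplus g u.

Let F KM c e : C := peval (expLap yi P) (g *m lamT KM c e) * ee (expo (lamT KM c e)).

Let thetaM_term KM c d h1 h2 : C :=
  peval (expLap yi (Ps h1 h2)) (gw g u (lbf KM c)) *
  ee (expoW (lbf KM c) - toC (trpair (base KM + 2^-1 *: - (muM *m intM (rowz c))) (muM *m intM (rowz d)))).

Let coef c d (h1 h2 : nat) : C :=
  cexp (- toC (pi / (2 * a)) * \tr ((Amx c d)^T *m Abmx c d *m toCM yi)) *
  ((Abmx c d *m toCM yi) 0 0 ^+ h1 * (Abmx c d *m toCM yi) 0 1 ^+ h2) / (- (2%:R * 'i)) ^+ (h1 + h2).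

(** The quadratic parameter coming from the operator equals the one for which the Poisson dual is
    linear in s. *)
Let ridge_normE (x : nat) : toC (- (8 * pi)^-1) * ridge_norm vp yi (slope R x) =
  - (a / (8 * pi * D))%:C * qf r%:C (- q%:C) p%:C 1 x%:R.
Proof.
rewrite /ridge_norm (sum_vplus2 gSO) -/uzp -/a !sum2 !yiC0 /slope /= /qf /toC.
rewrite rcN (rcV (8 * pi)) (rcM a) rcV !(rcM _ D) (rcM 8) rcn.
have := toC_nz (pi_gt0 R); have := toC_nz D0.
by move: (p%:C) (q%:C) (r%:C) (a%:C) (pi%:C) (D%:C) => pp qq rr A PI DD Dn Pn; field; rewrite Dn Pn.
Qed.

Let moment_E KM c k (x : nat) e :
  \sum_(h < k.+1) x%:R ^+ h * (peval (expLap yi (mono vp (k - h) h)) (g *m lamT KM c e) / ((k - h)`!%:R * h`!%:R)) =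
  herm k ((shift_pt a (t0 KM c 0) (t0 KM c 1) e).1 + x%:R * (shift_pt a (t0 KM c 0) (t0 KM c 1) e).2)
    (- (a / (8 * pi * D))%:C * qf r%:C (- q%:C) p%:C 1 x%:R).
Proof.
rewrite -ridge_normE.
have e0 := peval_ell u gSO (lamT KM c e) 0; have e1 := peval_ell u gSO (lamT KM c e) 1.
rewrite -/uzp t_lam in e0; rewrite -/uzp t_lam in e1.
rewrite /shift_pt /=; rewrite -[e.1]/(pr e 0) -[e.2]/(pr e 1) -e0 -e1.
exact: herm_expLap_mono.
Qed.

(** For fixed lam_M and c the weight is a combination of monomial moments whose coefficients [cst]
    are free of [e], so each (h1, h2) is dualised separately. *)
Let inner_sum KM c : guard KM -> exists V,
  hsum (F KM c) V /\
  hsum (fun d => \sum_(h1 < m.+1) \sum_(h2 < m.+1) coef c d h1 h2 * thetaM_term KM c d h1 h2)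
    ((2 * a * Num.sqrt D)%:C * V).
Proof.
move=> gK.
have /boolp.choice[M HM] (h : 'I_m.+1 * 'I_m.+1) :=
  @moments_mono _ _ _ _ _ _ _ (nn c 0) (nn c 1) p0 D0 a0
    (fun h1 h2 e => peval (expLap yi (mono vp h1 h2)) (g *m lamT KM c e)) (moment_E KM c) h.1 h.2.
pose cst h1 h2 := peval (expLap yi (Ps h1 h2)) (gw g u (lbf KM c)) * (ee (expoW (lbf KM c)) * ee (- ((2 * a)%:C)^-1 * cc c)).
exists (\sum_(h1 < m.+1) \sum_(h2 < m.+1) cst h1 h2 * M (h1, h2)); split.
  have := hsum_sum (index_enum 'I_m.+1) (fun h1 => hsum_sum (index_enum 'I_m.+1) (fun h2 => hsumZ (cst h1 h2) (HM (h1, h2)).1)).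
  apply: eq_hsum => e; rewrite /F (expLap_split gSO uu uu1 Psplit) (ee_lam c e gK) gw_lam big_distrl /=.
  apply: eq_bigr => h1 _; rewrite big_distrl /=; apply: eq_bigr => h2 _.
  rewrite /cst /W -/vp; move: (wt_e _ _ _ _ _ _ _ _ _) (ee _) (ee _) => w1 w2 w3.
  move: (peval _ _) (peval _ _) => z1 z2; ring.
have -> : (2 * a * Num.sqrt D)%:C * (\sum_(h1 < m.+1) \sum_(h2 < m.+1) cst h1 h2 * M (h1, h2)) =
    \sum_(h1 < m.+1) \sum_(h2 < m.+1) cst h1 h2 * ((2 * a * Num.sqrt D)%:C * M (h1, h2)).
  rewrite big_distrr /=; apply: eq_bigr => h1 _; rewrite big_distrr /=; apply: eq_bigr => h2 _; exact: mulrCA.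
have := hsum_sum (index_enum 'I_m.+1) (fun h1 => hsum_sum (index_enum 'I_m.+1) (fun h2 => hsumZ (cst h1 h2) (HM (h1, h2)).2)).
apply: eq_hsum => d; apply: eq_bigr => h1 _; apply: eq_bigr => h2 _.
have w := Wd_E c d gK; have := dual_ptE c d 0; have := dual_ptE c d 1; rewrite /= => -> ->.
rewrite /cst /coef /thetaM_term eeD.
have re (z1 z2 z3 z4 z5 : C) : z1 * (z2 * z3) * (z4 * z5) = z1 * z2 * (z3 * z4) * z5 by ring.
rewrite /Wd in w; rewrite re w {re w} !expr_div_n exprD [(_ ^+ h1 * _ ^+ h2)^-1]invfM.
move: (peval _ _) (ee _) (ee _) (cexp _) ((_ ^+ h1)^-1) ((_ ^+ h2)^-1) (_ ^+ h1) (_ ^+ h2) => z1 z2 z3 z4 z5 z6 z7 z8.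
ring.
Qed.

Lemma intMD k l (K K' : 'M[int]_(k,l)) : intM (K + K') = intM K + intM K' :> 'M[R]_(k,l).
Proof. by apply/matrixP => i j; rewrite !mxE intrD. Qed.

Lemma intMB k l (K K' : 'M[int]_(k,l)) : intM (K - K') = intM K - intM K' :> 'M[R]_(k,l).
Proof. by apply/matrixP => i j; rewrite !mxE intrB. Qed.

Lemma intMM k l s (K : 'M[int]_(k,l)) (K' : 'M[int]_(l,s)) :
  intM (K *m K') = intM K *m intM K' :> 'M[R]_(k,s).
Proof.
apply/matrixP => i j; rewrite !mxE rmorph_sum; apply: eq_bigr => t _ /=.
by rewrite !mxE intrM.
Qed.

Lemma rowzB e e' : rowz (e - e') = rowz e - rowz e'.
Proof. by apply/matrixP => i j; rewrite !mxE /pr; case: ifP. Qed.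

(** The floor only turns pairings known to be integral into elements of [int]. *)
Definition coord (v : 'cV[R]_n) (X : 'M[R]_(n,2)) : int * int :=
  (Num.floor (bil (col 0 X) v), Num.floor (bil (col 1 X) v)).

Lemma pr_coord v X j : bil (col j X) v \is a Num.int -> (pr (coord v X) j)%:~R = bil (col j X) v.
Proof. by case: (ord2P j) => -> /floorK. Qed.

Lemma coordP v X e : (forall j, bil (col j X) v = (pr e j)%:~R) -> coord v X = e.
Proof. by move=> h; rewrite /coord !h !intrKfloor /pr /=; case: e h. Qed.

Let sc := coord u sigma.
Let se := coord u' sigma.

Let scE j : bil (col j sigma) u = (pr sc j)%:~R.
Proof. by rewrite pr_coord//; exact: sigD. Qed.

Let seE j : bil (col j sigma) u' = (pr se j)%:~R.
Proof. by rewrite pr_coord//; exact: sigD. Qed.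

Let sME : sM = sigma - u *m intM (rowz se) - u' *m intM (rowz sc).
Proof.
apply/matrixP => i j; rewrite [in RHS]mxE [in RHS]mxE.
have -> : sM i j = projM u u' (col j sigma) i 0 by rewrite /sM mxE.
by rewrite /projM scE seE !mxE !big_ord1 !mxE !ord1 /= ![u _ _ * _]mulrC ![u' _ _ * _]mulrC.
Qed.

(** * Reindexing sigma + L^2 *)

Section Index.
Variables k k' : 'cV[int]_n.
Hypotheses (uk : u = B *m intM k) (u'k : u' = B *m intM k').

Let lam (K : 'M[int]_(n,2)) := sigma + B *m intM K.
(** [k] and [k'] are the integral coordinates of u and u'. The pairings [se] and [sc] of sigma are
    subtracted because the triple refers to the projection of sigma. *)
Let psi (j : 'M[int]_(n,2) * (int * int) * (int * int)) :=
  j.1.1 + k *m rowz (j.2 - se) + k' *m rowz (j.1.2 - sc).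
Let phi K := (K - k *m rowz (coord u' (lam K) - se) - k' *m rowz (coord u (lam K) - sc), coord u (lam K), coord u' (lam K)).

Let phiK : cancel phi psi.
Proof. by move=> K; rewrite /psi /phi /= addrAC subrK subrK. Qed.

Let lam_psi j : lam (psi j) = lamT j.1.1 j.1.2 j.2.
Proof.
rewrite /lam /psi /lamT /base sME !rowzB !intMD !intMM !intMB !mulmxDr !mulmxA -uk -u'k !mulmxN.
move: (u *m _) (u *m _) (u' *m _) (u' *m _) (B *m _) => x1 x2 x3 x4 x5.
by apply/matrixP => i l; rewrite !mxE; ring.
Qed.

Let inLatM v (X : 'M[R]_(n,2)) j : inLat B v -> (exists K, X = B *m intM K) -> bil (col j X) v \is a Num.int.
Proof.
move=> vL [K ->]; case: LB => _ [h _]; apply: h => //; exists (col j K).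
by rewrite col_mulmx; congr (_ *m _); apply/matrixP => i l; rewrite !mxE.
Qed.

Let coord_lam v K j : inLat B v -> bil (col j (lam K)) v = (pr (coord v (lam K)) j)%:~R.
Proof.
move=> vL; rewrite pr_coord// /lam colD bilDl rpredD//; first exact: sigD.
by apply: inLatM => //; exists K.
Qed.

Let guard_phi K : guard (phi K).1.1.
Proof.
have E : B *m intM (phi K).1.1 = lam K - u *m intM (rowz (coord u' (lam K))) - u' *m intM (rowz (coord u (lam K))) - sM.
  have := lam_psi (phi K); rewrite phiK /lamT /base => h; rewrite [X in X - _ - _ - _]h {h}.
  have -> : (phi K).1.2 = coord u (lam K) by [].
  have -> : (phi K).2 = coord u' (lam K) by [].
  by move: (u *m _) (u' *m _) (B *m _) sM => x1 x2 x3 x4; apply/matrixP => i l; rewrite !mxE; ring.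
apply/forallP => j; rewrite E.
have cB (X Y : 'M[R]_(n,2)) : col j (X - Y) = col j X - col j Y by apply/matrixP => i l; rewrite !mxE.
have [h1 h2] := projM_perp (col j sigma).
rewrite !cB !bilBl !col_mulr !bilZl /sM col_projM h1 h2 uu u'u' uu1 (bilC u') uu1 !coord_lam//.
by rewrite !mulr0 !mulr1 !subr0 !subrr eqxx.
Qed.

Let psiK j : guard j.1.1 -> phi (psi j) = j.
Proof.
move=> gj; rewrite /phi lam_psi.
rewrite (coordP (v := u) (e := j.1.2)) => [|l]; last exact: c_lam.
rewrite (coordP (v := u') (e := j.2)) => [|l]; last exact: e_lam.
by rewrite /psi addrAC addrK addrK; case: j {gj} => -[].
Qed.

Lemma hsum_reindex (S : C) (f : 'M[R]_(n,2) -> C) :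
  hsum (fun K => f (sigma + B *m intM K)) S ->
  hsum (fun j : 'M[int]_(n,2) * (int * int) * (int * int) => if guard j.1.1 then f (lamT j.1.1 j.1.2 j.2) else 0) S.
Proof.
move=> h; apply: (@hsum_inj _ _ _ phi); first exact: can_inj phiK.
  by move=> j; case: ifP => [gj _|]; [exists (psi j); rewrite psiK | rewrite eqxx].
by apply: eq_hsum h => K; rewrite guard_phi -lam_psi phiK.
Qed.

End Index.

(** * Gaussian majorants on both sides *)

Let dl : R := pi * (D / (p + r)).

Let r0 : 0 < r. Proof. by move: p0 D0; rewrite /D; nra. Qed.

Let dl0 : 0 < dl. Proof. by rewrite mulr_gt0 ?pi_gt0// divr_gt0// addr_gt0. Qed.

(** Changing the sign on z yields the Euclidean majorant of the form. *)
Let gram (x x' : 'cV[R]_n) :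
  bil (Pzp g *m x) (Pzp g *m x') - bil (Pz g *m x) (Pz g *m x') = \sum_(i < n) (g *m x) i 0 * (g *m x') i 0.
Proof.
rewrite -(bil_g gSO (Pzp g *m x)) -(bil_g gSO (Pz g *m x)) !(g_Pz gSO) !bilE -sumrB.
apply: eq_bigr => i _; rewrite !(g_Pzp_row gSO) !P0_row; case: ifP => _; rewrite ?mul0r ?mulr0 ?subr0 ?mul1r//.
by rewrite sub0r mulN1r opprK.
Qed.

Let ImD (x z : C) : complex.Im (x + z) = complex.Im x + complex.Im z.
Proof. by case: x; case: z. Qed.

Let ImZ (x : R) (z : C) : complex.Im (x%:C * z) = x * complex.Im z.
Proof. by case: z => z1 z2 /=; rewrite mul0r addr0. Qed.

Let Im_expo X : complex.Im (expo X) = 2^-1 * \sum_(i < n) qf p q r ((g *m X) i 0) ((g *m X) i 1).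
Proof.
pose G i j := \sum_(k < n) (g *m X) k i * (g *m X) k j.
have gE i j : qpair (Pzp g *m X) i j - qpair (Pz g *m X) i j = 2^-1 * G i j.
  rewrite !qpairE !col_mulmx -mulrBr gram; congr (_ * _); apply: eq_bigr => k _.
  by rewrite -!col_mulmx !mxE.
have -> : \sum_(i < n) qf p q r ((g *m X) i 0) ((g *m X) i 1) = p * G 0 0 + q * G 0 1 + (q * G 1 0 + r * G 1 1).
  rewrite /G 4!big_distrr -!big_split /=; apply: eq_bigr => k _; rewrite /qf.
  by move: ((g *m X) k 0) ((g *m X) k 1) => x0 x1; ring.
have t1 i j : complex.Im (tau i j) = y i j by rewrite mxE.
have t2 i j : complex.Im (conjM tau i j) = - y i j by rewrite !mxE; case: (tau i j).
rewrite /expo !tr2 !toCME !ImD !ImZ !t1 !t2 y10 -/p -/q -/r.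
move: gE; clearbody G; move: (qpair (Pzp g *m X)) (qpair (Pz g *m X)) => Q1 Q2 gE.
have h := gE 0 0; have h1 := gE 0 1; have h2 := gE 1 0; have h3 := gE 1 1.
transitivity ((Q1 0 0 - Q2 0 0) * p + (Q1 0 1 - Q2 0 1) * q + ((Q1 1 0 - Q2 1 0) * q + (Q1 1 1 - Q2 1 1) * r)); first by ring.
by rewrite h h1 h2 h3; ring.
Qed.

Let cabs_ee (z : C) : cabs (ee z) = expR (- (2 * pi * complex.Im z)).
Proof.
rewrite /ee cabs_cexp; congr expR; rewrite -/(toC _) /toC; case: z => z1 z2 /=.
by rewrite !(mulr0, mul0r, addr0, subr0, oppr0, add0r, mulr1, mul1r).
Qed.

Let cabs_ee_expo X : cabs (ee (expo X)) <= expR (- (dl * nrm2 (g *m X))).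
Proof.
rewrite cabs_ee ler_expR lerN2 Im_expo /dl.
have -> (x s : R) : 2 * x * (2^-1 * s) = x * s by field.
rewrite -(mulrA pi) ler_pM2l ?pi_gt0//.
rewrite /nrm2 big_distrr /=; apply: ler_sum => i _.
by rewrite sum2; exact: qf_ge.
Qed.

Let Wm := Pwp g u + Pw g u.

Let Pzp_W : Pzp g *m Wm = Pwp g u.
Proof.
apply: eq_mulmx => x; rewrite -mulmxA /Wm (mulmxDl (Pwp g u)) (Pwp_mul gSO) (Pw_mul gSO uu) mulmxDr mulmxBr mulmxDr -!scalemxAr.
have h1 (z : 'cV[R]_n) : Pzp g *m (Pzp g *m z) = Pzp g *m z by rewrite mulmxA (Pzp_idem gSO).
have h2 (z : 'cV[R]_n) : Pzp g *m (Pz g *m z) = 0 by rewrite mulmxA (Pzp_Pz gSO) mul0mx.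
by rewrite !h1 !h2 scaler0 !addr0.
Qed.

Let Pz_W : Pz g *m Wm = Pw g u.
Proof.
apply: eq_mulmx => x; rewrite -mulmxA /Wm (mulmxDl (Pwp g u)) (Pwp_mul gSO) (Pw_mul gSO uu) mulmxDr mulmxBr mulmxDr -!scalemxAr.
have h1 (z : 'cV[R]_n) : Pz g *m (Pz g *m z) = Pz g *m z by rewrite mulmxA (Pz_idem gSO).
have h2 (z : 'cV[R]_n) : Pz g *m (Pzp g *m z) = 0 by rewrite mulmxA (Pz_Pzp gSO) mul0mx.
by rewrite !h1 !h2 scaler0 subr0 add0r.
Qed.

(** The exponent of Theta_M is that of Theta_L at the projection to w + w^perp, so one estimate
    serves both. *)
Let expoW_E X : expoW X = expo (Wm *m X).
Proof. by rewrite /expo !mulmxA Pzp_W Pz_W. Qed.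

Let gw_E X : gw g u X = g *m (Wm *m X).
Proof. by rewrite /gw /Wm (mulmxDl (Pwp g u)). Qed.

Let cabs_ee_expoW X : cabs (ee (expoW X)) <= expR (- (dl * nrm2 (gw g u X))).
Proof. by rewrite expoW_E gw_E. Qed.

Let Bunit : B \in unitmx. Proof. by case: LB. Qed.

Let nrm2_lam : exists2 A : R, 0 < A & exists A', forall K,
  nrm2 (intM K) <= A * nrm2 (g *m (sigma + B *m intM K)) + A' :> R.
Proof.
pose N1 := nrm2 (invmx B); pose N2 := nrm2 (invmx g).
have N10 : 0 <= N1 by exact: nrm2_ge0. have N20 : 0 <= N2 by exact: nrm2_ge0.
exists (N1 * (2 * N2) + 1); first by rewrite ltr_wpDl// mulr_ge0// mulr_ge0.
exists (N1 * (2 * nrm2 (- sigma))) => K.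
set X := g *m _.
have -> : intM K = invmx B *m (invmx g *m X + - sigma).
  by rewrite /X mulKmx ?(g_unit gSO)// addrC addKr mulKmx.
apply: le_trans (nrm2M _ _) _; rewrite -/N1.
apply: (@le_trans _ _ (N1 * (2 * (N2 * nrm2 X) + 2 * nrm2 (- sigma)))).
  rewrite ler_wpM2l//; apply: le_trans (nrm2D _ _) _; rewrite lerD2r ler_wpM2l//; exact: nrm2M.
have := nrm2_ge0 X; move: (nrm2 X) (nrm2 (- sigma)) => x1 x2 x10; lra.
Qed.

Let bsum_L : bsum (fun K : 'M[int]_(n,2) => cabs (peval (expLap yi P) (g *m (sigma + B *m intM K)) * ee (expo (sigma + B *m intM K)))).
Proof.
have [M M0 hM] := subexp_gauss dl0 (subexp_peval (expLap yi P)).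
have [A A0 [A' hA]] := nrm2_lam.
have dA : 0 < dl / 2 / A by rewrite !divr_gt0.
have := bsumZ (mulr_ge0 M0 (expR_ge0 (dl / 2 / A * A'))) (bsum_gaussM n 2 dA).
apply: le_bsum => K; rewrite cabsM; apply: le_trans (ler_wpM2l (cabs_ge0 _) (cabs_ee_expo _)) _.
apply: le_trans (hM _) _; rewrite -(mulrA M) ler_wpM2l// -expRD ler_expR.
have := ler_wpM2l (ltW dA) (hA K); rewrite mulrDr mulrA divfK ?gt_eqF//.
by move: (nrm2 _) (dl / 2 * _) => x1 x2; lra.
Qed.

(** [al] and [be] are the real part and minus the imaginary part of the entries of c taubar + d. *)
Let al (c d : int * int) j : R := (pr c 0)%:~R * complex.Re (tau 0 j) + (pr c 1)%:~R * complex.Re (tau 1 j) + (pr d j)%:~R.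
Let be (c : int * int) j : R := (pr c 0)%:~R * y 0 j + (pr c 1)%:~R * y 1 j.

Let avecE c d j : avec c d j = (al c d j)%:C - 'i * (be c j)%:C.
Proof.
have tE i : tb i j = (complex.Re (tau i j))%:C - 'i * (y i j)%:C.
  rewrite !mxE; case: (tau i j) => x z /=; apply/eqP; rewrite eq_complex /=.
  by rewrite !(mulr0, mul0r, addr0, subr0, oppr0, add0r, sub0r, mulr1, mul1r) !eqxx.
rewrite /avec /nn !tE /al /be !rcD !rcM !rcz.
by move: (complex.Re _)%:C (complex.Re _)%:C (y 0 j)%:C (y 1 j)%:C ('i)%R => *; ring.
Qed.

(** The factors are al + i be and al - i be with be = c y: the mixed terms cancel, and be y^-1 be^t
    = c y c^t. *)
Let tr_real c d : \tr ((Amx c d)^T *m Abmx c d *m toCM yi) =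
  (qf r (- q) p (al c d 0) (al c d 1) / D + qf p q r (pr c 0)%:~R (pr c 1)%:~R)%:C.
Proof.
have beC j : (be c j)%:C = (pr c 0)%:~R * (y 0 j)%:C + (pr c 1)%:~R * (y 1 j)%:C by rewrite rcD !rcM !rcz.
have [v0 v1] := vE c d; rewrite tr_outer v0 v1 !AmxE !avecE !beC y10 -/p -/q -/r.
have DC : D%:C = p%:C * r%:C - q%:C ^+ 2 :> C by rewrite rcB rcM rcX.
have := toC_nz D0; have -> (x1 x2 x3 x4 : R) : (qf r (- q) p x1 x2 / D + qf p q r x3 x4)%:C =
    qf r%:C (- q%:C) p%:C x1%:C x2%:C / D%:C + qf p%:C q%:C r%:C x3%:C x4%:C.
  by rewrite (rcD (_ / _)) (rcM _ D^-1) rcV (qfC r) (qfC p) (rcN q).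
rewrite !rcz DC /qf.
have := ii; move: (al c d 0)%:C (al c d 1)%:C ((pr c 0)%:~R : C) ((pr c 1)%:~R : C) => a1 a2 c1 c2.
move: (p%:C) (q%:C) (r%:C) ('i)%R => pp qq rr I iE Dn.
rewrite [LHS](_ : _ = (pp * rr - qq ^+ 2)^-1 * (rr * a1 ^+ 2 - 2 * qq * a1 * a2 + pp * a2 ^+ 2)
  - (I * I) * (pp * c1 ^+ 2 + 2 * qq * c1 * c2 + rr * c2 ^+ 2)); last by field.
by rewrite iE; field.
Qed.

Let nrm2_rowz c : nrm2 (intM (rowz c)) = (pr c 0)%:~R ^+ 2 + (pr c 1)%:~R ^+ 2 :> R.
Proof. by rewrite /nrm2 big_ord1 sum2 !mxE. Qed.

Let dual_pos : exists2 ka : R, 0 < ka & forall c d,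
  cabs (cexp (- toC (pi / (2 * a)) * \tr ((Amx c d)^T *m Abmx c d *m toCM yi))) <=
  expR (- (ka * (nrm2 (intM (rowz c)) + nrm2 (intM (rowz d))))).
Proof.
have D1 : 0 < r * p - (- q) ^+ 2 by rewrite sqrrN mulrC.
pose d1 := (r * p - (- q) ^+ 2) / (r + p) / D; pose d2 := D / (p + r).
have d10 : 0 < d1 by rewrite !divr_gt0// addr_gt0.
have d20 : 0 < d2 by rewrite divr_gt0// addr_gt0.
pose X : 'M[R]_2 := reM tau; pose x := nrm2 X.
have x0 : 0 <= x by exact: nrm2_ge0.
(* Then 2t <= d1 pays for al, and 2 t x <= d2/2 leaves half of d2 for c itself. *)
pose t := Num.min (d1 / 2) (d2 / (4 * (x + 1))).
have x4 : 0 < 4 * (x + 1) by rewrite mulr_gt0// ltr_wpDl.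
have t0' : 0 < t by rewrite lt_min; apply/andP; split; exact: divr_gt0.
pose k := Num.min t (d2 / 2); have k0 : 0 < k by rewrite lt_min t0' divr_gt0.
have P0 : 0 < pi / (2 * a) by rewrite divr_gt0 ?pi_gt0// mulr_gt0.
exists (pi / (2 * a) * k) => [|c d]; first exact: mulr_gt0.
rewrite cabs_cexp tr_real /toC -rcN -rcM /= ler_expR mulNr lerN2 -(mulrA (pi / _)) ler_pM2l//.
have h1 := qf_ge (al c d 0) (al c d 1) r0 D1; have h2 := qf_ge (pr c 0)%:~R (pr c 1)%:~R p0 D0.
rewrite -/d2 -nrm2_rowz in h2.
have h3 : d1 * ((al c d 0) ^+ 2 + (al c d 1) ^+ 2) <= qf r (- q) p (al c d 0) (al c d 1) / D.
  by rewrite ler_pdivlMr// mulrAC /d1 divfK// gt_eqF.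
have h4 : nrm2 (intM (rowz d)) <= 2 * ((al c d 0) ^+ 2 + (al c d 1) ^+ 2) + 2 * (nrm2 (intM (rowz c)) * x).
  pose Y : 'rV[R]_2 := \row_j al c d j.
  have -> : intM (rowz d) = Y + - (intM (rowz c) *m X).
    by apply/matrixP => i j; rewrite !ord1 ![in RHS]mxE sum2 ![(intM _) _ _]mxE !rowzE ![X _ _]mxE /al addrAC subrr add0r.
  have -> : (al c d 0) ^+ 2 + (al c d 1) ^+ 2 = nrm2 Y by rewrite /nrm2 big_ord1 sum2 !mxE.
  apply: le_trans (nrm2D _ _) _; rewrite lerD2l ler_wpM2l//.
  have -> : nrm2 (- (intM (rowz c) *m X)) = nrm2 (intM (rowz c) *m X).
    by apply: eq_bigr => i _; apply: eq_bigr => j _; rewrite mxE sqrrN.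
  exact: nrm2M.
move: h1 h2 h3 h4; set N1 := nrm2 (intM (rowz c)); set N2 := nrm2 (intM (rowz d)).
set Q1 := qf _ _ _ _ _; set Q2 := qf _ _ _ _ _; set S := _ ^+ 2 + _ ^+ 2 => _ h2 h3 h4.
have N10 : 0 <= N1 by exact: nrm2_ge0. have N20 : 0 <= N2 by exact: nrm2_ge0.
have S0 : 0 <= S by rewrite addr_ge0 ?sqr_ge0.
have kt : k <= t by rewrite ge_min lexx. have kd : k <= d2 / 2 by rewrite ge_min lexx orbT.
have td : t <= d1 / 2 by rewrite ge_min lexx. have tx : t <= d2 / (4 * (x + 1)) by rewrite ge_min lexx orbT.
rewrite ler_pdivlMr// in tx.
have e1 : k * N2 <= t * N2 by rewrite ler_wpM2r.
have e2 : t * N2 <= t * (2 * S + 2 * (N1 * x)) by rewrite ler_wpM2l// ltW.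
have e3 : 2 * t * S <= d1 * S by rewrite ler_wpM2r//; lra.
have e4 : 2 * (t * x) <= d2 / 2 by move: tx; nra.
have e5 : 2 * (t * x) * N1 <= d2 / 2 * N1 by rewrite ler_wpM2r.
have e6 : k * N1 <= d2 / 2 * N1 by rewrite ler_wpM2r.
apply: le_trans (lerD h3 h2); rewrite mulrDr.
apply: le_trans (lerD e6 (le_trans e1 e2)) _; move: e3 e5.
have -> : d2 / 2 * N1 = (d2 * N1) / 2 by rewrite mulrAC.
have -> : t * (2 * S + 2 * (N1 * x)) = 2 * t * S + 2 * (t * x) * N1 by ring.
move: (d1 * S) (d2 * N1) (2 * t * S) (2 * (t * x) * N1) => s1 s2 s3 s4; lra.
Qed.

(* A vector orthogonal to [u] and [u'] is recovered from its components in [w] and [w^perp]. *)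
Let base_rec KM : guard KM -> base KM = (1%:M - u *m (u'^T *m Qf R b)) *m (Wm *m base KM).
Proof.
move=> gK; have key x : bil x u = 0 -> bil x u' = 0 -> x = (1%:M - u *m (u'^T *m Qf R b)) *m (Wm *m x).
  move=> xu xu'; have bz : bil x uz = - bil x uzp.
    have : bil x uzp + bil x uz = 0 by rewrite -bilDr -[uzp + uz](u_split g u).
    by move=> /eqP; rewrite addrC addr_eq0 => /eqP.
  have dx : x = Wm *m x + (bil x uzp / a) *: u.
    have h := decomp gSO uu x; rewrite -/uz -/uzp -/a bz in h.
    rewrite mulNr scaleNr in h.
 rewrite opprK in h.
    rewrite -addrA -scalerDr in h.
    by rewrite {1}h /Wm (mulmxDl (Pwp g u)) -[uzp + uz](u_split g u).
  have : bil (Wm *m x) u' + bil x uzp / a = 0.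
    by have := congr1 (fun z => bil z u') dx; rewrite /= xu' bilDl bilZl uu1 mulr1.
  move=> /eqP; rewrite addrC addr_eq0 => /eqP h; rewrite {1}dx h mulmxBl mul1mx -mulmxA scaleNr; congr (_ - _).
  have -> : u'^T *m Qf R b *m (Wm *m x) = (bil (Wm *m x) u')%:M by rewrite bilC /bil -mx11_scalar.
  by rewrite mul_mx_scalar.
apply/matrixP => i j; have [h1 h2] := base_perp j gK.
by have := congr1 (fun z : 'cV[R]_n => z i 0) (key _ h1 h2); rewrite -!col_mulmx !mxE.
Qed.

(** The argument of Theta_M is lam_M shifted by -muM c, so it bounds lam_M only together with c. *)
Let nrm2_KM : exists2 A : R, 0 < A & exists A', forall KM c, guard KM ->
  nrm2 (intM KM) <= A * (nrm2 (gw g u (lbf KM c)) + nrm2 (intM (rowz c))) + A' :> R.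
Proof.
pose E := 1%:M - u *m (u'^T *m Qf R b).
pose N1 := nrm2 (invmx B); pose N2 := nrm2 E; pose N3 := nrm2 (invmx g); pose N4 := nrm2 (Wm *m muM).
have [N10 N20 N30 N40] : [/\ 0 <= N1, 0 <= N2, 0 <= N3 & 0 <= N4] by split; exact: nrm2_ge0.
pose A := N1 * (2 * (N2 * (2 * N3 + 2 * N4))) + 1.
exists A; first by rewrite ltr_wpDl// mulr_ge0// mulr_ge0// mulr_ge0// addr_ge0// mulr_ge0.
exists (N1 * (2 * nrm2 (- sM))) => KM c gK.
have e1 : Wm *m base KM = invmx g *m gw g u (lbf KM c) + Wm *m muM *m intM (rowz c).
  by rewrite gw_E mulKmx ?(g_unit gSO)// -mulmxA -mulmxDr /lbf subrK.
have -> : intM KM = invmx B *m (E *m (Wm *m base KM) + - sM).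
  by rewrite -base_rec// /base addrC addKr mulKmx.
rewrite e1; set X := gw g u _; set c' := intM (rowz c).
have x0 : 0 <= nrm2 X by exact: nrm2_ge0. have c0 : 0 <= nrm2 c' by exact: nrm2_ge0.
have h1 : nrm2 (invmx g *m X + Wm *m muM *m c') <= (2 * N3 + 2 * N4) * (nrm2 X + nrm2 c').
  apply: le_trans (nrm2D _ _) _; have l1 := nrm2M (invmx g) X; have l2 := nrm2M (Wm *m muM) c'.
  apply: (@le_trans _ _ (2 * (N3 * nrm2 X) + 2 * (N4 * nrm2 c'))); first by apply: lerD; rewrite ler_wpM2l.
  by move: (nrm2 X) (nrm2 c') x0 c0 => s t s0 t00; nra.
have h2 : nrm2 (E *m (invmx g *m X + Wm *m muM *m c')) <= N2 * ((2 * N3 + 2 * N4) * (nrm2 X + nrm2 c')).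
  by apply: le_trans (nrm2M _ _) _; rewrite ler_wpM2l.
apply: le_trans (nrm2M _ _) _; rewrite -/N1.
have h3 := nrm2D (E *m (invmx g *m X + Wm *m muM *m c')) (- sM).
have h4 := ler_wpM2l N10 h3; apply: le_trans h4 _.
have h5 := ler_wpM2l N10 h2; rewrite /A.
move: (nrm2 (E *m _)) (nrm2 (- sM)) (nrm2 X + nrm2 c') (addr_ge0 x0 c0) h5 => s1 s2 s3 s30 h5.
rewrite (_ : N1 * (2 * s1 + 2 * s2) = 2 * (N1 * s1) + N1 * (2 * s2)); last by ring.
rewrite (_ : _ * s3 = 2 * (N1 * (N2 * ((2 * N3 + 2 * N4) * s3))) + s3); last by ring.
by move: (N1 * s1) (N1 * (N2 * _)) h5 => s4 s5 h5; lra.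
Qed.

Let T : choiceType := ('M[int]_(n,2) * (int * int) * (int * int))%type.
Let NT (j : T) : R := nrm2 (gw g u (lbf j.1.1 j.1.2)) + nrm2 (intM (rowz j.1.2)) + nrm2 (intM (rowz j.2)).

Let NT0 j : 0 <= NT j.
Proof. by rewrite !addr_ge0 ?nrm2_ge0. Qed.

Let bsum_NT d : 0 < d -> bsum (fun j : T => if guard j.1.1 then expR (- (d * NT j)) else 0).
Proof.
move=> d0; have [A A0 [A' hA]] := nrm2_KM.
(* Since s A <= 1/2, the bound on K spends at most half of the decay in c and leaves the other half
   for summing over c. *)
pose s : R := (2 * (A + 1))^-1.
have A1 : 0 < 2 * (A + 1) by rewrite mulr_gt0// addr_gt0.
have s0 : 0 < s by rewrite invr_gt0.
have ds : 0 < d * s by rewrite mulr_gt0.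
have d2 : 0 < d / 2 by rewrite divr_gt0.
pose f1 (K : 'M[int]_(n,2)) : R := expR (- (d * s * nrm2 (intM K))).
pose f2 (c : int * int) : R := expR (- (d / 2 * nrm2 (intM (rowz c)))).
have b1 : bsum f1 by exact: bsum_gaussM.
have b2 : bsum f2.
  by apply: (@bsum_gauss2 _ _ (d / 2) 0 0 0 d2) => k; rewrite /f2 nrm2_rowz !mul0r !addr0.
have p1 K : 0 <= f1 K by exact: expR_ge0.
have p2 c : 0 <= f2 c by exact: expR_ge0.
have p12 i : 0 <= f1 i.1 * f2 i.2 by exact: mulr_ge0.
have := bsumZ (expR_ge0 (d * s * A')) (bsumM p12 p2 (bsumM p1 p2 b1 b2) b2).
apply: le_bsum => -[[K c] e] /=; case: ifP => gK; last exact: mulr_ge0 (expR_ge0 _) (mulr_ge0 (p12 (K, c)) (p2 e)).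
rewrite /f1 /f2 -!expRD ler_expR /NT /=.
have := hA K c gK; have := nrm2_ge0 (gw g u (lbf K c)).
have := nrm2_ge0 (intM (rowz c) : 'M[R]_(1,2)); have := nrm2_ge0 (intM (rowz e) : 'M[R]_(1,2)).
move: (nrm2 (intM (rowz e))) (nrm2 (intM (rowz c))) (nrm2 (gw g u (lbf K c))) (nrm2 (intM K)) => x1 x2 x3 x4 h1 h2 h3 h4.
have h5 : s * (A * (x3 + x2)) <= (x3 + x2) / 2.
  rewrite mulrA [leRHS]mulrC ler_wpM2r ?addr_ge0// /s invfM -mulrA ler_piMr ?invr_ge0//.
  by rewrite mulrC ler_pdivrMr ?addr_gt0//; lra.
have h6 := ler_wpM2l (ltW s0) h4; rewrite mulrDr in h6.
have h7 := ler_wpM2l (ltW d0) (le_trans h6 (lerD h5 (lexx _))).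
have dx1 : 0 <= d * x1 by rewrite mulr_ge0// ltW.
have dx3 : 0 <= d * x3 by rewrite mulr_ge0// ltW.
move: h7; rewrite [d * (s * x4)]mulrA [d * (_ + s * A')]mulrDr [d * (s * A')]mulrA.
have -> : d * ((x3 + x2) / 2) = d * x3 / 2 + d * x2 / 2 by field.
have -> : d / 2 * x2 = d * x2 / 2 by rewrite mulrAC.
have -> : d / 2 * x1 = d * x1 / 2 by rewrite mulrAC.
rewrite !(mulrDr d); move: (d * s * x4) (d * s * A') (d * x1) (d * x2) (d * x3) dx1 dx3 => y1 y2 y3 y4 y5; lra.
Qed.

Let bsum_dual f ka : 0 < ka -> subexp NT f ->
  bsum (fun j : T => if guard j.1.1 then cabs (f j) * expR (- (ka * NT j)) else 0).
Proof.
move=> ka0 hf; have [M M0 hM] := subexp_gauss ka0 hf.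
have k2 : 0 < ka / 2 by rewrite divr_gt0.
apply: le_bsum (bsumZ M0 (bsum_NT k2)) => j.
by case: ifP => _; [exact: hM | rewrite mulr0].
Qed.

Let subexp_gw h1 h2 : subexp NT (fun j => peval (expLap yi (Ps h1 h2)) (gw g u (lbf j.1.1 j.1.2))).
Proof.
move=> e e0; have [M M0 hM] := subexp_peval (expLap yi (Ps h1 h2)) e0; exists M => // j.
apply: le_trans (hM _) _; rewrite ler_wpM2l// ler_expR ler_pM2l// /NT -addrA lerDl.
by rewrite addr_ge0 ?nrm2_ge0.
Qed.

Let subexp_c i : subexp NT (fun j => (pr j.1.2 i)%:~R).
Proof.
have h e : ((pr e i)%:~R : R) ^+ 2 <= nrm2 (intM (rowz e)).
  by rewrite nrm2_rowz; case: (ord2P i) => ->; rewrite ?lerDl ?lerDr sqr_ge0.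
move=> e e0; have [|M M0 hM] := subexp_real NT0 (f := fun j => (pr j.1.2 i)%:~R) _ e0.
  by move=> j; apply: le_trans (h _) _; rewrite /NT addrAC lerDr addr_ge0 ?nrm2_ge0.
by exists M => // j; rewrite -rcz; exact: hM.
Qed.

Let subexp_d i : subexp NT (fun j => (pr j.2 i)%:~R).
Proof.
have h e : ((pr e i)%:~R : R) ^+ 2 <= nrm2 (intM (rowz e)).
  by rewrite nrm2_rowz; case: (ord2P i) => ->; rewrite ?lerDl ?lerDr sqr_ge0.
move=> e e0; have [|M M0 hM] := subexp_real NT0 (f := fun j => (pr j.2 i)%:~R) _ e0.
  by move=> j; apply: le_trans (h _) _; rewrite /NT lerDr addr_ge0 ?nrm2_ge0.
by exists M => // j; rewrite -rcz; exact: hM.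
Qed.

Let subexp_avec i : subexp NT (fun j => avec j.1.2 j.2 i).
Proof.
apply: (subexpD (f := fun j => nn j.1.2 i)) (subexp_d i).
apply: (subexpD (f := fun j => _ * _) (g := fun j => _ * _)).
  exact: subexpM (subexp_c 0) (subexp_cst NT0 _).
exact: subexpM (subexp_c 1) (subexp_cst NT0 _).
Qed.

Let subexp_v i : subexp NT (fun j => (Abmx j.1.2 j.2 *m toCM yi) 0 i).
Proof.
have h : subexp NT (fun j => avec j.1.2 j.2 0 * toCM yi 0 i + avec j.1.2 j.2 1 * toCM yi 1 i).
  exact: subexpD (subexpM (subexp_avec 0) (subexp_cst NT0 _)) (subexpM (subexp_avec 1) (subexp_cst NT0 _)).
move=> e e0; have [M M0 hM] := h e e0; exists M => // j; suff -> : (Abmx j.1.2 j.2 *m toCM yi) 0 i =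
    avec j.1.2 j.2 0 * toCM yi 0 i + avec j.1.2 j.2 1 * toCM yi 1 i by exact: hM.
by rewrite mxE sum2 !AbmxE.
Qed.

Let cabs_thetaM_term KM c d h1 h2 : cabs (thetaM_term KM c d h1 h2) <=
  cabs (peval (expLap yi (Ps h1 h2)) (gw g u (lbf KM c))) * expR (- (dl * nrm2 (gw g u (lbf KM c)))).
Proof.
rewrite cabsM ler_wpM2l ?cabs_ge0//; apply: le_trans (cabs_ee_expoW _).
rewrite !cabs_ee; have -> // (z : C) t : complex.Im (z - toC t) = complex.Im z.
by case: z => ? ? /=; rewrite subr0.
Qed.

Let bsum_thetaM c d h1 h2 : bsum (fun KM => cabs (if guard KM then thetaM_term KM c d h1 h2 else 0)).
Proof.
(* For fixed (c, d) the Gaussian in c and d is a constant; multiplying it back reduces the claim to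
   a slice of the sum over all triples. *)
pose K := expR (dl * (nrm2 (intM (rowz c)) + nrm2 (intM (rowz d)))).
have gI : injective (fun KM : 'M[int]_(n,2) => (KM, c, d) : T) by move=> x z [].
have := bsumZ (expR_ge0 _ : 0 <= K) (bsum_inj gI (bsum_dual dl0 (subexp_gw h1 h2))).
apply: le_bsum => KM /=; case: ifP => _; last by rewrite cabs0 mulr0.
apply: le_trans (cabs_thetaM_term _ _ _ _ _) _.
rewrite mulrCA ler_wpM2l ?cabs_ge0// /K -expRD ler_expR /NT /=.
by have -> (x z w : R) : dl * (z + w) - dl * (x + z + w) = - (dl * x) by ring.
Qed.

Let dual_term (j : T) : C := if guard j.1.1 then
  \sum_(h1 < m.+1) \sum_(h2 < m.+1) coef j.1.2 j.2 h1 h2 * thetaM_term j.1.1 j.1.2 j.2 h1 h2 else 0.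

(** The outer exponential decays in (c, d), the Theta_M term in its own argument; the smaller rate
    gives a Gaussian in [NT], which absorbs the polynomial factors. *)
Let bsum_dual_term : bsum (fun j => cabs (dual_term j)).
Proof.
have [ka ka0 hka] := dual_pos.
pose k := Num.min ka dl; have k0 : 0 < k by rewrite lt_min ka0 dl0.
pose f (h1 h2 : 'I_m.+1) (j : T) := ((Abmx j.1.2 j.2 *m toCM yi) 0 0 ^+ h1 * (Abmx j.1.2 j.2 *m toCM yi) 0 1 ^+ h2) *
  ((- (2%:R * 'i)) ^+ (h1 + h2))^-1 * peval (expLap yi (Ps h1 h2)) (gw g u (lbf j.1.1 j.1.2)).
have sf h1 h2 : subexp NT (f h1 h2).
  apply: subexpM (subexp_gw h1 h2); apply: subexpM (subexp_cst NT0 _).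
  exact: subexpM (subexpX NT0 h1 (subexp_v 0)) (subexpX NT0 h2 (subexp_v 1)).
have := bsum_sum (index_enum 'I_m.+1) (fun h1 => bsum_sum (index_enum 'I_m.+1) (fun h2 => bsum_dual k0 (sf h1 h2))).
apply: le_bsum => j; rewrite /dual_term; case: ifP => _; last first.
  by rewrite cabs0 sumr_ge0// => h1 _; rewrite sumr_ge0.
apply: le_trans (cabs_sum _ _) _; apply: ler_sum => h1 _.
apply: le_trans (cabs_sum _ _) _; apply: ler_sum => h2 _.
rewrite cabsM /coef 2!cabsM /f 2!(cabsM (_ * _)).
set w := cabs (cexp _); set x := cabs (_ * _); set z := cabs (_^-1).
have x0 : 0 <= x * z by rewrite mulr_ge0 ?cabs_ge0.
have hw : w <= expR (- (ka * (nrm2 (intM (rowz j.1.2)) + nrm2 (intM (rowz j.2))))) by exact: hka.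
have ht := cabs_thetaM_term j.1.1 j.1.2 j.2 h1 h2.
set v := cabs (thetaM_term _ _ _ _ _) in ht *; set pv := cabs (peval _ _) in ht *.
have h := ler_wpM2r x0 (ler_pM (cabs_ge0 _ : 0 <= w) (cabs_ge0 _ : 0 <= v) hw ht).
have -> : w * x * z * v = w * v * (x * z) by ring.
apply: le_trans h _; set E1 := expR _; set E2 := expR (- (dl * _)).
have -> : E1 * (pv * E2) * (x * z) = (x * z * pv) * (E1 * E2) by ring.
apply: ler_wpM2l; first by rewrite mulr_ge0 ?cabs_ge0.
rewrite /E1 /E2 -expRD ler_expR /NT.
have kka : k <= ka by rewrite ge_min lexx. have kdl : k <= dl by rewrite ge_min lexx orbT.
have l1 := ler_wpM2r (nrm2_ge0 (gw g u (lbf j.1.1 j.1.2))) kdl.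
have cd0 : 0 <= nrm2 (intM (rowz j.1.2)) + nrm2 (intM (rowz j.2)) :> R by rewrite addr_ge0 ?nrm2_ge0.
have l2 := ler_wpM2r cd0 kka.
move: l1 l2; rewrite -[X in _ <= - (k * X)]addrA [k * (_ + (_ + _))]mulrDr.
by move: (k * _) (k * _) (dl * _) (ka * _) => x1 x2 x3 x4; lra.
Qed.

Let V_ex (i : 'M[int]_(n,2) * (int * int)) : exists V,
  hsum (fun e => if guard i.1 then F i.1 i.2 e else 0) V /\
  hsum (fun d => dual_term (i, d)) ((2 * a * Num.sqrt D)%:C * V).
Proof.
rewrite /dual_term /=; case gK: (guard i.1); first by have [V hV] := inner_sum i.2 gK; exists V.
by exists 0; rewrite mulr0; split; exact: hsum0.
Qed.

(** Fubini on both sides: for each (lam_M, c) the row sums over e and over d differ by the same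
    constant, so the total sums do. *)
Let dual_sum : exists2 S,
  hsum (fun K => peval (expLap yi P) (g *m (sigma + B *m intM K)) * ee (expo (sigma + B *m intM K))) S &
  hsum dual_term ((2 * a * Num.sqrt D)%:C * S).
Proof.
have [S hS] := hsum_ex bsum_L; exists S => //.
have [k uk] := uL; have [k' u'k] := u'L.
have h1 := hsum_reindex uk u'k (f := fun X => peval (expLap yi P) (g *m X) * ee (expo X)) hS.
have /boolp.choice[V hV] i := V_ex i.
have h2 := hsum_fubini (f := fun i e => if guard i.1 then F i.1 i.2 e else 0) h1 (fun i => (hV i).1).
have [S' hS'] := hsum_ex bsum_dual_term.
have h3 := hsum_fubini (f := fun i d => dual_term (i, d)) (h := fun i => (2 * a * Num.sqrt D)%:C * V i) (S := S').
have -> // : (2 * a * Num.sqrt D)%:C * S = S'.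
apply: (hsum_unique (hsumZ _ h2)); apply: h3 => [|i]; last exact: (hV i).2.
by apply: eq_hsum hS' => -[].
Qed.

(** * Assembly over pairs (c, d) *)

Let CDm (cd : (int * int) * (int * int)) : 'M[int]_2 := \matrix_(i, j) pr (if i == 0 then cd.1 else cd.2) j.
Let CDp (CD : 'M[int]_2) : (int * int) * (int * int) := ((CD 0 0, CD 0 1), (CD 1 0, CD 1 1)).

Let CDmK : cancel CDm CDp.
Proof. by case=> -[c1 c2] [d1 d2]; rewrite /CDp !mxE. Qed.

Let CDpK : cancel CDp CDm.
Proof. by move=> CD; apply/matrixP => i j; rewrite !mxE /pr; case: (ord2P i) => ->; case: (ord2P j) => ->. Qed.

Let row_CDm cd : row 0 (CDm cd) = rowz cd.1 /\ row 1 (CDm cd) = rowz cd.2.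
Proof. by split; apply/matrixP => i j; rewrite !mxE. Qed.

Lemma theta_split : ThetaL B g tau P sigma = toC ((2 * a)^-1) *
  zsum (fun CD : 'M[int]_(2, 2) =>
     let c := row 0 CD in
     let d := row 1 CD in
     let A := toCM (intM c) *m tau + toCM (intM d) in
     let Ab := toCM (intM c) *m conjM tau + toCM (intM d) in
     let v := Ab *m toCM yi in
     \sum_(h1 < m.+1) \sum_(h2 < m.+1)
       cexp (- toC (pi / (2 * a)) * \tr (A^T *m Ab *m toCM yi)) *
       (v 0 0 ^+ h1 * v 0 1 ^+ h2) / (- (2%:R * 'i)) ^+ (h1 + h2) *
       ThetaM B g u u' tau (muM *m intM d) (- (muM *m intM c)) (Ps h1 h2)
         (projMpair u u' sigma)).
Proof.
have [S hS hD] := dual_sum.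
have LE : ThetaL B g tau P sigma = toC D * S.
  by rewrite /ThetaL -/y detY; congr (_ * _); exact: zsumE hS.
have /boolp.choice[W' hW] (x : ((int * int) * (int * int)) * ('I_m.+1 * 'I_m.+1)) := hsum_ex (bsum_thetaM x.1.1 x.1.2 x.2.1 x.2.2).
have ME c d (h1 h2 : 'I_m.+1) : ThetaM B g u u' tau (muM *m intM (rowz d)) (- (muM *m intM (rowz c))) (Ps h1 h2) (projMpair u u' sigma) =
    toC (Num.sqrt D) * W' ((c, d), (h1, h2)).
  by rewrite /ThetaM -/y detY; congr (_ * _); exact: zsumE (hW ((c, d), (h1, h2))).
pose Z cd := \sum_(h1 < m.+1) \sum_(h2 < m.+1) coef cd.1 cd.2 h1 h2 * W' (cd, (h1, h2)).
have hZ : hsum Z ((2 * a * Num.sqrt D)%:C * S).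
  apply: (hsum_fubini (f := fun cd KM => dual_term ((KM, cd.1), cd.2))).
    apply: (hsum_bij (g := fun j : T => ((j.1.2, j.2), j.1.1)) (g' := fun x => ((x.2, x.1.1), x.1.2))).
    - by case=> -[].
    - by case=> -[].
    - by apply: eq_hsum hD => -[[]].
  move=> [c d]; have := hsum_sum (index_enum 'I_m.+1) (fun h1 => hsum_sum (index_enum 'I_m.+1) (fun h2 => hsumZ (coef c d h1 h2) (hW ((c, d), (h1, h2))))).
  apply: eq_hsum => KM; rewrite /dual_term /=; case: ifP => // _.
  by rewrite big1// => h1 _; rewrite big1// => h2 _; rewrite mulr0.
set f := fun CD => _.
have hf : hsum f (toC (Num.sqrt D) * ((2 * a * Num.sqrt D)%:C * S)).
  apply: (hsum_bij (g := CDm) (g' := CDp)); rewrite ?/(cancel _ _)//.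
  apply: eq_hsum (hsumZ (toC (Num.sqrt D)) hZ) => -[c d].
  have [r1 r2] := row_CDm (c, d); rewrite /f r1 r2 /Z big_distrr /=; apply: eq_bigr => h1 _.
  rewrite big_distrr /=; apply: eq_bigr => h2 _; rewrite ME mulrCA; congr (_ * _).
rewrite (zsumE hf) LE.
(* One root of det y is the weight of Theta_M, the other belongs to the Poisson constant 2 a
   sqrt(D). *)
have sD : D = Num.sqrt D * Num.sqrt D by rewrite -expr2 sqr_sqrtr// ltW.
rewrite /toC {1}sD rcV !rcM rcn; have := toC_nz a0.
by move: ((Num.sqrt D)%:C) (a%:C) => s A An; field.
Qed.

End ThetaSplit.

Theorem mainTheorem13 (R : realType) (b : nat)
  (B : 'M[R]_b.+2) (u u' : 'cV[R]_b.+2) (m : nat)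
  (P : mpoly.mpoly (b.+2 * 2) R[i]) (g : 'M[R]_b.+2) (tau : 'M[R[i]]_2)
  (Ps : 'I_m.+1 -> 'I_m.+1 -> mpoly.mpoly (b.+2 * 2) R[i])
  (sigma : 'M[R]_(b.+2, 2)) :
  even_lattice B ->
  inLat B u -> inLat B u' -> bil u u = 0 -> bil u' u' = 0 -> bil u u' = 1 ->
  very_homog m P -> isSO g -> siegel tau -> split_polys g u P Ps ->
  cols (inDual B) sigma ->
  let uz := Pz g *m u in
  let uzp := Pzp g *m u in
  let mu := - u' + (2 * bil uzp uzp)^-1 *: uzp + (2 * bil uz uz)^-1 *: uz in
  let muM := projM u u' mu in
  let yi := invmx (imM tau) in
  ThetaL B g tau P sigma =
  toC ((2 * bil uzp uzp)^-1) *
  zsum (fun CD : 'M[int]_(2, 2) =>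
     let c := row 0 CD in
     let d := row 1 CD in
     let A := toCM (intM c) *m tau + toCM (intM d) in
     let Ab := toCM (intM c) *m conjM tau + toCM (intM d) in
     let v := Ab *m toCM yi in
     \sum_(h1 < m.+1) \sum_(h2 < m.+1)
       cexp (- toC (pi / (2 * bil uzp uzp)) * \tr (A^T *m Ab *m toCM yi)) *
       (v 0 0 ^+ h1 * v 0 1 ^+ h2) / (- (2%:R * 'i)) ^+ (h1 + h2) *
       ThetaM B g u u' tau (muM *m intM d) (- (muM *m intM c)) (Ps h1 h2)
         (projMpair u u' sigma)).
Proof.
move=> LB uL u'L uu u'u' uu1 _ gSO tauS Psplit sigD.
exact: (theta_split LB uL u'L uu u'u' uu1 gSO tauS Psplit sigD).
Qed.
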